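(* The learning graph $\mathcal G$ for $\mathsf{Triangle}$ described in the context, with $|X|=x$, $|A|=a$, $|B|=b$, using $\mathsf{Load}=\mathsf{SparseLoad}$, has complexity over graphs with $m$ edges $$O\left(\sqrt{\left(xm+(ax)^2\cdot\frac m{n^2}+\left(\frac na\right)^2\left(a\cdot x^2\cdot\frac m{n^2}+n\left(b^2\cdot\frac m{n^2}+\left(\frac ab\right)^2\left(b+\frac{b^2}{x}\right)\right)\right)\right)\log n}\right).$$ In particular, taking $a=n^{3/4}$ and $b=x=\sqrt n/(m/n^2)^{1/3}$ leads to a complexity of $O(n^{11/12}m^{1/6}\sqrt{\log n})$ when $m\ge n^{5/4}$.
   Context: **Problem.** An undirected graph $G$ on vertex set $V=[n]$ is encoded by $z\in\{0,1\}^N$, $N=\binom n2$, with $z_{ij}=1$ iff $ij$ is an edge. $\mathsf{Triangle}(G)=1$ iff $G$ has a triangle; the inputs are the graphs with $m$ edges. $N_u$ is the neighborhood of $u$ in $G$, and $N_{u,v}=N_u\cap N_v$. The parameters satisfy $1\le x\le n$ and $2\le b\le a\le n$. **Learning graphs.** Let $f:Z\to\{0,1\}$, $Z\subseteq\{0,1\}^N$, $Y=f^{-1}(1)$; $z_S$ is the restriction of $z$ to $S$ and $|z_S|$ its Hamming weight. A $1$-certificate for $f$ on $y\in Y$ is $I\subseteq[N]$ with $f(z)=1$ for every $z\in Z$ with $z_I=y_I$. An (extended) learning graph for $f$ is a rooted directed acyclic graph $(\mathcal V,\mathcal E)$ with: (i) vertex labels $\mathcal S(v)\subseteq[N]$,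 the root being labelled $\emptyset$, and $\mathcal S(v)=\mathcal S(u)\cup\{j\}$ for some $j\notin\mathcal S(u)$ for each edge $(u,v)$ (the edge loads $j$); (ii) weights $w_z^b(u,v)\ge0$ ($z\in Z$, $b\in\{0,1\}$) depending on $z$ only through $z_{\mathcal S(v)}$, with $w_x^0(u,v)=w_y^1(u,v)$ whenever $x\in Z\setminus Y$, $y\in Y$, $x_{\mathcal S(u)}=y_{\mathcal S(u)}$ and $x_j\ne y_j$, where $(u,v)$ loads $j$; (iii) for each $y\in Y$, a unit flow $p_y\ge0$ from the root, zero on edges with $w_y^1=0$, each sink of which has a label containing a $1$-certificate for $f$ on $y$. Put $C^0(\mathcal G,x)=\sum_ew_x^0(e)$, $C^1(\mathcal G,y)=\sum_ep_y(e)^2/w_y^1(e)$, $C^0(\mathcal G)=\max_{x\in f^{-1}(0)}C^0(\mathcal G,x)$, $C^1(\mathcal G)=\max_{y\in f^{-1}(1)}C^1(\mathcal G,y)$. The complexity of $\mathcal G$ is $\sqrt{C^0(\mathcal G)C^1(\mathcal G)}$. Edges between vertices with equal labels (empty transitions) are allowed and contribute to no complexity. **Loading.** For $S=\{s_1,\dots,s_l\}$, $\mathsf{SparseLoad}_S$ is the path loading $s_1,\dots,s_l$ in this order, with unit flow, the edge loading $s_j$ having weight $w^b_z=3(|z_{\{s_1,\dots,s_{j-1}\}}|+1)\log(l+1)$ if $z_{s_j}=b$ and $w_z^b=3l\log(l+1)$ if $z_{s_j}=1-b$. It is used below as a single (super) edge, to be replaced by the path. **OR construction.** Given learning graphs $\mathcal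 G_i$ for functions $f_i$ such that every positive input of $\bigvee_if_i$ is positive for at least $k$ of the $f_i$: join a new root by empty transitions to the root of each $\mathcal G_i$ and multiply all weights in $\mathcal G_i$ by $C^1(\mathcal G_i)/k$. On a positive input the flow is split uniformly among $k$ components with $f_i=1$ and then follows the flow of those $\mathcal G_i$. **Johnson construction** on $k$-subsets of an $s$-element set $W$, with $r=2$, a monotone map $I$ from subsets of $W$ to subsets of $[N]$, and learning graphs $\mathcal G_{A,\lambda}$ to be used when the input restricted to $I(A)$ has been loaded and equals $\lambda$. Stage 0: for each $(k-2)$-subset $A'$ of $W$, a super edge $\mathsf{Load}_{I(A')}$ from the root to a vertex $A'$. Stages $\ell=1,2$: for each $(k-3+\ell)$-subset $A'$ and each $j\in W\setminus A'$, a super edge $\mathsf{Load}_{I(A'\cup\{j\})\setminus I(A')}$ from $A'$ to $A'\cup\{j\}$. Final stage: at each $k$-subset $A$, plug $\mathcal G_{A,z_{I(A)}}$ with weights multiplied by $C^1(\mathcal G_{A,z_{I(A)}})/\binom{s-2}{k-2}$. On a positive input with target pair $T=\{j_1,j_2\}\subseteq W$, the flow goes uniformly to the $A'$ of Stage 0 disjoint from $T$, then adds $j_1$, then $j_2$, and then follows the plugged learning graphs (of the $A\supseteq T$). In each of Stages 0, 1, 2 the weights of each super edge $e$ are multiplied by $c^1(e)/n_{\rm used}$, where $c^1(e)$ is the maximal positive complexity of $e$ for unit flow and $n_{\rm used}$ is the number of super edges of the stage carrying flow on a positive input. **The learning graph $\mathcal G$.** 1. OR over all $x$-subsets $X\subseteq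 V$ of learning graphs $\mathcal G_X$, all computing $\mathsf{Triangle}$ (flow uniform over all $X$). 2. $\mathcal G_X$ is the OR of $\mathcal H_X$, which detects a triangle with a vertex in $X$, and $\mathcal F_X$, which detects a triangle with no vertex in $X$ ($\mathcal F_X$ is needed only when there is no triangle with a vertex in $X$). $\mathcal H_X$ searches a vertex $t\in X$ and then an edge $uv$ forming a triangle with $t$: for each $t\in X$ it learns $N_t$ by loading $\{t\}\times V$ with $\mathsf{SparseLoad}$, and then looks for an edge in $N_t\times N_t$ with negative complexity $|N_t|^2$. 3. $\mathcal F_X$ is the Johnson construction on $a$-subsets $A$ of $V$ with $I(A')=X\times A'$ (all pairs between $X$ and $A'$), target pair two triangle vertices, and plugged learning graphs $\mathcal F_{X,A}$. 4. $\mathcal F_{X,A}$ is the OR over $w\in V$ ($w$ is the third triangle vertex) of $\mathcal F_{X,A,w}$. 5. $\mathcal F_{X,A,w}$ is the Johnson construction on $b$-subsets $B$ of $A$ with $I(B')=\{w\}\times B'$, target pair the two other triangle vertices. 6. The learning graph plugged at $B$ is the OR, over the pairs $(u,v)$ in $\Delta(X,B,w)=\{(u,v)\in B^2: N_{u,v}\cap X=\emptyset,\ u,v\in N_w\}$ (known from the pairs already loaded), of the single-edge learning graph loading $uv$.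
   Formalization: False if b/a or a/n tends to 1 (e.g. a=b=√n, x=1, m≈n²/4), so the O-constant depends on δ>0 with b-1≤(1-δ)a, a-1≤(1-δ)n; in particular: a=⌈n^{3/4}⌉, b=x=⌈c√n/(m/n²)^{1/3}⌉ with c√n/(m/n²)^{1/3}≤κn^{3/4}, κ<1, n large, constant depending on c,κ. *)

(* Defs.v *)
From HB Require Import structures.
From mathcomp Require Import all_boot all_order all_algebra.
From mathcomp Require Import reals exp.

Set Implicit Arguments.
Unset Strict Implicit.
Unset Printing Implicit Defensive.

Import Order.TTheory GRing.Theory Num.Theory.
Local Open Scope ring_scope.

Section LearningGraphs.
Variables (R : realType) (N : finType).

(* An input z in {0,1}^N is represented by the set of the coordinates at which
   it equals 1, so that z_S is z :&: S and |z_S| is #|z :&: S|. *)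
Notation input := {set N}.

Implicit Types (x y z : input) (S lam : {set N}) (Z Y : {set {set N}}).

Definition agree S z z' := z :&: S == z' :&: S.

(* flow y is only meaningful when y is a positive input. *)
Record lgraph := LGraph {
  vert : finType;
  edge : finType;
  src : edge -> vert;
  tgt : edge -> vert;
  root : vert;
  label : vert -> {set N};
  weight : bool -> input -> edge -> R;
  flow : input -> edge -> R }.

(* The edges that are not empty transitions. *)
Definition loading (G : lgraph) (e : edge G) := label (src e) != label (tgt e).

Definition C0 (G : lgraph) x := \sum_(e : edge G | loading e) weight false x e.

Definition C1 (G : lgraph) y :=
  \sum_(e : edge G | loading e) flow y e ^+ 2 / weight true y e.

(* Complexities are nonnegative; the maximum over no input is 0. *)
Definition C0max (G : lgraph) (X : {set {set N}}) :=
  \big[Num.max/0]_(x in X) C0 G x.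

Definition C1max (G : lgraph) Y := \big[Num.max/0]_(y in Y) C1 G y.

Definition positives Z (f : pred {set N}) := [set z in Z | f z].
Definition negatives Z (f : pred {set N}) := [set z in Z | ~~ f z].

Definition complexity Z (f : pred {set N}) (G : lgraph) :=
  Num.sqrt (C0max G (negatives Z f) * C1max G (positives Z f)).

Definition certificate Z (f : pred {set N}) y S :=
  forall z, z \in Z -> agree S z y -> f z.

Definition arc (G : lgraph) : rel (vert G) :=
  fun u v => [exists e : edge G, (src e == u) && (tgt e == v)].

Definition outflow (G : lgraph) y (v : vert G) :=
  \sum_(e : edge G | src e == v) flow y e.
Definition inflow (G : lgraph) y (v : vert G) :=
  \sum_(e : edge G | tgt e == v) flow y e.

Definition unit_flow Z (f : pred {set N}) (G : lgraph) y :=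
  [/\ forall e : edge G, 0 <= flow y e,
      forall e : edge G, loading e -> weight true y e = 0 -> flow y e = 0,
      outflow y (root G) - inflow y (root G) = 1
    & forall v : vert G, v != root G ->
        inflow y v = outflow y v \/
        (outflow y v = 0 /\ certificate Z f y (label v))].

(* Learning graph for the restriction of f to Z. *)
Record is_learning_graph Z (f : pred {set N}) (G : lgraph) : Prop := {
  lg_root : label (root G) = set0;
  lg_label : forall e : edge G,
    label (tgt e) = label (src e) \/
    exists2 j, j \notin label (src e) & label (tgt e) = j |: label (src e);
  lg_rooted : forall v : vert G, connect (@arc G) (root G) v;
  lg_acyclic : forall e : edge G, ~~ connect (@arc G) (tgt e) (src e);
  lg_weight_ge0 : forall b z (e : edge G), z \in Z -> 0 <= weight b z e;
  lg_weight_local : forall b z z' (e : edge G), z \in Z -> z' \in Z ->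
    agree (label (tgt e)) z z' -> weight b z e = weight b z' e;
  lg_weight_dual : forall (e : edge G) j x y,
    j \notin label (src e) -> label (tgt e) = j |: label (src e) ->
    x \in negatives Z f -> y \in positives Z f ->
    agree (label (src e)) x y -> (j \in x) != (j \in y) ->
    weight false x e = weight true y e;
  lg_flow : forall y, y \in positives Z f -> unit_flow Z f G y }.

(* Paths and single edges start at a vertex labelled S0. *)
Definition sparse_load S0 S : lgraph :=
  let s := enum S in
  let l := size s in
  let prefix k := [set j in take k s] in
  @LGraph 'I_l.+1 'I_l
    (fun i => widen_ord (leqnSn l) i) (fun i => lift ord0 i) ord0
    (fun k => S0 :|: prefix k)
    (fun b z i =>
       3 * (if (tnth (in_tuple s) i \in z) == b
            then #|z :&: prefix i|.+1%:R else l%:R) * ln (l.+1%:R : R))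
    (fun _ _ => 1).

(* U is a singleton, or is empty when there is nothing left to load. *)
Definition single_edge S0 (U : {set N}) : lgraph :=
  @LGraph bool unit (fun _ => false) (fun _ => true) false
    (fun v => if v then S0 :|: U else S0)
    (fun _ _ _ => 1) (fun _ _ => 1).

(* A skeleton with vertices K and super edges J, and a learning graph G i
   plugged at the vertex host i for each i : I. The super edge from u to v is
   replaced by the SparseLoad path of the part of the label of v that is not
   already in the label of u. Paths and plugged learning graphs are attached to
   the skeleton by empty transitions; their weights and flows are scaled by
   (cJ, pJ) and (cI, pI). *)
Section Compose.
Variables (K : finType) (lab : K -> {set N}) (top : K).
Variables (J : finType) (from to : J -> K).
Variables (cJ : J -> R) (pJ : J -> input -> R).
Variables (I : finType) (host : I -> K) (G : I -> lgraph).
Variables (cI pI : I -> input -> R).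

Definition super_edge (j : J) : lgraph :=
  sparse_load (lab (from j)) (lab (to j) :\: lab (from j)).

Definition compose_vert : finType :=
  (K + {j : J & vert (super_edge j)} + {i : I & vert (G i)})%type.

(* Entries and edges of the paths, exits of the paths, then entries and edges
   of the plugged learning graphs. *)
Definition compose_edge : finType :=
  (J + {j : J & edge (super_edge j)} + J + (I + {i : I & edge (G i)}))%type.

Definition in_skel (v : K) : compose_vert := inl (inl v).
Definition in_path (j : J) (v : vert (super_edge j)) : compose_vert :=
  inl (inr (existT (fun j => vert (super_edge j)) j v)).
Definition in_plug (i : I) (v : vert (G i)) : compose_vert :=
  inr (existT (fun i => vert (G i)) i v).

Definition compose_src (e : compose_edge) : compose_vert :=
  match e with
  | inl (inl (inl j)) => in_skel (from j)
  | inl (inl (inr (existT j e))) => in_path (src e)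
  | inl (inr j) => @in_path j ord_max
  | inr (inl i) => in_skel (host i)
  | inr (inr (existT i e)) => in_plug (src e)
  end.

Definition compose_tgt (e : compose_edge) : compose_vert :=
  match e with
  | inl (inl (inl j)) => in_path (root (super_edge j))
  | inl (inl (inr (existT j e))) => in_path (tgt e)
  | inl (inr j) => in_skel (to j)
  | inr (inl i) => in_plug (root (G i))
  | inr (inr (existT i e)) => in_plug (tgt e)
  end.

Definition compose_label (v : compose_vert) : {set N} :=
  match v with
  | inl (inl v) => lab v
  | inl (inr (existT j v)) => label v
  | inr (existT i v) => label v
  end.

Definition compose_weight b z (e : compose_edge) : R :=
  match e with
  | inl (inl (inr (existT j e))) => cJ j * weight b z e
  | inr (inr (existT i e)) => cI i z * weight b z e
  | _ => 1
  end.

Definition compose_flow y (e : compose_edge) : R :=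
  match e with
  | inl (inl (inl j)) => pJ j y
  | inl (inl (inr (existT j e))) => pJ j y * flow y e
  | inl (inr j) => pJ j y
  | inr (inl i) => pI i y
  | inr (inr (existT i e)) => pI i y * flow y e
  end.

Definition compose : lgraph :=
  @LGraph compose_vert compose_edge compose_src compose_tgt (in_skel top)
    compose_label compose_weight compose_flow.

End Compose.

(* Ypos i is the set of the positive inputs of the function of G i. *)
Definition or_graph S0 (k : nat) (I : finType) (G : I -> lgraph)
    (Ypos : I -> {set {set N}}) : lgraph :=
  @compose unit (fun=> S0) tt
    void (fun=> tt) (fun=> tt) (fun=> 0) (fun _ _ => 0)
    I (fun=> tt) G
    (fun i _ => C1max (G i) (Ypos i) / k%:R)
    (fun i y => if i \in take k (enum [set i | y \in Ypos i])
                then k%:R^-1 else 0).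

(* The super edge loading S, followed for each lam by G lam, which is active on
   the inputs whose restriction to S is lam. *)
Definition load_then S (G : {set N} -> lgraph) : lgraph :=
  @compose bool (fun v => if v then S else set0) false
    unit (fun=> false) (fun=> true) (fun=> 1) (fun _ _ => 1)
    {lam : {set N} | lam \subset S} (fun=> true)
    (fun lam : {lam : {set N} | lam \subset S} => G (val lam))
    (fun (lam : {lam : {set N} | lam \subset S}) z => (z :&: S == val lam)%:R)
    (fun (lam : {lam : {set N} | lam \subset S}) y => (y :&: S == val lam)%:R).

(* Johnson construction with r = 2 on the k-subsets of W, below a vertex
   labelled S0. Y is the set of the positive inputs of the function computed,
   Ypos A lam that of the function of G A lam. *)
Section Johnson.
Variables (V : finType) (W : {set V}) (k : nat).
Variables (S0 : {set N}) (load : {set V} -> {set N}).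
Variables (Y : {set {set N}}) (target : input -> option (V * V)).
Variables (G : {set V} -> {set N} -> lgraph).
Variables (Ypos : {set V} -> {set N} -> {set {set N}}).

Definition jnode : finType :=
  {A : {set V} | (A \subset W) && (k.-2 <= #|A| <= k)%N}.

Definition jlabel (v : option jnode) : {set N} :=
  if v is Some A then S0 :|: load (val A) else S0.

Definition jsuper (p : option jnode * option jnode) : bool :=
  match p with
  | (None, Some A) => #|val A| == k.-2
  | (Some A, Some B) => (val A \subset val B) && (#|val B| == #|val A|.+1)
  | _ => false
  end.

(* The vertices carrying flow on y: disjoint from the target pair after stage
   0, then containing its first element only, then both. *)
Definition on_route y (v : option jnode) : bool :=
  match v, target y with
  | None, Some _ => true
  | Some A, Some (j1, j2) =>
      ((j1 \in val A) == (k.-2 < #|val A|)%N) &&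
      ((j2 \in val A) == (k.-1 < #|val A|)%N)
  | _, None => false
  end.

(* In each stage the super edges carrying flow correspond to the
   (k-2)-subsets of W that are disjoint from the target pair. *)
Definition n_used : R := 'C(#|W|.-2, k.-2)%:R.

Definition jedge : finType := {p : option jnode * option jnode | jsuper p}.

Definition jload (e : jedge) : lgraph :=
  super_edge jlabel (fun e : jedge => (val e).1) (fun e => (val e).2) e.

Definition jplug : finType :=
  {p : jnode * {set N} |
    (#|val p.1| == k) && (p.2 \subset jlabel (Some p.1))}.

Definition jactive (i : jplug) z : bool :=
  z :&: jlabel (Some (val i).1) == (val i).2.

Definition johnson : lgraph :=
  @compose (option jnode) jlabel None
    jedge (fun e => (val e).1) (fun e => (val e).2)
    (fun e => C1max (jload e) Y / n_used)
    (fun e y => if on_route y (val e).1 && on_route y (val e).2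
                then n_used^-1 else 0)
    jplug (fun i => Some (val i).1)
    (fun i => G (val (val i).1) (val i).2)
    (fun i z => if jactive i z
                then C1max (G (val (val i).1) (val i).2)
                           (Ypos (val (val i).1) (val i).2) / n_used
                else 0)
    (fun i y => if jactive i y && on_route y (Some (val i).1)
                then n_used^-1 else 0).

End Johnson.

End LearningGraphs.

Section Triangle.
Variables (R : realType) (n : nat).

Notation V := 'I_n.

Definition vpair : finType := {e : {set V} | #|e| == 2}.

Implicit Types (z y lam : {set vpair}) (u v w t : V) (X A B : {set V}).

Definition adj z u v := [exists e in z, val e == [set u; v]].
Definition nbhd z u := [set v | adj z u v].
Definition triangle z u v w := [&& adj z u v, adj z u w & adj z v w].

Definition Triangle : pred {set vpair} :=
  fun z => [exists u, exists v, exists w, triangle z u v w].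

Definition graphs (m : nat) : {set {set vpair}} :=
  [set z : {set vpair} | #|z| == m].

Definition pairs A B : {set vpair} :=
  [set e : vpair | [exists u in A, exists v in B, val e == [set u; v]]].

(* OR of the single-edge learning graphs for the pairs in D. A pair (u, u), or
   one that is already in S0, gives an empty transition. *)
Definition search_edge S0 (D : {set V * V}) (Y : {set {set vpair}}) :
    lgraph R vpair :=
  or_graph S0 1
    (fun p : {p : V * V | p \in D} =>
       single_edge R S0 (pairs [set (val p).1] [set (val p).2]))
    (fun p => [set y in Y | adj y (val p).1 (val p).2]).

Definition Delta lam X B w : {set V * V} :=
  [set p | [&& p.1 \in B, p.2 \in B,
               nbhd lam p.1 :&: nbhd lam p.2 :&: X == set0,
               p.1 \in nbhd lam w & p.2 \in nbhd lam w]].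

Variables (m x a b : nat).

Definition Ytri : {set {set vpair}} := positives (graphs m) Triangle.

Definition YHt t : {set {set vpair}} :=
  [set y in graphs m | [exists u, exists v, triangle y u v t]].

Definition YH X : {set {set vpair}} :=
  [set y in graphs m | [exists t in X, y \in YHt t]].

(* F_X only has to handle the inputs without a triangle meeting X. *)
Definition YF X : {set {set vpair}} := Ytri :\: YH X.

Definition YFAw X A lam w : {set {set vpair}} :=
  [set y in YF X | (y :&: pairs X A == lam) &&
                   [exists u in A, exists v in A, triangle y u v w]].

Definition YFA X A lam : {set {set vpair}} := \bigcup_w YFAw X A lam w.

Definition YFAwB X A lam w B lam' : {set {set vpair}} :=
  [set y in YFAw X A lam w |
     (y :&: (pairs X A :|: pairs [set w] B) == lam') &&
     [exists u in B, exists v in B, triangle y u v w]].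

Definition graph_Ht t : lgraph R vpair :=
  let S := pairs [set t] [set: V] in
  load_then S (fun lam =>
    search_edge S (setX (nbhd lam t) (nbhd lam t))
      [set y in YHt t | y :&: S == lam]).

Definition graph_H X : lgraph R vpair :=
  or_graph set0 1 (fun t : {t : V | t \in X} => graph_Ht (val t))
    (fun t : {t : V | t \in X} => YHt (val t)).

Definition graph_FAw X A lam w : lgraph R vpair :=
  johnson A b (pairs X A) (fun B => pairs [set w] B) (YFAw X A lam w)
    (fun y => [pick p : V * V | [&& p.1 \in A, p.2 \in A &
                                    triangle y p.1 p.2 w]])
    (fun B lam' => search_edge (pairs X A :|: pairs [set w] B)
                     (Delta lam' X B w) (YFAwB X A lam w B lam'))
    (fun B lam' => YFAwB X A lam w B lam').

Definition graph_FA X A lam : lgraph R vpair :=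
  or_graph (pairs X A) 1 (fun w : V => graph_FAw X A lam w)
    (fun w => YFAw X A lam w).

Definition graph_F X : lgraph R vpair :=
  johnson [set: V] a set0 (fun A => pairs X A) (YF X)
    (fun y => [pick p : V * V | [exists w, triangle y p.1 p.2 w]])
    (graph_FA X) (YFA X).

Definition graph_X X : lgraph R vpair :=
  or_graph set0 1 (fun h : bool => if h then graph_H X else graph_F X)
    (fun h => if h then YH X else YF X).

Definition triangle_graph : lgraph R vpair :=
  or_graph set0 'C(n, x) (fun X : {X : {set V} | #|X| == x} => graph_X (val X))
    (fun=> Ytri).

Definition triangle_complexity : R :=
  complexity (graphs m) Triangle triangle_graph.

End Triangle.

Definition ceiln (R : realType) (r : R) : nat := `|Num.ceil r|%N.

(* Stage 0 of the Johnson construction on the k-subsets of an s-element set has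
   'C(s, k - 2) super edges, of which 'C(s - 2, k - 2) carry flow. The ratio
   s(s-1) / ((s-k+2)(s-k+1)) is O(1) only if k - 1 stays away from s. *)
Definition separated (R : realType) (delta : R) (k s : nat) : bool :=
  k.-1%:R <= (1 - delta) * s%:R.

(* Main.v *)
(* Every learning graph here is a composition: a skeleton whose super edges are
   replaced by SparseLoad paths and on whose vertices learning graphs are
   plugged.  Flow conservation, C0 and C1 of a composition are read off the
   skeleton and the pieces.  The scaling of the weights makes the positive
   complexity at most 1 for an OR and at most 4 for a Johnson construction
   (1 per stage), so only the negative complexity has to be estimated.  There a
   SparseLoad of S costs O(|S| (|z_S| + 1) log n); averaging |z_S| over the
   random sets X, A, B gives the density m / n^2 per pair, and each stage of a
   Johnson construction contributes its number of super edges divided by the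
   number of used ones.  The last term is the expected size of Delta: a pair
   (u, v) with d common neighbours lies in Delta for at most d choices of w and
   only if X misses these d vertices, and d Pr[X misses them] <= n / x. *)
From mathcomp Require Import all_boot all_order all_algebra.
From mathcomp Require Import reals exp.
From mathcomp Require Import zify ring lra.
Require Import Defs.
Set Implicit Arguments.
Unset Strict Implicit.
Unset Printing Implicit Defensive.
Import Order.TTheory GRing.Theory Num.Theory.
Local Open Scope ring_scope.

(** * Static conditions on labels and weights *)

Section Static.
Variables (R : realType) (N : finType).
Implicit Types (S : {set N}) (z y : {set N}) (Y : {set {set N}}).

(** The weights of a plugged learning graph are multiplied by its own [C1max]. Uniform bounds on
    positive complexities (2 for a SparseLoad, 3 for the search below one [t], 4 for a Johnson
    construction, 1 for an OR) are therefore needed before any negative cost can be estimated, and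
    they multiply up to constants such as 48 = 4 * 12 and 16 = 4 * 4. The same scaling endangers the
    flow condition: a vanishing [C1max] would put weight 0 under a positive flow. This is excluded
    because flow through a loading edge of nonzero weight already makes [C1max] positive.

    The terms that carry the density m / n^2, and the sizes of [Delta], are not bounded set by set.
    They are kept as sums through the layers until the sum over the relevant random set is taken.
    Degree sums are linear in the set, so a double count suffices for them. For [Delta] the sums
    over A and B are moved outside, and X is averaged with B fixed. *)

Lemma agreeS S S' z z' : S \subset S' -> agree S' z z' -> agree S z z'.
Proof.
move=> sSS' /eqP e; apply/eqP.
by rewrite -(setIidPr sSS') !setIA e.
Qed.

Lemma agree_in S z z' j : agree S z z' -> j \in S -> (j \in z) = (j \in z').
Proof. by move=> /eqP /setP /(_ j); rewrite !inE => + jS; rewrite jS !andbT. Qed.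

(* The conditions of is_learning_graph on labels and weights, freed from the
   function to be computed, so that they are inherited by composed graphs. *)
Record wf_lgraph S0 (G : lgraph R N) : Prop := {
  wf_root : label (root G) = S0;
  wf_label : forall e : edge G,
    label (tgt e) = label (src e) \/
    exists2 j, j \notin label (src e) & label (tgt e) = j |: label (src e);
  wf_rooted : forall v : vert G, connect (@arc R N G) (root G) v;
  wf_rank : exists rk : vert G -> nat, forall e, (rk (src e) < rk (tgt e))%N;
  wf_weight_ge0 : forall b z (e : edge G), 0 <= weight b z e;
  wf_weight_local : forall b z z' (e : edge G),
    agree (label (tgt e)) z z' -> weight b z e = weight b z' e;
  wf_weight_dual : forall (e : edge G) j x y,
    j \notin label (src e) -> label (tgt e) = j |: label (src e) ->
    agree (label (src e)) x y -> (j \in x) != (j \in y) ->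
    weight false x e = weight true y e }.

Lemma wf_label_src S0 (G : lgraph R N) (e : edge G) :
  wf_lgraph S0 G -> label (src e) \subset label (tgt e).
Proof.
by move=> wfG; case: (wf_label wfG e) => [->|[j _ ->]] //; apply: subsetUr.
Qed.

(** Labels only grow along edges, and every vertex is reachable from the root. Hence a scaling
    factor that depends on the input only through the label of the host vertex is still a local
    weight everywhere inside the plugged graph. *)
Lemma wf_label_sub S0 (G : lgraph R N) (v : vert G) :
  wf_lgraph S0 G -> S0 \subset label v.
Proof.
move=> wfG; have /connectP[p] := wf_rooted wfG v.
rewrite -(wf_root wfG); elim: p (root G) => [|w p IH] u /= => [_ ->|] //.
move=> /andP[/existsP[e /andP[/eqP <- /eqP <-]] pp] lst.
exact: subset_trans (wf_label_src e wfG) (IH _ pp lst).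
Qed.

Lemma wf_learning_graph Z (f : pred {set N}) (G : lgraph R N) :
  wf_lgraph set0 G ->
  (forall y, y \in positives Z f -> unit_flow Z f G y) ->
  is_learning_graph Z f G.
Proof.
move=> wfG flowG; split => //.
- exact: wf_root wfG.
- exact: wf_label wfG.
- exact: wf_rooted wfG.
- have [rk rkP] := wf_rank wfG.
  (* A rank that increases along edges is monotone along connections, so a cycle through [e] would
     contradict [rkP e]. *)
  have rk_conn u v : connect (@arc R N G) u v -> (rk u <= rk v)%N.
    move=> /connectP[p]; elim: p u => [|w p IH] u /= => [_ ->|] //.
    move=> /andP[/existsP[e /andP[/eqP <- /eqP <-]] pp] lst.
    exact: leq_trans (ltnW (rkP e)) (IH _ pp lst).
  by move=> e; apply/negP => /rk_conn; rewrite leqNgt rkP.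
- by move=> *; apply: wf_weight_ge0 wfG _ _ _.
- by move=> b z z' e _ _; apply: wf_weight_local wfG _ _ _ _.
- by move=> e j x y js lt _ _; apply: wf_weight_dual wfG _ _ _ _ js lt.
Qed.

Lemma C0_ge0 S0 (G : lgraph R N) z : wf_lgraph S0 G -> 0 <= C0 G z.
Proof. by move=> wfG; apply: sumr_ge0 => e _; apply: wf_weight_ge0 wfG _ _ _. Qed.

Lemma C1_ge0 S0 (G : lgraph R N) y : wf_lgraph S0 G -> 0 <= C1 G y.
Proof.
move=> wfG; apply: sumr_ge0 => e _; apply: divr_ge0; first exact: sqr_ge0.
exact: wf_weight_ge0 wfG _ _ _.
Qed.

Lemma le_bigmax0 (I : finType) (P : pred I) (F : I -> R) (c : R) :
  0 <= c -> (forall i, P i -> F i <= c) -> \big[Num.max/0]_(i | P i) F i <= c.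
Proof.
by move=> c0 Fc; elim/big_ind: _ => // u v uc vc; rewrite ge_max uc vc.
Qed.

Lemma bigmax0_ge0 (I : finType) (P : pred I) (F : I -> R) :
  0 <= \big[Num.max/0]_(i | P i) F i.
Proof. by rewrite bigmax_idl le_max lexx. Qed.

Lemma C1max_ge0 (G : lgraph R N) Y : 0 <= C1max G Y.
Proof. exact: bigmax0_ge0. Qed.

Lemma C1_le_max (G : lgraph R N) Y y : y \in Y -> C1 G y <= C1max G Y.
Proof. by move=> yY; apply: (@le_bigmax_cond _ _ _ _ _ _ (C1 G)). Qed.

Lemma C1max_le (G : lgraph R N) Y c :
  0 <= c -> (forall y, y \in Y -> C1 G y <= c) -> C1max G Y <= c.
Proof. by move=> c0 h; apply: le_bigmax0. Qed.

Lemma C1max_gt0 S0 (G : lgraph R N) Y y (e : edge G) :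
  wf_lgraph S0 G -> y \in Y ->
  loading e -> flow y e != 0 -> weight true y e != 0 -> 0 < C1max G Y.
Proof.
move=> wfG yY le fe we.
apply: lt_le_trans (C1_le_max G yY); rewrite /C1 (bigD1 e) //=.
apply: ltr_wpDr.
  apply: sumr_ge0 => e' _; apply: divr_ge0; first exact: sqr_ge0.
  exact: wf_weight_ge0 wfG _ _ _.
apply: divr_gt0; first by rewrite exprn_even_gt0.
by rewrite lt_neqAle (wf_weight_ge0 wfG) andbT eq_sym.
Qed.

(** Compositions scale weights by [C1max]. The flow condition of the inner graph already gives a
    nonzero weight under nonzero flow, and this single edge makes the factor positive. *)
Lemma C1max_neq0 S0 Z f (G : lgraph R N) Y y (e : edge G) :
  wf_lgraph S0 G -> unit_flow Z f G y -> y \in Y ->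
  loading e -> flow y e != 0 -> C1max G Y != 0.
Proof.
move=> wfG [_ w0 _ _] yY le fe; rewrite gt_eqF //.
by apply: (C1max_gt0 wfG yY le fe); apply: contra_neq fe; apply: w0.
Qed.

End Static.

(** * SparseLoad as a path: labels, unit flow, and duality of its weights *)

Section SparseLoad.
Variables (R : realType) (N : finType).
Implicit Types (S : {set N}) (z y : {set N}) (Y : {set {set N}}).

Lemma path_inflow l (k : 'I_l.+1) :
  \sum_(i : 'I_l | lift ord0 i == k) 1 = (k != ord0)%:R :> R.
Proof.
case: (unliftP ord0 k) => [j|] ->.
  by rewrite (big_pred1 j) => [|i]; rewrite 1?eq_sym ?neq_lift // (inj_eq lift_inj) eq_sym.
by rewrite eqxx big_pred0 // => i; rewrite eq_sym (negPf (neq_lift _ _)).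
Qed.

Lemma path_outflow l (k : 'I_l.+1) :
  \sum_(i : 'I_l | widen_ord (leqnSn l) i == k) 1 = (k != ord_max)%:R :> R.
Proof.
have -> : k != ord_max = (k < l)%N.
  by rewrite -val_eqE /= ltn_neqAle -ltnS ltn_ord andbT.
have [kl|lk] := ltnP k l.
  by rewrite (big_pred1 (Ordinal kl)) // => i; rewrite -!val_eqE.
rewrite big_pred0 // => i; rewrite -val_eqE /=; apply/negbTE.
by rewrite neq_ltn (leq_trans (ltn_ord i) lk).
Qed.

Lemma ln_nat_ge0 k : 0 <= ln (k.+1%:R : R).
Proof. by apply: ln_ge0; rewrite ler1n. Qed.

Lemma sparse_weight_gt0 S0 S b z (e : edge (sparse_load R S0 S)) :
  0 < weight b z e.
Proof.
rewrite /=; have lt0 : (0 < size (enum S))%N by apply: leq_ltn_trans (ltn_ord e).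
apply: mulr_gt0; last by apply: ln_gt0; rewrite ltr1n ltnS.
by apply: mulr_gt0; rewrite ?ltr0n //; case: ifP => _; rewrite ltr0n.
Qed.

Lemma sparse_prefixS S (i : 'I_(size (enum S))) :
  [set j in take i.+1 (enum S)] =
  tnth (in_tuple (enum S)) i |: [set j in take i (enum S)].
Proof.
apply/setP => j; rewrite !inE (tnth_nth j) /= (take_nth j) ?ltn_ord //.
by rewrite mem_rcons inE.
Qed.

Lemma sparse_notin_prefix S (i : 'I_(size (enum S))) :
  tnth (in_tuple (enum S)) i \notin [set j in take i (enum S)].
Proof.
rewrite inE (tnth_nth (tnth (in_tuple (enum S)) i)) /=.
have /(take_uniq i.+1) := enum_uniq (mem S).
by rewrite (take_nth (tnth (in_tuple (enum S)) i)) ?ltn_ord // rcons_uniq => /andP[].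
Qed.

Lemma sparse_in (S : {set N}) (i : 'I_(size (enum S))) :
  tnth (in_tuple (enum S)) i \in S.
Proof. by rewrite -mem_enum -{3}[enum S]/(val (in_tuple (enum S))) mem_tnth. Qed.

Lemma sparse_root_label S0 S : label (root (sparse_load R S0 S)) = S0.
Proof. by rewrite /= take0; apply/setP => j; rewrite !inE orbF. Qed.

Lemma sparse_last_label S0 S :
  label (ord_max : vert (sparse_load R S0 S)) = S0 :|: S.
Proof. by rewrite /= take_size; apply/setP => j; rewrite !inE mem_enum. Qed.

Lemma sparse_tgt_label S0 S (e : edge (sparse_load R S0 S)) :
  label (tgt e) = tnth (in_tuple (enum S)) e |: label (src e).
Proof. by rewrite /= /bump /= add1n sparse_prefixS setUCA. Qed.

Lemma sparse_notin_src S0 S (e : edge (sparse_load R S0 S)) :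
  [disjoint S0 & S] -> tnth (in_tuple (enum S)) e \notin label (src e).
Proof.
move=> /pred0P dis; rewrite /= in_setU (negPf (sparse_notin_prefix e)) orbF.
by have := dis (tnth (in_tuple (enum S)) e); rewrite /= sparse_in andbT => ->.
Qed.

Lemma sparse_loading S0 S (e : edge (sparse_load R S0 S)) :
  [disjoint S0 & S] -> loading e.
Proof.
move=> dis; apply/eqP => eq; have := sparse_notin_src e dis.
by rewrite eq sparse_tgt_label setU11.
Qed.

Lemma sparse_wf S0 S : [disjoint S0 & S] -> wf_lgraph S0 (sparse_load R S0 S).
Proof.
move=> dis; split.
- exact: sparse_root_label.
- move=> e; right; exists (tnth (in_tuple (enum S)) e).
    exact: sparse_notin_src.
  exact: sparse_tgt_label.
- move=> v; have [k kv] := ubnPeq (nat_of_ord v); elim: k v kv => [|k IH] v kv.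
    by have -> : v = root (sparse_load R S0 S) by apply/val_inj => /=; lia.
  have kl : (k < size (enum S))%N by have := ltn_ord v; lia.
  apply: connect_trans (IH (inord k) _) (connect1 _).
    by rewrite inordK //= ltnS ltnW.
  apply/existsP; exists (Ordinal kl); rewrite -!val_eqE /= inordK; last by rewrite ltnS ltnW.
  by rewrite eqxx /bump /= add1n; apply/eqP; lia.
- by exists (fun v : 'I_(size (enum S)).+1 => nat_of_ord v) => e; rewrite /= /bump /= add1n.
- by move=> *; apply/ltW/sparse_weight_gt0.
- move=> b z z' e; rewrite sparse_tgt_label => ag.
  have /= -> := agree_in ag (setU11 _ _).
  have : agree [set j in take e (enum S)] z z'.
    exact: agreeS (subset_trans (subsetUr S0 _) (subsetUr _ _)) ag.
  by rewrite /= => /eqP ->.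
- move=> e j x y js; rewrite sparse_tgt_label => eq.
  have {eq}<- : tnth (in_tuple (enum S)) e = j.
    have := setU11 (tnth (in_tuple (enum S)) e) (label (src e)).
    rewrite eq in_setU1 => /orP[/eqP //|].
    by rewrite (negPf (sparse_notin_src e dis)).
  (* Since [x] and [y] differ at the loaded index, it is a zero of [x] exactly when it is a one of
     [y]. Both weights then take the same branch, with the same prefix count. *)
  move=> ag; have : agree [set j in take e (enum S)] x y.
    exact: agreeS (subsetUr S0 _) ag.
  by rewrite /= => /eqP ->; case: (_ \in x) (_ \in y) => [] [].
Qed.

End SparseLoad.

(** * Complexity of SparseLoad *)

Section SparseCost.
Variables (R : realType) (N : finType).
Implicit Types (S : {set N}) (z y : {set N}) (Y : {set {set N}}).

Lemma ln2_ge : 2^-1 <= ln (2 : R).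
Proof.
(* ln 2 = - ln (1 - 1/2) >= 1/2, from ln (1 + t) <= t. *)
have := @le_ln1Dx R (- 2^-1); rewrite (_ : 1 + - 2^-1 = 2^-1); last by lra.
by rewrite lnV ?posrE // => /(_ _); lra.
Qed.

(** The induction step is ln (1 - 1/(k+2)) <= - 1/(k+2); for [k] = 0 the convention ln 0 = 0 is
    used. *)
Lemma harmonic_le (k : nat) :
  \sum_(i < k) i.+1%:R^-1 <= 1 + ln (k%:R : R).
Proof.
elim: k => [|[|k] IH]; first by rewrite big_ord0 ln0 ?addr0.
  by rewrite big_ord_recr big_ord0 /= ln1 invr1; lra.
rewrite big_ord_recr /=.
have k1 : 0 < (k.+1%:R : R) by rewrite ltr0n.
have k2 : 0 < (k.+2%:R : R) by rewrite ltr0n.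
have := @le_ln1Dx R (- k.+2%:R^-1).
have -> : 1 + - k.+2%:R^-1 = k.+1%:R / k.+2%:R :> R.
  by rewrite -(@natr1 R k.+1); move: k1; set u := k.+1%:R => k1; field; lra.
rewrite ln_div ?posrE // ltrN2 invf_lt1 // ltr1n => /(_ isT).
move: IH; move: (\sum_(i < _) _) (ln _) (ln _) (_^-1) => s u v w; lra.
Qed.

(** The successive ones of [y] met along the path see prefix weights 0, 1, 2, ..., so their inverse
    weights add up to a harmonic sum. *)
Lemma sparse_harmonic S y k : (k <= size (enum S))%N ->
  \sum_(i < size (enum S) | (i < k)%N)
     (if tnth (in_tuple (enum S)) i \in y
      then (#|y :&: [set j in take i (enum S)]|.+1%:R)^-1 else 0) =
  \sum_(i < #|y :&: [set j in take k (enum S)]|) i.+1%:R^-1 :> R.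
Proof.
elim: k => [|k IH] kl.
  rewrite take0 big_pred0 // (_ : _ :&: _ = set0) ?cards0 ?big_ord0 //.
  by apply/setP => j; rewrite !inE andbF.
rewrite (bigD1 (Ordinal kl)) //= (eq_bigl (fun i : 'I_(size (enum S)) => i < k)%N); last first.
  by move=> i; rewrite -val_eqE /=; lia.
rewrite IH ?(ltnW kl) // (sparse_prefixS (Ordinal kl)) /=.
case: ifP => sy.
  rewrite setIUr; have /setIidPr -> : [set tnth (in_tuple (enum S)) (Ordinal kl)] \subset y by rewrite sub1set.
  rewrite cardsU1 inE.
  rewrite (negPf (sparse_notin_prefix (Ordinal kl))) andbF /= add1n.
  by rewrite big_ord_recr /= addrC.
rewrite add0r setIUr (_ : _ :&: [set _] = set0) ?set0U //.
by apply/setP => j; rewrite !inE; case: eqP => [->|]; rewrite ?sy ?andbF.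
Qed.

Lemma sparse_C1_le S0 S y : C1 (sparse_load R S0 S) y <= 2.
Proof.
set l := size (enum S); set L := ln (l.+1%:R : R).
have [l0|l0] := posnP l.
  by rewrite /C1 big1 // => e _; have := ltn_ord (e : 'I_l); rewrite {2}l0.
have l0R : 0 < (l%:R : R) by rewrite ltr0n.
have L0 : 2^-1 <= L.
  by apply: le_trans ln2_ge _; rewrite ler_ln ?posrE ?ler_nat ?ltr0n.
have lL : ln (l%:R : R) <= L by rewrite ler_ln ?posrE ?ler_nat ?ltr0n.
(* Up to the factor 1 / (3L), the ones contribute at most 1 + L by the harmonic sum, and the at most
   [l] zeros contribute 1/l each. The total 2 + L is below 6L because L >= ln 2 >= 1/2. *)
have -> : 2 = (3 * L)^-1 * (6 * L) by field; rewrite lt0r_neq0 //; lra.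
apply: (@le_trans _ _ ((3 * L)^-1 * \sum_(i < l)
  ((if tnth (in_tuple (enum S)) i \in y
    then (#|y :&: [set j in take i (enum S)]|.+1%:R)^-1 else 0) + l%:R^-1))).
  rewrite /C1 mulr_sumr big_mkcond; apply: ler_sum => i _ /=.
  have h : 0 <= (3 * L)^-1 * ((if tnth (in_tuple (enum S)) i \in y
    then (#|y :&: [set j in take i (enum S)]|.+1%:R)^-1 else 0) + l%:R^-1).
    apply: mulr_ge0; first by rewrite invr_ge0; lra.
    by apply: addr_ge0; [case: ifP => // _|]; rewrite invr_ge0.
  case: ifP => // _; rewrite eqb_id expr1n div1r -/l -/L mulrAC invfM.
  apply: ler_wpM2l; first by rewrite invr_ge0; lra.
  by case: ifP => _; rewrite ?add0r // lerDl invr_ge0.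
apply: ler_wpM2l; first by rewrite invr_ge0; lra.
rewrite big_split /= sumr_const card_ord -[_ *+ l]mulr_natl divff ?lt0r_neq0 //.
have := @sparse_harmonic S y l (leqnn _); under [X in X = _ -> _]eq_bigl => i do rewrite ltn_ord.
move=> ->; rewrite take_size; set c := #|_|.
have cl : (c <= l)%N.
  by rewrite /l -cardE; apply/subset_leq_card/subsetP => j; rewrite !inE mem_enum => /andP[].
have := harmonic_le c.
have : ln (c%:R : R) <= L; last by lra.
case: (c) cl => [_|c' c'l]; first by rewrite ln0 //; lra.
by rewrite ler_ln ?posrE ?ler_nat ?ltr0n // leqW.
Qed.

Definition load_cost z S : R :=
  6 * #|S|%:R * #|z :&: S|.+1%:R * ln (#|S|.+1%:R).

(** For the negative weights the roles are exchanged: each zero costs at most 3(c+1)L and each of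
    the [c] ones costs 3lL. With at most [l] zeros this gives 3L(l(c+1) + cl) <= 6l(c+1)L. *)
Lemma sparse_C0_le S0 S z : C0 (sparse_load R S0 S) z <= load_cost z S.
Proof.
rewrite /load_cost cardE; set l := size (enum S); set L := ln (l.+1%:R : R).
have L0 : 0 <= L by apply: ln_nat_ge0.
set c := #|z :&: S|.
apply: (@le_trans _ _ (\sum_(i < l) (3 * L) *
   (c.+1%:R + (tnth (in_tuple (enum S)) i \in z)%:R * l%:R))).
  rewrite /C0 big_mkcond; apply: ler_sum => i _ /=.
  have h : 0 <= 3 * L * (c.+1%:R + (tnth (in_tuple (enum S)) i \in z)%:R * l%:R).
    by rewrite !mulr_ge0 // addr_ge0 // mulr_ge0.
  case: ifP => // _; rewrite -/l -/L mulrAC.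
  apply: ler_wpM2l; first by rewrite mulr_ge0.
  case: (_ \in z) => /=; first by rewrite mul1r lerDr.
  rewrite mul0r addr0 ler_nat ltnS; apply/subset_leq_card/setIS.
  by apply/subsetP => j; rewrite inE => /mem_take; rewrite mem_enum.
rewrite -mulr_sumr big_split /= sumr_const card_ord -mulr_suml.
have -> : \sum_(i < l) (tnth (in_tuple (enum S)) i \in z)%:R = c%:R :> R.
  rewrite -(big_tnth _ _ _ xpredT (fun j => (j \in z)%:R)) /= big_enum /=.
  rewrite -natr_sum /c -sum1_card; congr (_%:R).
  rewrite big_mkcond [RHS]big_mkcond; apply: eq_bigr => j _.
  by rewrite inE; case: (j \in S); case: (j \in z).
rewrite -[_ *+ l]mulr_natl -[c.+1%:R]natr1.
have -> : 6 * l%:R * (c%:R + 1) * L = 3 * L * (2 * l%:R * (c%:R + 1)) by ring.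
apply: ler_wpM2l; first by rewrite mulr_ge0.
have : 0 <= (l%:R : R) by [].
by lra.
Qed.

Lemma load_cost_le z S (k r : nat) (L : R) :
  (#|S| <= k)%N -> (#|z :&: S| <= r)%N -> ln (#|S|.+1%:R) <= L ->
  load_cost z S <= 6 * k%:R * r.+1%:R * L.
Proof.
by move=> Sk zr SL; rewrite /load_cost !ler_pM ?mulr_ge0 ?ln_nat_ge0 ?ler_nat //.
Qed.

End SparseCost.

(** * Composition along a skeleton *)

Lemma connect_arc_map (R : realType) (N : finType) (G G' : lgraph R N)
    (g : vert G -> vert G') (h : edge G -> edge G') u v :
  (forall e, src (h e) = g (src e)) -> (forall e, tgt (h e) = g (tgt e)) ->
  connect (@arc R N G) u v -> connect (@arc R N G') (g u) (g v).
Proof.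
move=> hs ht /connectP[p pp ->].
elim: p u pp => [|w p IH] u /=; first by rewrite connect0.
move=> /andP[/existsP[e /andP[/eqP <- /eqP <-]] pp].
apply: connect_trans (IH _ pp); apply: connect1.
by apply/existsP; exists (h e); rewrite hs ht !eqxx.
Qed.

Section Compose.
Variables (R : realType) (N : finType).
Variables (K : finType) (lab : K -> {set N}) (top : K).
Variables (J : finType) (from to : J -> K).
Variables (cJ : J -> R) (pJ : J -> {set N} -> R).
Variables (I : finType) (host : I -> K) (G : I -> lgraph R N).
Variables (cI pI : I -> {set N} -> R).

Local Notation GC := (compose lab top from to cJ pJ host G cI pI).
Local Notation path := (super_edge R lab from to).
Local Notation vskel v := (in_skel lab from to G v).
Local Notation vpath v := (@in_path R N K lab J from to I G _ v).
Local Notation vplug v := (@in_plug R N K lab J from to I G _ v).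
Local Notation eentry j := (inl (inl (inl j)) : edge GC).
Local Notation epath j e :=
  (inl (inl (inr (existT (fun j => edge (path j)) j e))) : edge GC).
Local Notation eexit j := (inl (inr j) : edge GC).
Local Notation eenter i := (inr (inl i) : edge GC).
Local Notation eplug i e :=
  (inr (inr (existT (fun i => edge (G i)) i e)) : edge GC).

Lemma big_compose_edge (P : pred (edge GC)) (F : edge GC -> R) :
  \sum_(e | P e) F e =
  \sum_(j | P (eentry j)) F (eentry j) +
  \sum_j \sum_(e : edge (path j) | P (epath j e)) F (epath j e) +
  \sum_(j | P (eexit j)) F (eexit j) +
  (\sum_(i | P (eenter i)) F (eenter i) +
   \sum_i \sum_(e : edge (G i) | P (eplug i e)) F (eplug i e)).
Proof.
rewrite !big_sumType /=; congr (_ + _ + _ + (_ + _)).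
  rewrite [RHS](sig_big_dep xpredT (fun j e => P (epath j e))
                            (fun j e => F (epath j e))).
  by apply: eq_big => -[].
rewrite [RHS](sig_big_dep xpredT (fun i e => P (eplug i e))
                          (fun i e => F (eplug i e))).
by apply: eq_big => -[].
Qed.

Lemma sum_tagged_eq (A : finType) (V E : A -> finType)
    (g : forall j, E j -> V j) (F : forall j, E j -> R) j (k : V j) :
  \sum_j' \sum_(e | existT (fun j => Finite.sort (V j)) j' (g j' e) == existT _ j k)
     F j' e = \sum_(e | g j e == k) F j e.
Proof.
rewrite (bigD1 j) //= [X in _ + X]big1 ?addr0 => [|j' jj'].
  by apply: eq_bigl => e; rewrite eq_Tagged.
by rewrite big_pred0 // => e; rewrite -tag_eqE /tag_eq /= (negPf jj').
Qed.

Lemma inflow_skel y v : inflow y (vskel v : vert GC) = \sum_(j | to j == v) pJ j y.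
Proof.
rewrite /inflow big_compose_edge /=.
rewrite [X in X + _ + _ + _]big_pred0 // [X in _ + X + _ + _]big1 => [|j _]; last first.
  by rewrite big_pred0.
rewrite [X in _ + (X + _)]big_pred0 // [X in _ + (_ + X)]big1 => [|i _]; last first.
  by rewrite big_pred0.
by rewrite !add0r !addr0.
Qed.

Lemma outflow_skel y v : outflow y (vskel v : vert GC) =
  \sum_(j | from j == v) pJ j y + \sum_(i | host i == v) pI i y.
Proof.
rewrite /outflow big_compose_edge /=.
rewrite [X in _ + X + _ + _]big1 => [|j _]; last by rewrite big_pred0.
rewrite [X in _ + X + _]big_pred0 // [X in _ + (_ + X)]big1 => [|i _].
  by rewrite !addr0.
by rewrite big_pred0.
Qed.

Lemma inflow_path y j (k : vert (path j)) : inflow y (vpath k : vert GC) = pJ j y.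
Proof.
rewrite /inflow big_compose_edge /=.
rewrite [X in _ + X + _]big_pred0 // [X in _ + (X + _)]big_pred0 //.
rewrite [X in _ + (_ + X)]big1 => [|i _]; last by rewrite big_pred0.
rewrite !addr0.
(* The entries are viewed as one-edge families indexed by [unit], so that the same collapsing lemma
   serves for them and for the path edges. The entry supplies the flow that the first vertex of the
   path does not receive from path edges. *)
have := @sum_tagged_eq J (fun j => vert (path j)) (fun=> unit : finType)
  (fun j _ => root (path j)) (fun j _ => pJ j y) j k.
have -> f : \sum_(e : unit | f e) pJ j y = (f tt)%:R * pJ j y.
  by rewrite big_mkcond (big_pred1 tt) => [|[]]; case: (f tt); rewrite ?mul1r ?mul0r.
move=> e1.
have -> : \sum_(i | vpath (root (path i)) == vpath k) pJ i y =
          (root (path j) == k)%:R * pJ j y.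
  rewrite -e1 [LHS]big_mkcond; apply: eq_bigr => i _.
  by rewrite big_mkcond (big_pred1 tt) => [|[]].
rewrite (@sum_tagged_eq J (fun j => vert (path j)) (fun j => edge (path j))
  (fun j e => tgt e) (fun j e => pJ j y * 1) j k) -mulr_sumr.
rewrite [X in _ + _ * X]path_inflow eq_sym mulrC -mulrDr.
by case: eqP => _ /=; rewrite ?addr0 ?add0r mulr1.
Qed.

Lemma outflow_path y j (k : vert (path j)) : outflow y (vpath k : vert GC) = pJ j y.
Proof.
rewrite /outflow big_compose_edge /=.
rewrite [X in X + _ + _ + _]big_pred0 // [X in _ + (X + _)]big_pred0 //.
rewrite [X in _ + (_ + X)]big1 => [|i _]; last by rewrite big_pred0.
rewrite !addr0 add0r.
have := @sum_tagged_eq J (fun j => vert (path j)) (fun=> unit : finType)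
  (fun j _ => ord_max) (fun j _ => pJ j y) j k.
have -> f : \sum_(e : unit | f e) pJ j y = (f tt)%:R * pJ j y.
  by rewrite big_mkcond (big_pred1 tt) => [|[]]; case: (f tt); rewrite ?mul1r ?mul0r.
move=> e1.
have -> : \sum_(i | vpath (ord_max : vert (path i)) == vpath k) pJ i y =
          (ord_max == k)%:R * pJ j y.
  rewrite -e1 [LHS]big_mkcond; apply: eq_bigr => i _.
  by rewrite big_mkcond (big_pred1 tt) => [|[]].
rewrite (@sum_tagged_eq J (fun j => vert (path j)) (fun j => edge (path j))
  (fun j e => src e) (fun j e => pJ j y * 1) j k) -mulr_sumr.
rewrite [X in _ * X]path_outflow eq_sym [_%:R * pJ j y]mulrC -mulrDr.
by case: eqP => _ /=; rewrite ?addr0 ?add0r mulr1.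
Qed.

Lemma inflow_plug y i (v : vert (G i)) : inflow y (vplug v : vert GC) =
  pI i y * ((v == root (G i))%:R + inflow y v).
Proof.
rewrite /inflow big_compose_edge /=.
rewrite [X in X + _ + _ + _]big_pred0 // [X in _ + X + _]big_pred0 //.
rewrite [X in _ + X + _ + _]big1 => [|j _]; last by rewrite big_pred0.
rewrite !add0r.
have := @sum_tagged_eq I (fun i => vert (G i)) (fun=> unit : finType)
  (fun i _ => root (G i)) (fun i _ => pI i y) i v.
have -> f : \sum_(e : unit | f e) pI i y = (f tt)%:R * pI i y.
  by rewrite big_mkcond (big_pred1 tt) => [|[]]; case: (f tt); rewrite ?mul1r ?mul0r.
move=> e1.
have -> : \sum_(i' | vplug (root (G i')) == vplug v) pI i' y =
          (root (G i) == v)%:R * pI i y.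
  rewrite -e1 [LHS]big_mkcond; apply: eq_bigr => i' _.
  by rewrite big_mkcond (big_pred1 tt) => [|[]].
rewrite (@sum_tagged_eq I (fun i => vert (G i)) (fun i => edge (G i))
  (fun i e => tgt e) (fun i e => pI i y * flow y e) i v) -mulr_sumr.
by rewrite eq_sym [_%:R * _]mulrC -mulrDr.
Qed.

Lemma outflow_plug y i (v : vert (G i)) :
  outflow y (vplug v : vert GC) = pI i y * outflow y v.
Proof.
rewrite /outflow big_compose_edge /=.
rewrite [X in X + _ + _ + _]big_pred0 // [X in _ + X + _]big_pred0 //.
rewrite [X in _ + X + _ + _]big1 => [|j _]; last by rewrite big_pred0.
rewrite [X in _ + (X + _)]big_pred0 // !add0r.
by rewrite (@sum_tagged_eq I (fun i => vert (G i)) (fun i => edge (G i))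
  (fun i e => src e) (fun i e => pI i y * flow y e) i v) -mulr_sumr.
Qed.

Hypothesis lab_mono : forall j, lab (from j) \subset lab (to j).
Hypothesis wfG : forall i, wf_lgraph (lab (host i)) (G i).

Lemma super_edge_wf j : wf_lgraph (lab (from j)) (path j).
Proof. by apply: sparse_wf; rewrite -setI_eq0 setIDA setDIl setDv set0I. Qed.

(** The path only adds what [lab (from j)] lacks, so it ends exactly at [lab (to j)] by monotonicity
    of the labels. This is why leaving a path is an empty transition and costs nothing. *)
Lemma super_edge_last j : label (ord_max : vert (path j)) = lab (to j).
Proof.
rewrite sparse_last_label; apply/setP => s; rewrite !inE.
by have [/(subsetP (lab_mono j))|] := boolP (s \in lab (from j)).
Qed.

Lemma loading_entry j : loading (eentry j) = false.
Proof. by apply/negbF/eqP/esym; exact: wf_root (super_edge_wf j). Qed.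

Lemma loading_exit j : loading (eexit j) = false.
Proof. by apply/negbF/eqP; exact: super_edge_last. Qed.

Lemma loading_enter i : loading (eenter i) = false.
Proof. by apply/negbF/eqP/esym; exact: wf_root (wfG i). Qed.

Lemma compose_C0 z :
  C0 GC z = \sum_j cJ j * C0 (path j) z + \sum_i cI i z * C0 (G i) z.
Proof.
rewrite /C0 big_compose_edge.
rewrite [X in X + _ + _ + _]big_pred0; last exact: loading_entry.
rewrite [X in _ + X + _]big_pred0; last exact: loading_exit.
rewrite [X in _ + (X + _)]big_pred0; last exact: loading_enter.
rewrite !addr0 !add0r; congr (_ + _); apply: eq_bigr => j _.
  by rewrite mulr_sumr.
by rewrite mulr_sumr.
Qed.

(** The factors separate edge by edge, even where a weight or a scaling factor is 0, because
    inversion is multiplicative with the inverse of 0 equal to 0. *)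
Lemma compose_C1 y :
  C1 GC y = \sum_j pJ j y ^+ 2 / cJ j * C1 (path j) y +
            \sum_i pI i y ^+ 2 / cI i y * C1 (G i) y.
Proof.
rewrite /C1 big_compose_edge.
rewrite [X in X + _ + _ + _]big_pred0; last exact: loading_entry.
rewrite [X in _ + X + _]big_pred0; last exact: loading_exit.
rewrite [X in _ + (X + _)]big_pred0; last exact: loading_enter.
rewrite !addr0 !add0r; congr (_ + _); apply: eq_bigr => j _;
  rewrite mulr_sumr; apply: eq_bigr => e _ /=;
  by rewrite exprMn invfM mulrACA.
Qed.

Lemma compose_wf (rk : K -> nat) :
  (forall j, (rk (from j) < rk (to j))%N) ->
  (forall v, connect (fun u v => [exists j, (from j == u) && (to j == v)]) top v) ->
  (forall j, 0 <= cJ j) -> (forall i z, 0 <= cI i z) ->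
  (forall i z z', agree (lab (host i)) z z' -> cI i z = cI i z') ->
  wf_lgraph (lab top) GC.
Proof.
move=> rkP conn cJ0 cI0 cI_local.
have arcP (e : edge GC) : arc (src e) (tgt e).
  by apply/existsP; exists e; rewrite !eqxx.
have conn_path j (k : vert (path j)) :
    connect (@arc R N GC) (vskel (from j) : vert GC) (vpath k : vert GC).
  apply: connect_trans (connect1 (arcP (eentry j))) _.
  exact: (@connect_arc_map _ _ (path j) GC (fun k => vpath k : vert GC)
    (fun e => epath j e)) (wf_rooted (super_edge_wf j) k).
have conn_skel v : connect (@arc R N GC) (vskel top : vert GC) (vskel v : vert GC).
  have /connectP[p pp ->] := conn v.
  elim: p top pp => [|w p IH] u /=; first by rewrite connect0.
  move=> /andP[/existsP[j /andP[/eqP <- /eqP <-]] pp].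
  apply: connect_trans (conn_path j ord_max) _.
  exact: connect_trans (connect1 (arcP (eexit j))) (IH _ pp).
have cI_agree i (S : {set N}) z z' : lab (host i) \subset S -> agree S z z' -> cI i z = cI i z'.
  by move=> sub ag; apply: cI_local; apply: agreeS ag.
split => //.
- case=> [[[j|[j e]]|j]|[i|[i e]]].
  + by left; apply/esym/eqP/negbNE; rewrite -/(loading (eentry j)) loading_entry.
  + exact: (wf_label (super_edge_wf j)).
  + by left; apply/esym/eqP/negbNE; rewrite -/(loading (eexit j)) loading_exit.
  + by left; apply/esym/eqP/negbNE; rewrite -/(loading (eenter i)) loading_enter.
  + exact: (wf_label (wfG i)).
- case=> [[v|[j k]]|[i v]] /=.
  + exact: conn_skel.
  + exact: connect_trans (conn_skel _) (conn_path j k).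
  + apply: connect_trans (conn_skel (host i)) _.
    apply: connect_trans (connect1 (arcP (eenter i))) _.
    exact: (@connect_arc_map _ _ (G i) GC (fun v => vplug v : vert GC)
      (fun e => eplug i e)) (wf_rooted (wfG i) v).
(* The ranks of the plugged graphs are known only to exist. Encoding each one as a finite function
   makes [xchoose] applicable, which selects one rank per index. *)
- have [rkG rkGP] : exists rkG : forall i, vert (G i) -> nat,
      forall i e, (rkG i (src e) < rkG i (tgt e))%N.
    have h i : exists rki : {ffun vert (G i) -> nat},
        [forall e, (rki (src e) < rki (tgt e))%N].
      have [r rP] := wf_rank (wfG i); exists (finfun r).
      by apply/forallP => e; rewrite !ffunE.
    exists (fun i v => xchoose (h i) v) => i e.
    exact: (forallP (xchooseP (h i)) e).
  (* A path has at most #|N| + 1 vertices, so it fits strictly between the multiples [M * rk] of its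
     two end points. The shift [L] places all plugged graphs above the whole skeleton. *)
  pose M := #|N|.+2; pose L := (M * (\max_v rk v).+1)%N.
  have kM j (k : vert (path j)) : (k.+1 < M)%N.
    rewrite ltnS; apply: leq_trans (ltn_ord k) _.
    by rewrite ltnS -cardE max_card.
  exists (fun v : vert GC => match v with
    | inl (inl v) => M * rk v
    | inl (inr (existT j k)) => M * rk (from j) + (nat_of_ord k).+1
    | inr (existT i v) => L + rkG i v end)%N.
  case=> [[[j|[j e]]|j]|[i|[i e]]] /=.
  + by rewrite addn1.
  + by rewrite ltn_add2l /bump /= add1n.
  + have := kM j ord_max; rewrite /= => h.
    apply: leq_trans (_ : M * (rk (from j)).+1 <= _)%N; last by rewrite leq_mul2l rkP orbT.
    by rewrite mulnS addnC ltn_add2r.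
  + apply: leq_trans (leq_addr _ _); rewrite ltn_mul2l /= ltnS.
    exact: leq_bigmax.
  + by rewrite ltn_add2l.
- move=> b z [[[j|[j e]]|j]|[i|[i e]]] //=.
  + exact: mulr_ge0 (cJ0 j) (wf_weight_ge0 (super_edge_wf j) _ _ _).
  + exact: mulr_ge0 (cI0 i z) (wf_weight_ge0 (wfG i) _ _ _).
- move=> b z z' [[[j|[j e]]|j]|[i|[i e]]] //= ag.
  + congr (_ * _); exact: (wf_weight_local (super_edge_wf j) _ ag).
  + congr (_ * _); last exact: (wf_weight_local (wfG i) _ ag).
    exact: cI_agree (wf_label_sub _ (wfG i)) ag.
- move=> [[[j|[j e]]|j]|[i|[i e]]] s x y //= js lt ag xy.
  + congr (_ * _); exact: (wf_weight_dual (super_edge_wf j) js lt ag xy).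
  + congr (_ * _); last exact: (wf_weight_dual (wfG i) js lt ag xy).
    exact: cI_agree (wf_label_sub _ (wfG i)) ag.
Qed.

(** Flow is constant along a path, and inside a plugged graph it is a scaled unit flow fed at the
    root, so conservation has to be checked on the skeleton only. The condition on [cJ] is
    restricted to paths having an edge, since the factor used for a path that loads nothing is 0. *)
Lemma compose_unit_flow Z f y :
  (forall j, 0 <= pJ j y) -> (forall i, 0 <= pI i y) ->
  (forall j (e : edge (path j)), pJ j y != 0 -> cJ j != 0) ->
  (forall i, pI i y != 0 -> unit_flow Z f (G i) y) ->
  (forall i (e : edge (G i)),
     pI i y != 0 -> loading e -> flow y e != 0 -> cI i y != 0) ->
  (forall v, (v == top)%:R + \sum_(j | to j == v) pJ j y =
     \sum_(j | from j == v) pJ j y + \sum_(i | host i == v) pI i y) ->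
  unit_flow Z f GC y.
Proof.
move=> pJ0 pI0 cJn0 flowG cIn0 conserv; split.
- case=> [[[j|[j e]]|j]|[i|[i e]]] //=; first by rewrite mulr1.
  have [->|/flowG[p0 _ _ _]] := eqVneq (pI i y) 0; first by rewrite mul0r.
  exact: mulr_ge0.
- case=> [[[j|[j e]]|j]|[i|[i e]]] le /eqP; try by rewrite oner_eq0.
  + rewrite /= mulr1 mulf_eq0 [X in _ || X]gt_eqF ?orbF; last first.
      exact: (@sparse_weight_gt0 R N (lab (from j)) _ true y e).
    by move=> /eqP c0; apply/eqP; apply: contra_eqT c0 => /(cJn0 j e).
  + rewrite /= mulf_eq0; have [->|pn0] := eqVneq (pI i y) 0; first by rewrite mul0r.
    have [_ w0 _ _] := flowG _ pn0.
    move=> /orP[/eqP c0|/eqP /(w0 e le) ->]; last by rewrite mulr0.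
    have [->|fn0] := eqVneq (flow y e) 0; first by rewrite mulr0.
    by have := cIn0 i e pn0 le fn0; rewrite c0 eqxx.
- rewrite [outflow _ _]outflow_skel [inflow _ _]inflow_skel -conserv eqxx.
  by rewrite addrK.
- case=> [[v|[j k]]|[i v]] /= vtop.
  + left; rewrite [inflow _ _]inflow_skel [outflow _ _]outflow_skel -conserv.
    suff /negPf -> : v != top by rewrite add0r.
    by apply: contra vtop => /eqP ->.
  + by left; rewrite [inflow _ _]inflow_path [outflow _ _]outflow_path.
  + rewrite [inflow _ _]inflow_plug [outflow _ _]outflow_plug.
    have [->|/flowG[_ _ rt oth]] := eqVneq (pI i y) 0; first by left; rewrite !mul0r.
    have [->|vr] := eqVneq v (root (G i)).
      by left; congr (_ * _); rewrite -rt subrK.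
    by have [->|[-> cert]] := oth v vr; [left; rewrite add0r|right; rewrite mulr0].
Qed.

End Compose.

(** * Single edges, OR, and loading before branching *)

Section SingleEdge.
Variables (R : realType) (N : finType).
Implicit Types (S U z y : {set N}).

Lemma single_edge_wf S U : (#|U| <= 1)%N -> wf_lgraph S (single_edge R S U).
Proof.
move=> U1; split => //=.
- case; have [sub|/subsetPn[j jU jS]] := boolP (U \subset S).
    by left; apply/setUidPl.
  right; exists j => //; rewrite setUC; congr (_ :|: _); apply/esym/eqP.
  by rewrite eqEcard sub1set jU cards1.
- move=> [] //; apply: connect1; apply/existsP; exists tt => //=.
- by exists (fun v : bool => nat_of_bool v).
Qed.

Lemma single_edge_C0 S U z : C0 (single_edge R S U) z <= 1.
Proof.
rewrite /C0 big_mkcond (big_pred1 tt) /=; last by case.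
by case: ifP.
Qed.

Lemma single_edge_C1 S U y : C1 (single_edge R S U) y <= 1.
Proof.
rewrite /C1 big_mkcond (big_pred1 tt) /=; last by case.
by case: ifP; rewrite ?expr1n ?divr1.
Qed.

Lemma single_edge_flow Z f S U y :
  certificate Z f y (S :|: U) -> unit_flow Z f (single_edge R S U) y.
Proof.
move=> cert; split => //=.
- by rewrite /outflow /inflow (big_pred1 tt) ?big_pred0 ?subr0 //; case.
- by case=> // _; right; split => //; rewrite /outflow big_pred0.
Qed.

End SingleEdge.

Section Or.
Variables (R : realType) (N : finType).
Variables (S0 : {set N}) (k : nat) (I : finType) (G : I -> lgraph R N).
Variable Ypos : I -> {set {set N}}.
Hypothesis wfG : forall i, wf_lgraph S0 (G i).
Local Notation GO := (or_graph S0 k G Ypos).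

Lemma or_wf : wf_lgraph S0 GO.
Proof.
apply: (@compose_wf _ _ _ _ _ _ _ _ _ _ _ _ _ _ _ _ _ (fun=> 0%N)) => //.
- by case.
- by move=> i z; rewrite divr_ge0 ?C1max_ge0.
Qed.

Lemma or_C0 z : C0 GO z = \sum_i C1max (G i) (Ypos i) / k%:R * C0 (G i) z.
Proof. by rewrite compose_C0 // [X in X + _]big1 ?add0r // => -[]. Qed.

Hypothesis k_gt0 : (0 < k)%N.

(** At most [k] components carry flow, namely 1/k each, over weights scaled by M/k. Such a component
    contributes (1/k)(C1/M) <= 1/k. *)
Lemma or_C1_le y : C1 GO y <= 1.
Proof.
rewrite compose_C1 // [X in X + _]big1 ?add0r => [|[]] //.
set s := take k _; have us : uniq s by rewrite take_uniq // enum_uniq.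
have k0 : 0 < k%:R^-1 :> R by rewrite invr_gt0 ltr0n.
apply: (@le_trans _ _ (\sum_(i in s) k%:R^-1)).
  rewrite [leRHS]big_mkcond; apply: ler_sum => i _.
  case: ifP => [si|_]; last by rewrite expr0n !mul0r.
  have yi : y \in Ypos i by have := mem_take si; rewrite mem_enum inE.
  have := C1_le_max (G i) yi; have := C1_ge0 y (wfG i).
  set c := C1 _ _; set M := C1max _ _ => c0 cM.
  (* Division by 0 yields 0, so a component with [M] = 0 contributes nothing. *)
  have [M0|M0] := eqVneq M 0.
    by rewrite M0 mul0r invr0 mulr0 mul0r ltW.
  have -> : k%:R^-1 ^+ 2 / (M / k%:R) * c = k%:R^-1 * (c / M).
    by field; rewrite M0 /= pnatr_eq0 -lt0n k_gt0.
  rewrite ger_pMr // ler_pdivrMr ?mul1r // lt_neqAle eq_sym M0.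
  exact: le_trans cM.
rewrite sumr_const -[_ *+ _]mulr_natl (card_uniqP us) ler_pdivrMr ?ltr0n //.
by rewrite mul1r ler_nat size_take_min geq_minl.
Qed.

Lemma or_C1max_le Y : C1max GO Y <= 1.
Proof. by apply: C1max_le => // y _; apply: or_C1_le. Qed.

Lemma or_flow Z f y :
  (k <= #|[set i | y \in Ypos i]|)%N ->
  (forall i, y \in Ypos i -> unit_flow Z f (G i) y) -> unit_flow Z f GO y.
Proof.
move=> kY flowG.
have k0 : 0 < k%:R^-1 :> R by rewrite invr_gt0 ltr0n.
have act i : i \in take k (enum [set i | y \in Ypos i]) -> y \in Ypos i.
  by move=> /mem_take; rewrite mem_enum inE.
apply: compose_unit_flow => //.
- by move=> i; case: ifP => // _; apply: ltW.
- by move=> i; case: ifP => [/act/flowG //|]; rewrite eqxx.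
- move=> i e; case: ifP => [/act yi _ le fe|]; last by rewrite eqxx.
  apply: mulf_neq0; last by rewrite gt_eqF.
  exact: C1max_neq0 (wfG i) (flowG i yi) yi le fe.
- case; rewrite [X in _ + X = _]big_pred0 // [X in _ = X + _]big_pred0 // addr0 add0r /=.
  rewrite -big_mkcond /= sumr_const (card_uniqP (take_uniq _ (enum_uniq _))).
  rewrite size_takel -?cardE // -[_^-1 *+ k]mulr_natl divff //.
  by rewrite pnatr_eq0 -lt0n.
Qed.

End Or.

Section LoadThen.
Variables (R : realType) (N : finType).
Variables (S : {set N}) (G : {set N} -> lgraph R N).
Hypothesis wfG : forall lam, wf_lgraph S (G lam).
Local Notation GL := (load_then S G).

Lemma load_then_wf : wf_lgraph set0 GL.
Proof.
apply: (@compose_wf _ _ _ _ _ _ _ _ _ _ _ _ _ _ _ _ _ (fun b : bool => nat_of_bool b)) => //.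
- by move=> _; apply: sub0set.
- by case=> //; apply: connect1; apply/existsP; exists tt.
- by move=> i z z' /eqP ->.
Qed.

(** Exactly one branch matches the restriction of the input to [S], so sums over all branches
    collapse to it. *)
Lemma sum_active (F : {lam : {set N} | lam \subset S} -> R) z :
  \sum_(i : {lam : {set N} | lam \subset S}) (z :&: S == val i)%:R * F i =
  F (exist _ (z :&: S) (subsetIr z S)).
Proof.
rewrite (bigD1 (exist _ (z :&: S) (subsetIr z S))) //= eqxx mul1r.
rewrite big1 ?addr0 // => i /negPf; rewrite -val_eqE /= eq_sym => ->.
by rewrite mul0r.
Qed.

Lemma load_then_C0 z :
  C0 GL z <= load_cost R z S + C0 (G (z :&: S)) z.
Proof.
rewrite compose_C0 //=; last by move=> _; apply: sub0set.
rewrite (sum_active (fun i => C0 (G (val i)) z)) lerD2r.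
rewrite (big_pred1 tt) /=; last by case.
by rewrite mul1r /super_edge setD0 sparse_C0_le.
Qed.

Lemma load_then_C1 y : C1 GL y <= 2 + C1 (G (y :&: S)) y.
Proof.
rewrite compose_C1 //=; last by move=> _; apply: sub0set.
rewrite (eq_bigr (fun i => (y :&: S == val i)%:R * C1 (G (val i)) y)); last first.
  move=> i _; case: eqP => _; first by rewrite expr1n divr1.
  by rewrite expr0n !mul0r.
rewrite (sum_active (fun i => C1 (G (val i)) y)) lerD2r.
rewrite (big_pred1 tt) /=; last by case.
by rewrite expr1n divr1 mul1r sparse_C1_le.
Qed.

Lemma load_then_flow Z f y :
  unit_flow Z f (G (y :&: S)) y -> unit_flow Z f GL y.
Proof.
move=> flowG; apply: compose_unit_flow => //.
- by move=> [lam lamS] /=; case: (y :&: S =P lam) => [<- //|_]; rewrite eqxx.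
- have sum1 : \sum_(j : unit) 1 = 1 :> R by rewrite (big_pred1 tt) //; case.
  case=> /=; last by rewrite sum1 big_pred0 // big_pred0.
  rewrite sum1 big_pred0 // !add0r -[LHS](sum_active (fun=> 1) y).
  by apply: eq_bigr => i _; rewrite mulr1.
Qed.

End LoadThen.

(** * Johnson construction: correctness and positive complexity *)

Ltac card_lia :=
  repeat match goal with
  | H : is_true (in_mem _ _) |- _ => clear H
  | H : is_true (~~ in_mem _ _) |- _ => clear H
  | H : in_mem _ _ = _ |- _ => clear H
  | H : is_true (_ \subset _) |- _ => clear H
  end; lia.

Section JohnsonTheory.
Variables (R : realType) (N V : finType) (W : {set V}) (k : nat).
Variables (S0 : {set N}) (load : {set V} -> {set N}).
Variables (Y : {set {set N}}) (target : {set N} -> option (V * V)).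
Variables (G : {set V} -> {set N} -> lgraph R N).
Variables (Ypos : {set V} -> {set N} -> {set {set N}}).
Local Notation GJ := (johnson W k S0 load Y target G Ypos).
Local Notation node := (jnode W k).
Local Notation lab := (@jlabel N V W k S0 load).
Local Notation n1 := (n_used R W k).
Local Notation pJ := (fun (e : jedge W k) y =>
  if on_route target y (val e).1 && on_route target y (val e).2
  then n1^-1 else 0).
Local Notation pI := (fun (i : jplug W k S0 load) y =>
  if jactive i y && on_route target y (Some (val i).1) then n1^-1 else 0).

Lemma jsuper_Some (A B : node) : jsuper (Some A, Some B) =
  (val A \subset val B) && (#|val B| == #|val A|.+1).
Proof. by []. Qed.

Lemma jsuper_None (A : node) : jsuper (None, Some A) = (#|val A| == k.-2).
Proof. by []. Qed.

Lemma sum_jedge_to (F : option node -> R) v :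
  \sum_(e : jedge W k | (val e).2 == v) F (val e).1 =
  \sum_(u | jsuper (u, v)) F u.
Proof.
rewrite -(big_sub_cond (@jsuper V W k) (fun p => p.2 == v) (fun p => F p.1)).
rewrite (eq_bigl (fun p => true && (jsuper (p.1, p.2) && (p.2 == v)))); last by case.
rewrite -(pair_big_dep xpredT (fun u w => jsuper (u, w) && (w == v)) (fun u _ => F u)).
rewrite [RHS]big_mkcond; apply: eq_bigr => u _.
under eq_bigl do rewrite andbC.
by rewrite big_mkcondr big_pred1_eq.
Qed.

Lemma sum_jedge_from (F : option node -> R) v :
  \sum_(e : jedge W k | (val e).1 == v) F (val e).2 =
  \sum_(u | jsuper (v, u)) F u.
Proof.
rewrite -(big_sub_cond (@jsuper V W k) (fun p => p.1 == v) (fun p => F p.2)).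
rewrite (eq_bigl (fun p => (p.1 == v) && jsuper (p.1, p.2))); last first.
  by case=> u w; rewrite andbC.
rewrite -(pair_big_dep (fun u => u == v) (fun u w => jsuper (u, w)) (fun _ w => F w)).
by rewrite big_pred1_eq.
Qed.

Lemma sum_jplug (P : pred node) (F : node -> {set N} -> R) z :
  \sum_(i : jplug W k S0 load | P (val i).1)
     (if jactive i z then F (val i).1 (val i).2 else 0) =
  \sum_(A : node | P A && (#|val A| == k)) F A (z :&: lab (Some A)).
Proof.
rewrite -(big_sub_cond
  (fun p : node * {set N} => (#|val p.1| == k) && (p.2 \subset lab (Some p.1)))
  (fun p => P p.1)
  (fun p => if z :&: lab (Some p.1) == p.2 then F p.1 p.2 else 0)).
rewrite (eq_bigl (fun p : node * {set N} =>
  (P p.1 && (#|val p.1| == k)) && (p.2 \subset lab (Some p.1)))); last first.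
  by case=> A lam /=; rewrite [LHS]andbC andbA.
rewrite -(pair_big_dep (fun A : node => P A && (#|val A| == k))
  (fun A (lam : {set N}) => lam \subset lab (Some A))
  (fun A lam => if z :&: lab (Some A) == lam then F A lam else 0)).
apply: eq_bigr => A _; rewrite -big_mkcondr /=.
under eq_bigl do rewrite andbC eq_sym.
by rewrite big_mkcondr big_pred1_eq subsetIr.
Qed.

Hypothesis load_mono : forall A B : {set V}, A \subset B -> load A \subset load B.
Hypothesis wfG : forall A lam, wf_lgraph (S0 :|: load A) (G A lam).

Lemma jlabel_mono (e : jedge W k) : lab (val e).1 \subset lab (val e).2.
Proof.
case: e => [[[A|] [B|]]] //= AB; last exact: subsetUl.
by apply/setUS/load_mono; case/andP: AB.
Qed.

Lemma plug_wf (i : jplug W k S0 load) :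
  wf_lgraph (lab (Some (val i).1)) (G (val (val i).1) (val i).2).
Proof. exact: wfG. Qed.

Hypothesis k_gt1 : (1 < k)%N.

Lemma johnson_wf : wf_lgraph S0 GJ.
Proof.
apply: (@compose_wf R N (option node) lab None (jedge W k)
  (fun e => (val e).1) (fun e => (val e).2) _ _ _ _ _ _ _ jlabel_mono plug_wf
  (fun v => if v is Some A then #|val A|.+1 else 0%N)).
- case=> [[[A|] [B|]]] //= /andP[_ /eqP ->] //.
- case=> [A|]; last exact: connect0.
  (* Induction on the excess of #|A| over k - 2: deleting any element gives a smaller node, down to
     the sets reached directly from the root. *)
  have [d dA] := ubnPeq (#|val A| - k.-2)%N; elim: d A dA => [|d IH] A dA.
    have eA : #|val A| == k.-2 by have := valP A => /andP[_]; lia.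
    by apply: connect1; apply/existsP; exists (exist _ (None, Some A) eA); rewrite !eqxx.
  have [/card_gt0P[j jA]] : (0 < #|val A|)%N by lia.
  have cB := cardsD1 j (val A); rewrite jA add1n in cB.
  have PB : (val A :\ j \subset W) && (k.-2 <= #|val A :\ j| <= k)%N.
    have /andP[AW Ak] := valP A.
    by rewrite (subset_trans (subD1set _ _) AW) andTb; lia.
  apply: connect_trans (IH (exist _ (val A :\ j) PB) _) (connect1 _); first by rewrite SubK; lia.
  apply/existsP.
  have eAB : @jsuper V W k (Some (exist _ (val A :\ j) PB), Some A).
    by rewrite /jsuper !SubK subD1set cB eqxx.
  by exists (exist _ (Some (exist _ (val A :\ j) PB), Some A) eAB); rewrite !eqxx.
- by move=> e; rewrite divr_ge0 ?C1max_ge0.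
- by move=> i z; case: ifP => // _; rewrite divr_ge0 ?C1max_ge0.
- by move=> i z z' /eqP ag; rewrite /jactive ag.
Qed.

Lemma johnson_C0 z :
  C0 GJ z = \sum_(e : jedge W k) C1max (jload R S0 load e) Y / n1 *
                                 C0 (jload R S0 load e) z +
    \sum_(A : node | #|val A| == k)
       C1max (G (val A) (z :&: lab (Some A))) (Ypos (val A) (z :&: lab (Some A))) / n1
       * C0 (G (val A) (z :&: lab (Some A))) z.
Proof.
rewrite compose_C0; [|exact: jlabel_mono|exact: plug_wf]; congr (_ + _).
rewrite -(sum_jplug xpredT (fun A lam =>
  C1max (G (val A) lam) (Ypos (val A) lam) / n1 * C0 (G (val A) lam) z)).
by apply: eq_bigr => i _; case: ifP => //; rewrite mul0r.
Qed.

Section Flow.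
Variables (y : {set N}) (j1 j2 : V).
Hypothesis k_le : (k <= #|W|)%N.
Hypothesis yY : y \in Y.
Hypothesis tgt_y : target y = Some (j1, j2).
Hypothesis j1W : j1 \in W.
Hypothesis j2W : j2 \in W.
Hypothesis j12 : j1 != j2.

Lemma n_used_gt0 : 0 < n1.
Proof. by rewrite ltr0n bin_gt0; lia. Qed.

Lemma on_route_Some (A : node) : on_route target y (Some A) =
  ((j1 \in val A) == (k.-2 < #|val A|)%N) && ((j2 \in val A) == (k.-1 < #|val A|)%N).
Proof. by rewrite /on_route tgt_y. Qed.

Lemma on_route_None : on_route target y (None : option node).
Proof. by rewrite /on_route tgt_y. Qed.

Lemma node_card (A : node) : (k.-2 <= #|val A| <= k)%N.
Proof. by have /andP[] := valP A. Qed.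

Lemma node_sub (A : node) : val A \subset W.
Proof. by have /andP[] := valP A. Qed.

(** A set on the route contains neither target at size k - 2, only [j1] at size k - 1, and both at
    size k. Its predecessor on the route can therefore only drop the target added last, and its
    successor can only add the next one. Apart from the common root, the flow runs along disjoint
    paths. *)
Definition flow_pred (A : node) : option node :=
  if #|val A| == k.-2 then None
  else insub (val A :\ (if #|val A| == k.-1 then j1 else j2)).

Definition flow_succ (A : node) : option node :=
  insub ((if #|val A| == k.-2 then j1 else j2) |: val A).

Lemma insub_eq_some (A : {set V}) (B : node) :
  (Some B == insub A :> option node) = (val B == A).
Proof.
case: insubP => [A' _ <-|nA]; first by rewrite -val_eqE.
by apply/esym/negP => /eqP e; rewrite -e (valP B) in nA.
Qed.

Lemma flow_predP (A : node) u : on_route target y (Some A) ->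
  jsuper (u, Some A) && on_route target y u = (u == flow_pred A).
Proof.
rewrite on_route_Some /flow_pred => /andP[/eqP A1 /eqP A2].
have kA := node_card A.
case: u => [B|]; last first.
  rewrite jsuper_None on_route_None andbT; case: ifP => kA2; rewrite ?eqxx //.
  (* A failing [insub] would return [None], which denotes the root here; the smaller set has to be
     shown to be a node. *)
  case: insubP => // /negP[]; rewrite (subset_trans (subD1set _ _) (node_sub A)) andTb.
  have := cardsD1 (if #|val A| == k.-1 then j1 else j2) (val A).
  have -> : (if #|val A| == k.-1 then j1 else j2) \in val A.
    by case: ifP => e; rewrite ?A1 ?A2; card_lia.
  by card_lia.
rewrite jsuper_Some on_route_Some; have kB := node_card B.
case: ifP => kA2.
  by apply/negP => /andP[/andP[_ /eqP cA] _]; move: kA kB kA2 cA; clear; card_lia.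
rewrite [RHS](insub_eq_some _ B).
apply/idP/eqP => [/andP[/andP[BA /eqP cA]] /andP[/eqP B1 /eqP B2]|eB].
  have jB : (if #|val A| == k.-1 then j1 else j2) \notin val B.
    by case: ifP => e; rewrite ?B1 ?B2; card_lia.
  have jA : (if #|val A| == k.-1 then j1 else j2) \in val A.
    by case: ifP => e; rewrite ?A1 ?A2; card_lia.
  apply/eqP; rewrite eqEcard subsetD1 BA jB andTb.
  by have := cardsD1 (if #|val A| == k.-1 then j1 else j2) (val A); rewrite jA; card_lia.
have jA : (if #|val A| == k.-1 then j1 else j2) \in val A.
  by case: ifP => e; rewrite ?A1 ?A2; card_lia.
have cA : (#|val A| = #|val B|.+1)%N.
  by rewrite (cardsD1 (if #|val A| == k.-1 then j1 else j2) (val A)) jA eB.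
have mB i : (i \in val B) = (i != (if #|val A| == k.-1 then j1 else j2)) && (i \in val A).
  by rewrite eB !inE.
rewrite {1}eB subD1set cA eqxx !andTb !mB A1 A2.
have [e|e] := eqVneq #|val A| k.-1.
  by rewrite eqxx [_ == j1]eq_sym (negPf j12); apply/andP; split; apply/eqP; card_lia.
by rewrite (negPf j12) eqxx; apply/andP; split; apply/eqP; card_lia.
Qed.

Lemma flow_succP (A : node) u : on_route target y (Some A) -> (#|val A| < k)%N ->
  jsuper (Some A, u) && on_route target y u = (u == flow_succ A).
Proof.
rewrite on_route_Some /flow_succ => /andP[/eqP A1 /eqP A2] ltA.
have kA := node_card A.
set j := if _ then _ else _.
have jA : j \notin val A by rewrite /j; case: ifP => e; rewrite ?A1 ?A2; card_lia.
have jW : j \in W by rewrite /j; case: ifP.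
have cA := cardsU1 j (val A); rewrite jA add1n in cA.
have PB : (j |: val A \subset W) && (k.-2 <= #|j |: val A| <= k)%N.
  by rewrite subUset sub1set jW node_sub andTb; card_lia.
case: u => [B|]; last by case: insubP => // /negP[].
rewrite [RHS](insub_eq_some _ B) jsuper_Some on_route_Some; have kB := node_card B.
apply/idP/eqP => [/andP[/andP[AB /eqP cB]] /andP[/eqP B1 /eqP B2]|eB].
  have jB : j \in val B by rewrite /j; case: ifP => e; rewrite ?B1 ?B2; card_lia.
  by apply/esym/eqP; rewrite eqEcard subUset sub1set jB AB andTb; card_lia.
have mB i : (i \in val B) = (i == j) || (i \in val A) by rewrite eB !inE.
have cB : #|val B| = #|val A|.+1 by rewrite eB.
rewrite {1}eB subsetUr cB eqxx !andTb !mB A1 A2 /j.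
have [e|e] := eqVneq #|val A| k.-2.
  by rewrite eqxx [_ == j1]eq_sym (negPf j12); apply/andP; split; apply/eqP; card_lia.
by rewrite (negPf j12) eqxx; apply/andP; split; apply/eqP; card_lia.
Qed.

Lemma pJ_to (A : node) :
  \sum_(e : jedge W k | (val e).2 == Some A) pJ e y =
  if on_route target y (Some A) then n1^-1 else 0.
Proof.
rewrite (eq_bigr (fun e : jedge W k =>
  if on_route target y (val e).1 && on_route target y (Some A) then n1^-1 else 0));
  last by move=> e /eqP ->.
rewrite (sum_jedge_to (fun u => if on_route target y u && _ then n1^-1 else 0)).
case: ifP => rA; last by apply: big1 => u _; rewrite andbF.
rewrite -big_mkcondr (big_pred1 (flow_pred A)) // => u.
by rewrite andbT; apply: flow_predP.
Qed.

Lemma pJ_from (A : node) :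
  \sum_(e : jedge W k | (val e).1 == Some A) pJ e y =
  if on_route target y (Some A) && (#|val A| < k)%N then n1^-1 else 0.
Proof.
rewrite (eq_bigr (fun e : jedge W k =>
  if on_route target y (Some A) && on_route target y (val e).2 then n1^-1 else 0));
  last by move=> e /eqP ->.
rewrite (sum_jedge_from (fun u => if _ && on_route target y u then n1^-1 else 0)).
have [rA|_] := boolP (on_route target y (Some A)); last by apply: big1.
have [ltA|leA] := ltnP #|val A| k.
  rewrite -big_mkcondr (big_pred1 (flow_succ A)) // => u.
  exact: flow_succP.
rewrite big_pred0 // => -[B|] //; rewrite jsuper_Some; apply/negP => /andP[_ /eqP].
by have := node_card B; lia.
Qed.

Lemma pI_host (A : node) :
  \sum_(i : jplug W k S0 load | Some (val i).1 == Some A) pI i y =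
  if on_route target y (Some A) && (#|val A| == k) then n1^-1 else 0.
Proof.
rewrite (eq_bigr (fun i : jplug W k S0 load => if jactive i y then
  (if on_route target y (Some (val i).1) then n1^-1 else 0) else 0)); last first.
  by move=> i _; case: jactive.
rewrite (eq_bigl (fun i : jplug W k S0 load => (val i).1 == A)) //.
rewrite (sum_jplug (pred1 A)
  (fun A _ => if on_route target y (Some A) then n1^-1 else 0)).
rewrite big_mkcondr big_pred1_eq.
by case: ifP => _; rewrite ?andbT ?andbF.
Qed.

(** Deleting the target pair sends these sets into the (k-2)-subsets of [W] without the pair. The
    map is injective because the size [s] determines which targets were present. *)
Lemma card_route s : (k.-2 <= s <= k)%N ->
  (#|[pred A : node | (#|val A| == s) && on_route target y (Some A)]|
    <= 'C(#|W|.-2, k.-2))%N.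
Proof.
move=> sk; rewrite -(card_in_imset (f := fun A : node => val A :\: [set j1; j2])).
  have <- : #|W :\: [set j1; j2]| = #|W|.-2.
    have : [set j1; j2] \subset W by rewrite subUset !sub1set j1W.
    by move=> /setIidPr; rewrite cardsD => ->; rewrite cards2 j12; lia.
  rewrite -cards_draws; apply/subset_leq_card/subsetP => _ /imsetP[A + ->].
  rewrite !inE => /andP[/eqP cA]; rewrite on_route_Some cA => /andP[/eqP A1 /eqP A2].
  rewrite setSD ?node_sub //= cardsD cA.
  have setI1 j c : (j \in val A) = c -> val A :&: [set j] = if c then [set j] else set0.
    by case: c => Aj; apply/setP => i; rewrite !inE; case: (i =P j) => [->|_];
      rewrite ?Aj ?andbF.
  rewrite setIUr (setI1 _ _ A1) (setI1 _ _ A2).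
  case: ifP => s2; case: ifP => s1; rewrite ?setU0 ?set0U ?cards1 ?cards0 ?cards2 ?j12; try lia.
move=> A B; rewrite !inE !on_route_Some => /andP[/eqP -> /andP[/eqP A1 /eqP A2]].
move=> /andP[/eqP cB]; rewrite cB => /andP[/eqP B1 /eqP B2] /setP AB.
apply/val_inj/setP => j /=; have := AB j; rewrite !inE.
have [->|_] := eqVneq j j1; first by rewrite A1 B1.
by have [->|_] := eqVneq j j2; first by rewrite A2 B2.
Qed.

(** At stage 0 the count has to be exact: it makes the flow leaving the root equal to 1. *)
Lemma card_route0 :
  #|[pred A : node | (#|val A| == k.-2) && on_route target y (Some A)]|
    = 'C(#|W|.-2, k.-2).
Proof.
have <- : #|W :\: [set j1; j2]| = #|W|.-2.
  have : [set j1; j2] \subset W by rewrite subUset !sub1set j1W.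
  by move=> /setIidPr; rewrite cardsD => ->; rewrite cards2 j12; lia.
rewrite -cards_draws -(card_imset _ val_inj); apply: eq_card => A.
rewrite !inE; apply/imsetP/andP => [[B + ->]|[AW cA]].
  rewrite inE on_route_Some => /andP[/eqP ->]; rewrite eqxx ltnn.
  have -> : (k.-1 < k.-2)%N = false by lia.
  move=> /andP[/eqP B1 /eqP B2]; split=> //; apply/subsetP => j jB; rewrite !inE.
  rewrite (subsetP (node_sub B)) // andbT; apply/norP.
  by split; apply: contraTneq jB => ->; rewrite ?B1 ?B2.
have PA : (A \subset W) && (k.-2 <= #|A| <= k)%N.
  by rewrite (subset_trans AW (subsetDl _ _)) (eqP cA) leqnn; lia.
exists (exist _ A PA) => //; rewrite inE on_route_Some /= cA (eqP cA) ltnn.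
have -> : (k.-1 < k.-2)%N = false by lia.
have nA j : j \in [set j1; j2] -> (j \in A) = false.
  by move=> j12'; apply/negP => /(subsetP AW); rewrite inE j12'.
by rewrite !nA ?inE ?eqxx ?orbT.
Qed.

Lemma pJ_from_root : \sum_(e : jedge W k | (val e).1 == None) pJ e y = 1.
Proof.
rewrite (eq_bigr (fun e : jedge W k =>
  if on_route target y (val e).2 then n1^-1 else 0)); last first.
  by move=> e /eqP ->; rewrite /= tgt_y.
rewrite (sum_jedge_from (fun u => if on_route target y u then n1^-1 else 0)).
rewrite -big_mkcondr.
rewrite (reindex_omap Some id) /=; last by case.
rewrite (eq_bigl [pred A : node | (#|val A| == k.-2) && on_route target y (Some A)]); last first.
  by move=> A; rewrite /= eqxx andbT.
rewrite sumr_const card_route0 -[_ *+ _]mulr_natl divff //.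
exact: lt0r_neq0 n_used_gt0.
Qed.

Lemma johnson_flow Z f :
  (forall (A : {set V}) (lam : {set N}), A \subset W -> #|A| = k -> j1 \in A -> j2 \in A ->
     y :&: (S0 :|: load A) = lam -> y \in Ypos A lam /\ unit_flow Z f (G A lam) y) ->
  unit_flow Z f GJ y.
Proof.
move=> flowG.
have n0 : 0 < n1^-1 by rewrite invr_gt0 n_used_gt0.
have [k2k k1k] : (k.-2 < k)%N /\ (k.-1 < k)%N by lia.
have plug i : pI i y != 0 ->
    jactive i y /\ y \in Ypos (val (val i).1) (val i).2 /\
    unit_flow Z f (G (val (val i).1) (val i).2) y.
  have /andP[/eqP ci _] := valP i.
  case: ifP => [|_]; last by rewrite eqxx.
  rewrite on_route_Some ci => /andP[act /andP[/eqP r1 /eqP r2]] _; split=> //.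
  apply: flowG => //; [exact: node_sub|by rewrite r1|by rewrite r2|].
  exact/eqP.
apply: compose_unit_flow => //.
- by move=> e; case: ifP => // _; apply: ltW.
- by move=> i; case: ifP => // _; apply: ltW.
(* An edge [ed] of the path carries flow 1 at positive weight on [y], which lies in [Y]; hence the
   scaling factor of this super edge is positive. *)
- move=> e ed _; rewrite mulf_neq0 ?(lt0r_neq0 n0) // lt0r_neq0 //.
  have wfe := super_edge_wf R lab (fun e : jedge W k => (val e).1)
                (fun e : jedge W k => (val e).2) e.
  apply: (C1max_gt0 wfe yY (e := ed)); rewrite ?oner_eq0 //.
    apply: sparse_loading; first by rewrite -setI_eq0 setIDA setDIl setDv set0I.
  by rewrite lt0r_neq0 // sparse_weight_gt0.
- by move=> i /plug[_ []].
- move=> i ed /plug[-> [yi fl]] le fe; rewrite mulf_neq0 ?(lt0r_neq0 n0) //.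
  exact: C1max_neq0 (wfG _ _) fl yi le fe.
- case=> [A|].
    rewrite pJ_to pJ_from pI_host add0r.
    have := node_card A; case: (on_route _ _ _) => /=; last by rewrite addr0.
    by have [] := ltngtP #|val A| k; rewrite ?addr0 ?add0r //; lia.
  rewrite eqxx pJ_from_root big_pred0 ?[X in _ = _ + X]big_pred0 //.
  by case=> [[[A|] [B|]]].
Qed.

Lemma johnson_C1_le :
  (forall (A : {set V}) (lam : {set N}), A \subset W -> #|A| = k -> j1 \in A -> j2 \in A ->
     y :&: (S0 :|: load A) = lam -> y \in Ypos A lam) ->
  C1 GJ y <= 4.
Proof.
move=> YG; have n0 : 0 < n1^-1 by rewrite invr_gt0 n_used_gt0.
have [k2k k1k] : (k.-2 < k)%N /\ (k.-1 < k)%N by lia.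
have ratio (c M : R) : 0 <= c -> c <= M -> n1^-1 ^+ 2 / (M / n1) * c <= n1^-1.
  move=> c0 cM; have [->|M0] := eqVneq M 0.
    by rewrite mul0r invr0 mulr0 mul0r ltW.
  have -> : n1^-1 ^+ 2 / (M / n1) * c = n1^-1 * (c / M).
    by field; rewrite M0 (lt0r_neq0 n_used_gt0).
  rewrite ger_pMr // ler_pdivrMr ?mul1r // lt_neqAle eq_sym M0.
  exact: le_trans cM.
rewrite compose_C1; [|exact: jlabel_mono|exact: plug_wf].
(* The three stages of super edges and the plugged graphs each contribute at most the total flow
   they carry, which is at most 1. *)
have -> : 4 = 3 + 1 :> R by rewrite natr1.
apply: lerD.
  apply: (@le_trans _ _ (\sum_(e : jedge W k) pJ e y)).
    apply: ler_sum => e _; case: ifP => _; last by rewrite expr0n !mul0r.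
    apply: ratio; last exact: C1_le_max.
    exact: (C1_ge0 y (super_edge_wf R lab (fun e : jedge W k => (val e).1)
      (fun e => (val e).2) e)).
  have route s : (k.-2 <= s <= k)%N ->
      \sum_(A : node | #|val A| == s)
         (if on_route target y (Some A) then n1^-1 else 0) <= 1.
    move=> sk; rewrite -big_mkcondr sumr_const -[_ *+ _]mulr_natl.
    by rewrite ler_pdivrMr ?n_used_gt0 // mul1r ler_nat card_route.
  (* The stage of a super edge is read off the size of its end point: k - 2, k - 1 or k. *)
  rewrite (partition_big (fun e : jedge W k => (val e).2) xpredT) //=.
  rewrite (bigD1 None) //= big_pred0 ?add0r; last by case=> [[[A|] [B|]]].
  rewrite (reindex_omap Some id) /=; last by case.
  rewrite (eq_bigl xpredT); last by move=> A; rewrite eqxx.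
  under eq_bigr do rewrite pJ_to.
  rewrite (bigID (fun A : node => #|val A| == k)) /=.
  rewrite [X in _ + X](bigID (fun A : node => #|val A| == k.-1)) /=.
  have -> : 3 = 1 + (1 + 1) :> R by ring.
  apply: lerD; first by apply: route; lia.
  apply: lerD.
    rewrite (eq_bigl (fun A : node => #|val A| == k.-1)); first by apply: route; lia.
    by move=> A; have := node_card A; rewrite /=; lia.
  rewrite (eq_bigl (fun A : node => #|val A| == k.-2)); first by apply: route; lia.
  by move=> A; have := node_card A; rewrite /=; lia.
apply: (@le_trans _ _ (\sum_(i : jplug W k S0 load) pI i y)).
  apply: ler_sum => i _; case: ifP => [/andP[act r]|_]; last by rewrite expr0n !mul0r.
  rewrite act; apply: ratio; first exact: (C1_ge0 y (wfG _ _)).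
  have /andP[/eqP ci _] := valP i.
  apply: C1_le_max; move: r; rewrite on_route_Some ci => /andP[/eqP r1 /eqP r2].
  apply: YG => //; [exact: node_sub|by rewrite r1|by rewrite r2|].
  exact/eqP.
rewrite (partition_big (fun i : jplug W k S0 load => Some (val i).1) xpredT) //=.
rewrite (bigD1 None) //= big_pred0 ?add0r //.
rewrite (reindex_omap Some id) /=; last by case.
rewrite (eq_bigl xpredT); last by move=> A; rewrite eqxx.
under eq_bigr do rewrite pI_host.
rewrite -big_mkcond sumr_const -[_ *+ _]mulr_natl.
rewrite ler_pdivrMr ?n_used_gt0 // mul1r ler_nat.
apply: leq_trans (card_route (s := k) _); last by lia.
by apply: eq_leq; apply: eq_card => A; rewrite !inE andbC.
Qed.

End Flow.
End JohnsonTheory.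

(** * Johnson construction: negative complexity *)

Section Draws.
Variables (R : realType) (V : finType) (W : {set V}).

(** The sets avoiding [j] are the q-subsets of [W :\ j]. The additive form avoids truncated
    subtraction and the case [q] = 0. *)
Lemma card_draws_mem q j : j \in W ->
  (#|[set A : {set V} | (A \subset W) && (#|A| == q) & j \in A]| + 'C(#|W|.-1, q) =
   'C(#|W|, q))%N.
Proof.
move=> jW; rewrite -[in RHS]cards_draws.
rewrite -[RHS](cardsID [set A : {set V} | j \in A]).
congr (_ + _)%N; first by apply: eq_card => A; rewrite !inE.
have <- : #|W :\ j| = #|W|.-1 by rewrite (cardsD1 j W) jW.
rewrite -cards_draws; apply: eq_card => A.
by rewrite !inE subsetD1 [RHS]andbC andbAC.
Qed.

(** Linearity of expectation: each [j] lies in a fraction q / #|W| of the q-subsets, by w C(w-1, q)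
    = (w - q) C(w, q). If q > #|W|, both sides vanish. *)
Lemma sum_draws q (r : V -> R) : (0 < #|W|)%N ->
  \sum_(A : {set V} | (A \subset W) && (#|A| == q)) \sum_(j in A) r j =
  q%:R / #|W|%:R * 'C(#|W|, q)%:R * \sum_(j in W) r j.
Proof.
move=> W0; rewrite (exchange_big_dep (mem W)) /=; last first.
  by move=> A j /andP[/subsetP AW _] /AW.
rewrite mulr_sumr; apply: eq_bigr => j jW.
rewrite sumr_const -[_ *+ _]mulr_natl; congr (_ * _).
have := card_draws_mem q jW.
set c := #|[set _ | _ & _]| => cq.
have -> : #|[pred A : {set V} | (A \subset W) && (#|A| == q) & j \in A]| = c.
  by apply: eq_card => A; rewrite !inE.
have w0 : (#|W|%:R : R) != 0 by rewrite pnatr_eq0 -lt0n.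
have cR : c%:R + 'C(#|W|.-1, q)%:R = 'C(#|W|, q)%:R :> R by rewrite -natrD cq.
have [qw|wq] := leqP q #|W|.
  have : #|W|%:R * 'C(#|W|.-1, q)%:R = (#|W|%:R - q%:R) * 'C(#|W|, q)%:R :> R.
    by rewrite -natrB // -!natrM mul_bin_down.
  move: cR w0; move: (c%:R) (#|W|%:R) ('C(#|W|.-1, q)%:R) ('C(#|W|, q)%:R) => u w p s e w0 e'.
  apply: (mulfI w0); transitivity (w * s - w * p); first by rewrite -e; ring.
  by rewrite e'; field.
have cqw : 'C(#|W|, q) = 0%N by rewrite bin_small.
move: cq; rewrite cqw => /eqP; rewrite addn_eq0 => /andP[/eqP -> _].
by rewrite mulr0.
Qed.

Lemma sum_draws_const q (c : R) :
  \sum_(A : {set V} | (A \subset W) && (#|A| == q)) c = 'C(#|W|, q)%:R * c.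
Proof.
rewrite sumr_const mulr_natl -cards_draws; congr (_ *+ _).
by apply: eq_card => A; rewrite !inE.
Qed.

End Draws.

(** * Ratios between the super edges (or plugged sets) of a stage and the used ones *)

Section BinomialRatio.
Variables (R : realType) (k w : nat).
Hypotheses (k_gt1 : (1 < k)%N) (kw : (k <= w)%N).
Local Notation n1 := ('C(w.-2, k.-2)%:R : R).

Lemma bin_used_gt0 : 0 < n1.
Proof. by rewrite ltr0n bin_gt0; lia. Qed.

(** The ratio is w(w-1) / (k(k-1)); the factor 2 absorbs k <= 2(k-1). *)
Lemma bin_ratio_full : 'C(w, k)%:R / n1 <= 2 * (w%:R / k%:R) ^+ 2.
Proof.
rewrite ler_pdivrMr ?bin_used_gt0 //.
have e1 := mul_bin_diag w k.-1; have e2 := mul_bin_diag w.-1 k.-2.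
rewrite (_ : k.-1.+1 = k) in e1; last by lia.
rewrite (_ : k.-2.+1 = k.-1) in e2; last by lia.
have k0 : 0 < (k%:R : R) by rewrite ltr0n; lia.
have e : k%:R ^+ 2 * 'C(w, k)%:R <= 2 * w%:R ^+ 2 * n1.
  rewrite -!natrX -!natrM ler_nat.
  have e3 : (k * (k.-1 * 'C(w, k)) = w * (w.-1 * 'C(w.-2, k.-2)))%N by nia.
  nia.
have -> : 2 * (w%:R / k%:R) ^+ 2 * n1 = (k%:R ^+ 2)^-1 * (2 * w%:R ^+ 2 * n1).
  by field; rewrite lt0r_neq0.
by rewrite -ler_pdivrMl ?invr_gt0 ?exprn_gt0 // invrK.
Qed.

Variable delta : R.
Hypotheses (delta_gt0 : 0 < delta) (sep : separated delta k w).

Lemma separated_le : delta * w%:R <= (w - k.-1)%:R.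
Proof. by move: sep; rewrite /separated natrB; [lra|lia]. Qed.

(** Passing from w to w - 1 and then to w - 2 with k - 2 fixed multiplies the binomial by (w-k+2)/w
    and by (w-k+1)/(w-1). Separation makes both factors at least [delta]. *)
Lemma bin_ratio_stage0 : 'C(w, k.-2)%:R / n1 <= (delta ^+ 2)^-1.
Proof.
rewrite ler_pdivrMr ?bin_used_gt0 // ler_pdivlMl ?exprn_gt0 //.
have w0 : 0 < (w%:R : R) by rewrite ltr0n; lia.
have w1 : 0 < (w.-1%:R : R) by rewrite ltr0n; lia.
have e1 : w%:R * 'C(w.-1, k.-2)%:R = (w - k.-2)%:R * 'C(w, k.-2)%:R :> R.
  by rewrite -!natrM mul_bin_down.
have e2 : w.-1%:R * n1 = (w - k.-1)%:R * 'C(w.-1, k.-2)%:R :> R.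
  by rewrite -!natrM mul_bin_down; congr (_%:R); congr (_ * _)%N; lia.
have h := separated_le.
have h1 : delta * w%:R <= (w - k.-2)%:R by apply: le_trans h _; rewrite ler_nat; lia.
have h2 : delta * w.-1%:R <= (w - k.-1)%:R.
  by apply: le_trans h; rewrite ler_wpM2l ?ler_nat ?ltW //; lia.
have b1 : delta * 'C(w, k.-2)%:R <= 'C(w.-1, k.-2)%:R.
  rewrite -(ler_pM2l w0) e1 mulrCA mulrA.
  by rewrite ler_wpM2r.
have b2 : delta * 'C(w.-1, k.-2)%:R <= n1.
  rewrite -(ler_pM2l w1) e2 mulrCA mulrA.
  by rewrite ler_wpM2r.
by rewrite expr2 -mulrA; apply: le_trans b2; rewrite ler_wpM2l // ltW.
Qed.

(** The ratio is w(w-1) / ((k-1)(w-k+1)): one factor is controlled by separation, the other by k <=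
    2(k-1). *)
Lemma bin_ratio_stage1 : 'C(w, k.-1)%:R / n1 <= 2 * w%:R / (delta * k%:R).
Proof.
rewrite ler_pdivrMr ?bin_used_gt0 //.
have w1 : 0 < (w.-1%:R : R) by rewrite ltr0n; lia.
have k0 : 0 < (k%:R : R) by rewrite ltr0n; lia.
have e1 : w%:R * 'C(w.-1, k.-2)%:R = k.-1%:R * 'C(w, k.-1)%:R :> R.
  rewrite -!natrM mul_bin_diag; congr (_%:R); congr (_ * 'C(_, _))%N; lia.
have e2 : w.-1%:R * n1 = (w - k.-1)%:R * 'C(w.-1, k.-2)%:R :> R.
  by rewrite -!natrM mul_bin_down; congr (_%:R); congr (_ * _)%N; lia.
have h2 : delta * w.-1%:R <= (w - k.-1)%:R.
  by apply: le_trans separated_le; rewrite ler_wpM2l ?ler_nat ?ltW //; lia.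
have b2 : delta * 'C(w.-1, k.-2)%:R <= n1.
  rewrite -(ler_pM2l w1) e2 mulrCA mulrA.
  by rewrite ler_wpM2r.
have b1 : k%:R * 'C(w, k.-1)%:R <= 2 * (w%:R * 'C(w.-1, k.-2)%:R) :> R.
  by rewrite e1 -!natrM ler_nat mulnA leq_mul2r; apply/orP; right; lia.
have -> : 2 * w%:R / (delta * k%:R) * n1 = (k%:R)^-1 * (2 * w%:R * (n1 / delta)).
  by field; rewrite !lt0r_neq0.
rewrite ler_pdivlMl //; apply: le_trans b1 _; rewrite mulrA ler_wpM2l ?mulr_ge0 //.
by rewrite ler_pdivlMr // mulrC.
Qed.

End BinomialRatio.

(** * Cost of the three loading stages, averaged over the nodes *)

Section JohnsonCost.
Variables (R : realType) (N V : finType) (W : {set V}) (k : nat).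
Variables (S0 : {set N}) (load : {set V} -> {set N}).
Variables (Y : {set {set N}}) (target : {set N} -> option (V * V)).
Variables (G : {set V} -> {set N} -> lgraph R N).
Variables (Ypos : {set V} -> {set N} -> {set {set N}}).
Local Notation GJ := (johnson W k S0 load Y target G Ypos).
Local Notation node := (jnode W k).
Local Notation lab := (@jlabel N V W k S0 load).
Local Notation n1 := (n_used R W k).

Hypothesis load_mono : forall A B : {set V}, A \subset B -> load A \subset load B.
Hypothesis load_cup : forall (A : {set V}) s, s \in load A ->
  exists2 j, j \in A & s \in load [set j].
Hypothesis wfG : forall A lam, wf_lgraph (S0 :|: load A) (G A lam).
Hypotheses (k_gt1 : (1 < k)%N) (kW : (k <= #|W|)%N).

Variables (z : {set N}) (L : nat) (Lam : R) (r : V -> nat).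
Hypothesis LamP : forall U : {set N}, ln (#|U|.+1%:R) <= Lam.
Hypothesis load1 : forall j, (#|load [set j]| <= L)%N.
Hypothesis load1z : forall j, (#|z :&: load [set j]| <= r j)%N.

Lemma load_bigcup (A : {set V}) : load A \subset \bigcup_(j in A) load [set j].
Proof. by apply/subsetP => s /load_cup[j jA sj]; apply/bigcupP; exists j. Qed.

Lemma card_bigcup_le (A : {set V}) (F : V -> {set N}) :
  (#|\bigcup_(j in A) F j| <= \sum_(j in A) #|F j|)%N.
Proof.
elim/big_rec2: _ => [|j U m _ h]; first by rewrite cards0.
by apply: leq_trans (leq_card_setU _ _) _; rewrite leq_add2l.
Qed.

Lemma load_card (A : {set V}) : (#|load A| <= #|A| * L)%N.
Proof.
apply: leq_trans (subset_leq_card (load_bigcup A)) _.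
apply: leq_trans (card_bigcup_le _ _) _.
by rewrite -sum_nat_const; apply: leq_sum => j _.
Qed.

Lemma load_cardz (A : {set V}) : (#|z :&: load A| <= \sum_(j in A) r j)%N.
Proof.
apply: leq_trans (subset_leq_card (setIS z (load_bigcup A))) _.
rewrite big_distrr /=.
apply: leq_trans (card_bigcup_le _ _) _.
by apply: leq_sum => j _.
Qed.

Definition stage0_cost (A : {set V}) : R :=
  6 * (k * L)%:R * (\sum_(j in A) r j).+1%:R * Lam.
Definition step_cost (j : V) : R := 6 * L%:R * (r j).+1%:R * Lam.

Lemma Lam_ge0 : 0 <= Lam.
Proof. exact: le_trans (ln_nat_ge0 R _) (LamP set0). Qed.

Lemma step_cost_ge0 j : 0 <= step_cost j.
Proof. by rewrite !mulr_ge0 // Lam_ge0. Qed.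

Lemma load_cost_stage0 (B : node) :
  load_cost R z (lab (Some B) :\: lab None) <= stage0_cost (val B).
Proof.
have sub : lab (Some B) :\: lab None \subset load (val B).
  by rewrite /= setDUl setDv set0U subsetDl.
apply: load_cost_le => //.
  apply: leq_trans (subset_leq_card sub) (leq_trans (load_card _) _).
  by rewrite leq_mul2r; have /and3P[_ _ ->] := valP B; rewrite orbT.
exact: leq_trans (subset_leq_card (setIS z sub)) (load_cardz _).
Qed.

Lemma load_cost_step (A B : node) j : val A = val B :\ j ->
  load_cost R z (lab (Some B) :\: lab (Some A)) <= step_cost j.
Proof.
move=> AB.
have sub : lab (Some B) :\: lab (Some A) \subset load [set j].
  apply/subsetP => s; rewrite !in_setD !in_setU => /andP[/norP[/negPf -> sA]] /=.
  move=> /load_cup[i iB si].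
  have [<- //|ij] := eqVneq i j.
  case/negP: sA; apply: (subsetP (load_mono _)) si.
  by rewrite sub1set; move: AB => /= ->; rewrite !inE ij.
apply: load_cost_le => //; first exact: leq_trans (subset_leq_card sub) _.
exact: leq_trans (subset_leq_card (setIS z sub)) _.
Qed.

(** A node of size k - 2 is entered from the root only, a larger one only from the sets obtained by
    deleting one of its elements. The two exclusive cases are written as a sum so that they can be
    summed over the nodes separately. *)
Lemma sum_steps_to (B : node) :
  \sum_(u | jsuper (u, Some B)) load_cost R z (lab (Some B) :\: lab u) <=
  (if #|val B| == k.-2 then stage0_cost (val B) else 0) +
  (if #|val B| != k.-2 then \sum_(j in val B) step_cost j else 0).
Proof.
rewrite (bigID (pred1 None)) /=; apply: lerD.
  rewrite (eq_bigl (fun u : option node => (u == None) && jsuper (u, Some B))); last first.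
    by move=> u; rewrite andbC.
  rewrite big_mkcondr big_pred1_eq jsuper_None; case: ifP => // _.
  exact: load_cost_stage0.
rewrite (reindex_omap Some id) /=; last by case=> //=; rewrite andbF.
case: ifPn => [Bk|]; last first.
  rewrite negbK => /eqP Bk; rewrite big1 // => A /andP[/andP[/andP[_ /eqP cA] _] _].
  by have := node_card A; move: cA Bk; rewrite /= => -> e; lia.
apply: (@le_trans _ _ (\sum_(A : node) \sum_(j in val B | val A == val B :\ j) step_cost j)).
  rewrite big_mkcond; apply: ler_sum => A _; case: ifP; last first.
    by move=> _; apply: sumr_ge0 => j _; apply: step_cost_ge0.
  move=> /andP[/andP[/andP[AB /eqP cB] _] _].
  have /cards1P[j jE] : #|val B :\: val A| == 1%N.
    by rewrite cardsD (setIidPr AB) /= cB subSnn.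
  have /setDP[jB jA] : j \in val B :\: val A by rewrite jE set11.
  have AE : val A = val B :\ j.
    by rewrite -jE setDDr setDv set0U; apply/esym/setIidPr.
  rewrite (bigD1 j) /=; last by rewrite jB AE eqxx.
  apply: ler_wpDr; last exact: load_cost_step.
  by apply: sumr_ge0 => i _; apply: step_cost_ge0.
rewrite (exchange_big_dep (mem (val B))) /=; last by move=> A j _ /andP[].
apply: ler_sum => j jB; rewrite sumr_const -[_ *+ _]mulr_natl.
rewrite ler_piMl ?step_cost_ge0 // lern1.
apply: leq_trans (_ : #|[pred A : {set V} | A == val B :\ j]| <= _)%N; last first.
  by rewrite card1.
rewrite -(card_image val_inj); apply/subset_leq_card/subsetP => A.
by move=> /imageP[C + ->]; rewrite !inE => /andP[].
Qed.

Lemma sum_node s (F : {set V} -> R) : (k.-2 <= s <= k)%N ->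
  \sum_(B : node | #|val B| == s) F (val B) =
  \sum_(B : {set V} | (B \subset W) && (#|B| == s)) F B.
Proof.
move=> sk; rewrite -(big_sub_cond (fun A : {set V} => (A \subset W) && (k.-2 <= #|A| <= k)%N)
  (fun A : {set V} => #|A| == s)).
apply: eq_bigl => A; rewrite unfold_in; case: (_ \subset _) => //=.
by case: eqP => [->|]; rewrite ?sk ?andbF.
Qed.

Lemma sum_super_edges :
  \sum_(e : jedge W k) load_cost R z (lab (val e).2 :\: lab (val e).1) <=
  6 * Lam * L%:R *
   ('C(#|W|, k.-2)%:R * k%:R * (k%:R / #|W|%:R * \sum_(j in W) (r j)%:R + 1) +
    'C(#|W|, k.-1)%:R * (\sum_(j in W) (r j)%:R + #|W|%:R)).
Proof.
have W0 : (0 < #|W|)%N by lia.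
have w0 : (#|W|%:R : R) != 0 by rewrite pnatr_eq0 -lt0n.
set Rs := \sum_(j in W) _.
have Rs0 : 0 <= Rs by apply: sumr_ge0.
rewrite (partition_big (fun e : jedge W k => (val e).2) xpredT) //=.
rewrite (bigD1 None) //= big_pred0 ?add0r; last by case=> [[[A|] [B|]]].
rewrite (reindex_omap Some id) /=; last by case.
rewrite (eq_bigl xpredT); last by move=> A; rewrite eqxx.
apply: (@le_trans _ _ (\sum_(B : node)
  ((if #|val B| == k.-2 then stage0_cost (val B) else 0) +
   (if #|val B| != k.-2 then \sum_(j in val B) step_cost j else 0)))).
  apply: ler_sum => B _.
  rewrite (eq_bigr (fun e : jedge W k =>
    load_cost R z (lab (Some B) :\: lab (val e).1))); last by move=> e /eqP ->.
  by rewrite (sum_jedge_to (fun u => load_cost R z (lab (Some B) :\: lab u)))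
    sum_steps_to.
rewrite big_split /= -!big_mkcond /=.
rewrite (sum_node (s := k.-2) stage0_cost); last by lia.
rewrite [X in _ + X](bigID (fun A : node => #|val A| == k)) /=.
rewrite [X in _ + (X + _)](eq_bigl (fun B : node => #|val B| == k)); last first.
  by move=> B; have := node_card B; rewrite /=; lia.
rewrite [X in _ + (_ + X)](eq_bigl (fun B : node => #|val B| == k.-1)); last first.
  by move=> B; have := node_card B; rewrite /=; lia.
rewrite !(sum_node (fun B => \sum_(j in B) step_cost j)); [|lia|lia].
rewrite !sum_draws //.
have -> : \sum_(j in W) step_cost j = 6 * L%:R * Lam * (Rs + #|W|%:R).
  rewrite /Rs -sum1_card natr_sum -big_split mulr_sumr; apply: eq_bigr => j _.
  by rewrite /step_cost -[(r j).+1%:R]natr1 /=; ring.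
have -> : \sum_(A : {set V} | (A \subset W) && (#|A| == k.-2)) stage0_cost A =
    6 * (k * L)%:R * Lam * 'C(#|W|, k.-2)%:R * (k.-2%:R / #|W|%:R * Rs + 1).
  under eq_bigr => A _ do rewrite /stage0_cost -[(\sum_(j in A) _).+1%:R]natr1 natr_sum mulrDr mulrDl.
  rewrite big_split /= sum_draws_const -mulr_suml -mulr_sumr sum_draws //.
  by rewrite -/Rs; ring.
(* Stages 1 and 2 are treated together: every [j] is the added element of C(w-1, k-2) + C(w-1, k-1)
   = C(w, k-1) super edges, where w = #|W|. *)
have pascal : k%:R * 'C(#|W|, k)%:R + k.-1%:R * 'C(#|W|, k.-1)%:R =
    #|W|%:R * 'C(#|W|, k.-1)%:R :> R.
  rewrite -!natrM -natrD; congr (_%:R).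
  have := mul_bin_left #|W| k.-1; rewrite (_ : k.-1.+1 = k); last by lia.
  by move=> ->; rewrite -mulnDl; congr (_ * _)%N; lia.
have -> : k%:R / #|W|%:R * 'C(#|W|, k)%:R * (6 * L%:R * Lam * (Rs + #|W|%:R)) +
   k.-1%:R / #|W|%:R * 'C(#|W|, k.-1)%:R * (6 * L%:R * Lam * (Rs + #|W|%:R)) =
   'C(#|W|, k.-1)%:R * (6 * L%:R * Lam * (Rs + #|W|%:R)).
  rewrite -mulrDl; congr (_ * _); apply: (mulfI w0); rewrite -pascal; field.
  exact: w0.
rewrite [leRHS]mulrDr; apply: lerD; last by rewrite -subr_ge0 (_ : _ - _ = 0) //; ring.
rewrite natrM.
have -> : 6 * (k%:R * L%:R) * Lam * 'C(#|W|, k.-2)%:R * (k.-2%:R / #|W|%:R * Rs + 1) =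
  6 * Lam * L%:R * ('C(#|W|, k.-2)%:R * k%:R * (k.-2%:R / #|W|%:R * Rs + 1)) by ring.
do 2! (apply: ler_wpM2l; first by rewrite !mulr_ge0 // Lam_ge0).
rewrite lerD2r ler_wpM2r // ler_wpM2r ?invr_ge0 // ler_nat; lia.
Qed.

Lemma johnson_C0_le (delta : R) : 0 < delta -> separated delta k #|W| ->
  C0 GJ z <=
  12 * Lam * L%:R *
   (k%:R / delta ^+ 2 * (k%:R / #|W|%:R * \sum_(j in W) (r j)%:R + 1) +
    2 * #|W|%:R / (delta * k%:R) * (\sum_(j in W) (r j)%:R + #|W|%:R)) +
  \sum_(A : {set V} | (A \subset W) && (#|A| == k))
    C1max (G A (z :&: (S0 :|: load A))) (Ypos A (z :&: (S0 :|: load A))) / n1 *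
    C0 (G A (z :&: (S0 :|: load A))) z.
Proof.
move=> d0 sep.
have n0 : 0 < n1 := bin_used_gt0 R k_gt1 kW.
rewrite johnson_C0 //; apply: lerD; last first.
  rewrite (sum_node (s := k) (fun A =>
    C1max (G A (z :&: (S0 :|: load A))) (Ypos A (z :&: (S0 :|: load A))) / n1 *
    C0 (G A (z :&: (S0 :|: load A))) z)) //.
  lia.
(* The scaling factor of each super edge is at most 2 / n1, by the bound 2 on the positive
   complexity of SparseLoad; with the 6 of [load_cost] this gives 12. *)
apply: (@le_trans _ _ (2 / n1 *
  \sum_(e : jedge W k) load_cost R z (lab (val e).2 :\: lab (val e).1))).
  rewrite mulr_sumr; apply: ler_sum => e _; apply: ler_pM.
  - by rewrite divr_ge0 ?C1max_ge0 // ltW.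
  - exact: (C0_ge0 z (super_edge_wf R lab (fun e : jedge W k => (val e).1)
      (fun e => (val e).2) e)).
  - rewrite ler_pM2r ?invr_gt0 //; apply: C1max_le => // y _.
    exact: sparse_C1_le.
  - exact: sparse_C0_le.
set Rs := \sum_(j in W) _; have Rs0 : 0 <= Rs by apply: sumr_ge0.
apply: (@le_trans _ _ (2 / n1 * (6 * Lam * L%:R *
   ('C(#|W|, k.-2)%:R * k%:R * (k%:R / #|W|%:R * Rs + 1) +
    'C(#|W|, k.-1)%:R * (Rs + #|W|%:R))))).
  apply: ler_wpM2l; last exact: sum_super_edges.
  by rewrite divr_ge0 // ltW.
have -> : 2 / n1 * (6 * Lam * L%:R *
   ('C(#|W|, k.-2)%:R * k%:R * (k%:R / #|W|%:R * Rs + 1) +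
    'C(#|W|, k.-1)%:R * (Rs + #|W|%:R))) =
  12 * Lam * L%:R *
   ('C(#|W|, k.-2)%:R / n1 * (k%:R * (k%:R / #|W|%:R * Rs + 1)) +
    'C(#|W|, k.-1)%:R / n1 * (Rs + #|W|%:R)) by ring.
have : 0 <= k%:R / #|W|%:R * Rs + 1 by rewrite addr_ge0 // mulr_ge0 // divr_ge0.
move: (_ * Rs + 1) => X X0.
apply: ler_wpM2l; first by rewrite !mulr_ge0 // Lam_ge0.
apply: lerD; last first.
  by apply: ler_wpM2r; [rewrite addr_ge0|exact: bin_ratio_stage1].
rewrite [leRHS]mulrAC [leRHS]mulrC.
by apply: ler_wpM2r; [rewrite mulr_ge0|exact: bin_ratio_stage0].
Qed.

End JohnsonCost.

(** * The learning graph for Triangle *)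

Section Pairs.
Variable n : nat.
Implicit Types (z y S : {set vpair n}) (u v w t : 'I_n) (X A B : {set 'I_n}).

Lemma adjP z u v : reflect (exists2 e : vpair n, e \in z & val e = [set u; v]) (adj z u v).
Proof.
apply: (iffP existsP) => [[e /andP[ez /eqP ee]]|[e ez ee]]; exists e => //.
by rewrite ez ee eqxx.
Qed.

Lemma pairsP A B (e : vpair n) :
  reflect (exists u v, [/\ u \in A, v \in B & val e = [set u; v]]) (e \in pairs A B).
Proof.
rewrite inE; apply: (iffP existsP) => [[u /andP[uA /existsP[v /andP[vB /eqP ee]]]]|].
  by exists u, v.
move=> [u [v [uA vB ee]]]; exists u; rewrite uA; apply/existsP; exists v.
by rewrite vB ee eqxx.
Qed.

Lemma adjC z u v : adj z u v = adj z v u.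
Proof. by rewrite /adj setUC. Qed.

Lemma adj_neq z u v : adj z u v -> u != v.
Proof.
move=> /adjP[e _ ee]; have := valP e; rewrite /= -/(val e) ee cards2.
by case: (u != v).
Qed.

Lemma adjS z z' u v : z \subset z' -> adj z u v -> adj z' u v.
Proof. by move=> /subsetP zz' /adjP[e /zz' ez ee]; apply/adjP; exists e. Qed.

Lemma adj_setI z S A B u v : u \in A -> v \in B -> pairs A B \subset S ->
  adj (z :&: S) u v = adj z u v.
Proof.
move=> uA vB /subsetP sub; apply/idP/idP; first exact/adjS/subsetIl.
move=> /adjP[e ez ee]; apply/adjP; exists e => //; rewrite inE ez sub //.
by apply/pairsP; exists u, v.
Qed.

Lemma pairsS A A' B B' : A \subset A' -> B \subset B' -> pairs A B \subset pairs A' B'.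
Proof.
move=> /subsetP sA /subsetP sB; apply/subsetP => e /pairsP[u [v [/sA uA /sB vB ee]]].
by apply/pairsP; exists u, v.
Qed.

Lemma pairsC A B : pairs A B = pairs B A.
Proof.
apply/setP => e; apply/pairsP/pairsP => -[u [v [uA vB ee]]]; exists v, u.
  by rewrite setUC.
by rewrite setUC.
Qed.

Lemma pairs_cup A B (e : vpair n) : e \in pairs A B ->
  exists2 v, v \in B & e \in pairs A [set v].
Proof.
by move=> /pairsP[u [v [uA vB ee]]]; exists v => //; apply/pairsP; exists u, v; rewrite set11.
Qed.

Lemma pairs_load_mono A B B' : B \subset B' -> pairs A B \subset pairs A B'.
Proof. exact: pairsS. Qed.

Lemma pair1_val u v (e : vpair n) : e \in pairs [set u] [set v] -> val e = [set u; v].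
Proof. by move=> /pairsP[u' [v' [/set1P -> /set1P -> ->]]]. Qed.

Lemma card_pair1 u v : (#|pairs [set u] [set v]| <= 1)%N.
Proof.
rewrite leqNgt; apply/negP => /card_gt1P[e [e' [/pair1_val ee /pair1_val ee' /eqP]]].
by apply; apply: val_inj; rewrite ee ee'.
Qed.

Lemma card_pair1z z u v : (#|z :&: pairs [set u] [set v]| <= adj z u v)%N.
Proof.
have [->|[e]] := set_0Vmem (z :&: pairs [set u] [set v]); first by rewrite cards0.
rewrite inE => /andP[ez /pair1_val ee].
have -> : adj z u v by apply/adjP; exists e.
exact: leq_trans (subset_leq_card (subsetIr _ _)) (card_pair1 u v).
Qed.

Lemma card_pairs1 A v : (#|pairs A [set v]| <= #|A|)%N.
Proof.
apply: leq_trans (_ : \sum_(t in A) 1 <= _)%N; last by rewrite sum1_card.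
apply: leq_trans (leq_sum _ (fun t _ => card_pair1 t v)).
apply: leq_trans (card_bigcup_le _ _).
apply/subset_leq_card/subsetP => e; rewrite pairsC => /pairs_cup[t tA et].
by apply/bigcupP; exists t; rewrite // pairsC.
Qed.

Lemma card_pairs1z z A v : (#|z :&: pairs A [set v]| <= \sum_(t in A) adj z t v)%N.
Proof.
apply: leq_trans (leq_sum _ (fun t _ => card_pair1z z t v)).
apply: leq_trans (card_bigcup_le _ _).
apply/subset_leq_card/subsetP => e /setIP[ez]; rewrite pairsC => /pairs_cup[t tA et].
by apply/bigcupP; exists t; rewrite // in_setI ez pairsC.
Qed.

Lemma triangle_mem z u v w :
  triangle z u v w -> [/\ adj z u v, adj z u w & adj z v w].
Proof. by move/and3P. Qed.

Lemma certificate_triangle m y S u v w :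
  triangle y u v w -> pairs [set u] [set v] \subset S ->
  pairs [set u] [set w] \subset S -> pairs [set v] [set w] \subset S ->
  certificate (graphs n m) (@Triangle n) y S.
Proof.
move=> /triangle_mem[uv uw vw] Suv Suw Svw z _ /eqP ag.
apply/existsP; exists u; apply/existsP; exists v; apply/existsP; exists w.
apply/and3P; split; apply: (adjS (subsetIl z S)); rewrite ag.
- by rewrite (adj_setI y (set11 u) (set11 v)).
- by rewrite (adj_setI y (set11 u) (set11 w)).
- by rewrite (adj_setI y (set11 v) (set11 w)).
Qed.

Lemma nbhdE z u v : (v \in nbhd z u) = adj z u v.
Proof. by rewrite inE. Qed.

End Pairs.

(** * Well-formedness, flow and positive complexity of each layer *)

Section TriangleGraph.
Variables (R : realType) (n m : nat).
Implicit Types (z y S lam : {set vpair n}) (u v w t : 'I_n) (X A B : {set 'I_n}).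
Implicit Types (D : {set 'I_n * 'I_n}) (Y : {set {set vpair n}}).
Local Notation uflow := (unit_flow (graphs n m) (@Triangle n)).

Lemma search_edge_wf S D Y : wf_lgraph S (search_edge R S D Y).
Proof. by apply: or_wf => p; apply/single_edge_wf/card_pair1. Qed.

Lemma search_edge_flow S D Y y :
  y \in Y -> (exists2 p, p \in D & adj y p.1 p.2) ->
  (forall p, p \in D -> adj y p.1 p.2 ->
     certificate (graphs n m) (@Triangle n) y (S :|: pairs [set p.1] [set p.2])) ->
  uflow (search_edge R S D Y) y.
Proof.
move=> yY [p pD py] cert; apply: or_flow => //.
- by move=> q; apply/single_edge_wf/card_pair1.
- by apply/card_gt0P; exists (exist _ p pD); rewrite !inE yY.
- move=> [q qD]; rewrite inE => /andP[_ qy].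
  exact/single_edge_flow/cert.
Qed.

Lemma search_edge_C0 S D Y z : C0 (search_edge R S D Y) z <= #|D|%:R.
Proof.
rewrite or_C0; last by move=> p; apply/single_edge_wf/card_pair1.
apply: (@le_trans _ _ (\sum_(p : {p : 'I_n * 'I_n | p \in D}) 1)).
  apply: ler_sum => p _; rewrite divr1; apply: mulr_ile1.
  - exact: C1max_ge0.
  - exact: (C0_ge0 z (single_edge_wf R S (card_pair1 _ _))).
  - by apply: C1max_le => // y _; apply: single_edge_C1.
  - exact: single_edge_C0.
by rewrite sumr_const card_sig.
Qed.

Lemma search_edge_C1 S D Y y : C1 (search_edge R S D Y) y <= 1.
Proof. by apply: or_C1_le => // p; apply/single_edge_wf/card_pair1. Qed.

Lemma graph_Ht_wf t : wf_lgraph set0 (graph_Ht R m t).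
Proof. by apply: load_then_wf => lam; apply: search_edge_wf. Qed.

Lemma graph_Ht_flow t y : y \in YHt m t -> uflow (graph_Ht R m t) y.
Proof.
move=> yY; apply: load_then_flow; set S := pairs _ _.
(* All pairs at [t] are loaded, so the neighbourhood of [t] read from the loaded part is the true
   one. *)
have adjt u : adj (y :&: S) t u = adj y t u.
  by apply: adj_setI (set11 t) (in_setT u) _.
apply: search_edge_flow; first by rewrite inE yY eqxx.
  move: yY; rewrite inE => /andP[_ /existsP[u /existsP[v /triangle_mem[uv ut vt]]]].
  by exists (u, v) => //; rewrite inE !nbhdE !adjt ![adj y t _]adjC ut vt.
move=> [u v]; rewrite inE !nbhdE !adjt /= ![adj y t _]adjC => /andP[ut vt] uv.
apply: (@certificate_triangle _ _ _ _ u v t); first by apply/and3P.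
- exact: subsetUr.
- by apply: subset_trans (subsetUl _ _); rewrite pairsC; apply: pairsS; rewrite ?subsetT.
- by apply: subset_trans (subsetUl _ _); rewrite pairsC; apply: pairsS; rewrite ?subsetT.
Qed.

Lemma graph_Ht_C1max t Y : C1max (graph_Ht R m t) Y <= 3.
Proof.
apply: C1max_le => // y _.
apply: le_trans (load_then_C1 (fun lam => search_edge_wf _ _ _) y) _.
have -> : 3 = 2 + 1 :> R by ring.
by rewrite lerD2l search_edge_C1.
Qed.

Lemma graph_H_wf X : wf_lgraph set0 (graph_H R m X).
Proof. by apply: or_wf => t; apply: graph_Ht_wf. Qed.

Lemma graph_H_flow X y : y \in YH m X -> uflow (graph_H R m X) y.
Proof.
rewrite inE => /andP[_ /existsP[t /andP[tX yt]]]; apply: or_flow => //.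
- by move=> s; apply: graph_Ht_wf.
- by apply/card_gt0P; exists (exist _ t tX); rewrite inE.
- by move=> s; apply: graph_Ht_flow.
Qed.

Section WithB.
Variable b : nat.
Hypothesis b_gt1 : (1 < b)%N.

Lemma graph_FAw_wf X A lam w : wf_lgraph (pairs X A) (graph_FAw R m b X A lam w).
Proof.
apply: johnson_wf => // [B B'|B lam']; first exact: pairs_load_mono.
exact: search_edge_wf.
Qed.

Section Positive.
Variables (X A : {set 'I_n}) (lam : {set vpair n}) (w : 'I_n) (y : {set vpair n}).
Hypothesis yFAw : y \in YFAw m X A lam w.

Lemma FAw_target : exists j1 j2,
  [/\ [pick p : 'I_n * 'I_n | [&& p.1 \in A, p.2 \in A & triangle y p.1 p.2 w]]
        = Some (j1, j2), j1 \in A, j2 \in A & triangle y j1 j2 w].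
Proof.
case: pickP => [[j1 j2] /and3P[? ? ?]|none]; first by exists j1, j2.
move: yFAw; rewrite inE => /andP[_ /andP[_ /existsP[u /andP[uA /existsP[v /andP[vA t]]]]]].
by have := none (u, v); rewrite /= uA vA t.
Qed.

Lemma FAwB_mem j1 j2 B lam' : triangle y j1 j2 w -> j1 \in B -> j2 \in B ->
  y :&: (pairs X A :|: pairs [set w] B) = lam' -> y \in YFAwB m X A lam w B lam'.
Proof.
move=> t j1B j2B ey; rewrite inE yFAw ey eqxx /=.
by apply/existsP; exists j1; rewrite j1B; apply/existsP; exists j2; rewrite j2B.
Qed.

(** A common neighbour of the target pair in [X] would form a triangle meeting [X], and such inputs
    are left to [graph_H]. This is why the target pair survives in [Delta]. *)
Lemma FAw_no_triangle_X u v t : t \in X -> ~~ triangle y u v t.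
Proof.
move=> tX; apply/negP => tr.
move: yFAw; rewrite inE => /andP[+ _]; rewrite inE => /andP[/negP + yT]; apply.
have yg : y \in graphs n m by move: yT; rewrite inE => /andP[].
rewrite inE yg; apply/existsP; exists t; rewrite tX inE yg.
by apply/existsP; exists u; apply/existsP; exists v.
Qed.

Lemma FAwB_flow j1 j2 B lam' : triangle y j1 j2 w -> j1 \in B -> j2 \in B ->
  y :&: (pairs X A :|: pairs [set w] B) = lam' ->
  uflow (search_edge R (pairs X A :|: pairs [set w] B) (Delta lam' X B w)
           (YFAwB m X A lam w B lam')) y.
Proof.
move=> tr j1B j2B ey; have yB := FAwB_mem tr j1B j2B ey.
have [a12 a1 a2] := triangle_mem tr.
have adjw u : u \in B -> adj lam' w u = adj y w u.
  by move=> uB; rewrite -ey; apply: adj_setI (set11 w) uB (subsetUr _ _).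
have sub : lam' \subset y by rewrite -ey subsetIl.
apply: search_edge_flow => //.
  exists (j1, j2) => //; rewrite inE j1B j2B !nbhdE /= !adjw // ![adj y w _]adjC.
  rewrite a1 a2 !andbT; apply/eqP/setP => t; rewrite !inE; apply/negP.
  move=> /andP[/andP[/(adjS sub) t1 /(adjS sub) t2] tX].
  by move: (FAw_no_triangle_X j1 j2 tX); rewrite /triangle a12 t1 t2.
(* Any edge found in [Delta], whether or not it is the target pair, closes a triangle with [w],
   whose other two edges are already loaded. *)
move=> [u v]; rewrite inE /= => /and5P[uB vB _]; rewrite !nbhdE !adjw //.
rewrite ![adj y w _]adjC => uw vw uv.
apply: (@certificate_triangle _ _ _ _ u v w); first by apply/and3P.
- exact: subsetUr.
- apply: subset_trans (subsetUl _ _); rewrite pairsC.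
  by apply: subset_trans (subsetUr _ _); apply: pairsS; rewrite ?sub1set ?set11.
- apply: subset_trans (subsetUl _ _); rewrite pairsC.
  by apply: subset_trans (subsetUr _ _); apply: pairsS; rewrite ?sub1set ?set11.
Qed.

Hypothesis bA : (b <= #|A|)%N.

Lemma graph_FAw_flow : uflow (graph_FAw R m b X A lam w) y.
Proof.
have [j1 [j2 [tgt j1A j2A tr]]] := FAw_target.
have [a12 _ _] := triangle_mem tr.
apply: (@johnson_flow _ _ _ _ _ _ _ _ _ _ _ _ b_gt1 y j1 j2) => //.
- by move=> B lam'; apply: search_edge_wf.
- exact: adj_neq a12.
- move=> B lam' _ _ j1B j2B ey; split; first exact: FAwB_mem tr j1B j2B ey.
  exact: FAwB_flow tr j1B j2B ey.
Qed.

Lemma graph_FAw_C1 : C1 (graph_FAw R m b X A lam w) y <= 4.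
Proof.
have [j1 [j2 [tgt j1A j2A tr]]] := FAw_target.
have [a12 _ _] := triangle_mem tr.
apply: (@johnson_C1_le _ _ _ _ _ _ _ _ _ _ _ _ _ b_gt1 y j1 j2) => //.
- by move=> B B'; apply: pairs_load_mono.
- by move=> B lam'; apply: search_edge_wf.
- exact: adj_neq a12.
- by move=> B lam' _ _ j1B j2B ey; apply: FAwB_mem tr j1B j2B ey.
Qed.

End Positive.

Lemma graph_FA_wf X A lam : wf_lgraph (pairs X A) (graph_FA R m b X A lam).
Proof. by apply: or_wf => w; apply: graph_FAw_wf. Qed.

Lemma graph_FA_flow X A lam y : (b <= #|A|)%N ->
  y \in YFA m X A lam -> uflow (graph_FA R m b X A lam) y.
Proof.
move=> bA /bigcupP[w _ yw]; apply: or_flow.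
- by move=> w'; apply: graph_FAw_wf.
- exact: ltnSn.
- by apply/card_gt0P; exists w; rewrite inE.
- by move=> w' yw'; apply: graph_FAw_flow yw' bA.
Qed.

Variable a : nat.
Hypotheses (ba : (b <= a)%N) (an : (a <= n)%N).

Lemma a_gt1 : (1 < a)%N.
Proof. exact: leq_trans b_gt1 ba. Qed.

Lemma graph_F_load_wf X A lam :
  wf_lgraph (set0 :|: pairs X A) (graph_FA R m b X A lam).
Proof. by rewrite set0U; apply: graph_FA_wf. Qed.

Lemma graph_F_wf X : wf_lgraph set0 (graph_F R m a b X).
Proof.
apply: johnson_wf a_gt1 => [B B'|B lam]; first exact: pairs_load_mono.
exact: graph_F_load_wf.
Qed.

Lemma F_target X y : y \in YF m X -> exists j1 j2,
  [pick p : 'I_n * 'I_n | [exists w, triangle y p.1 p.2 w]] = Some (j1, j2) /\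
  exists w, triangle y j1 j2 w.
Proof.
move=> yF; case: pickP => [[j1 j2] /existsP[w tr]|none].
  by exists j1, j2; split=> //; exists w.
move: yF; rewrite inE => /andP[_]; rewrite inE => /andP[_].
move=> /existsP[u /existsP[v /existsP[w tr]]].
by have /existsP[] := none (u, v); exists w.
Qed.

Lemma FA_mem X A lam y j1 j2 w : y \in YF m X -> triangle y j1 j2 w ->
  j1 \in A -> j2 \in A -> y :&: (set0 :|: pairs X A) = lam -> y \in YFA m X A lam.
Proof.
move=> yF tr j1A j2A; rewrite set0U => ey; apply/bigcupP; exists w => //.
rewrite inE yF ey eqxx /=.
by apply/existsP; exists j1; rewrite j1A; apply/existsP; exists j2; rewrite j2A.
Qed.

Lemma graph_F_flow X y : y \in YF m X -> uflow (graph_F R m a b X) y.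
Proof.
move=> yF; have [j1 [j2 [tgt [w tr]]]] := F_target yF.
have [a12 _ _] := triangle_mem tr.
apply: (@johnson_flow _ _ _ _ _ _ _ _ _ _ _ _ a_gt1 y j1 j2).
- exact: graph_F_load_wf.
- by rewrite cardsT card_ord.
- exact: yF.
- exact: tgt.
- exact: in_setT.
- exact: in_setT.
- exact: adj_neq a12.
- move=> A lam _ cA j1A j2A ey; have yA := FA_mem yF tr j1A j2A ey; split; first exact: yA.
  by apply: graph_FA_flow; rewrite ?cA.
Qed.

Lemma graph_F_C1max X : C1max (graph_F R m a b X) (YF m X) <= 4.
Proof.
apply: C1max_le => // y yF; have [j1 [j2 [tgt [w tr]]]] := F_target yF.
have [a12 _ _] := triangle_mem tr.
apply: (@johnson_C1_le _ _ _ _ _ _ _ _ _ _ _ _ _ a_gt1 y j1 j2).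
- by move=> B B'; apply: pairs_load_mono.
- exact: graph_F_load_wf.
- by rewrite cardsT card_ord.
- exact: yF.
- exact: tgt.
- exact: in_setT.
- exact: in_setT.
- exact: adj_neq a12.
- by move=> A lam _ _ j1A j2A; apply: FA_mem yF tr j1A j2A.
Qed.

Lemma graph_HF_wf X (h : bool) :
  wf_lgraph set0 (if h then graph_H R m X else graph_F R m a b X).
Proof. by case: h; [apply: graph_H_wf|apply: graph_F_wf]. Qed.

Lemma graph_X_wf X : wf_lgraph set0 (graph_X R m a b X).
Proof. by apply: or_wf => h; apply: graph_HF_wf. Qed.

Lemma graph_X_flow X y : y \in Ytri n m -> uflow (graph_X R m a b X) y.
Proof.
move=> yT; apply: or_flow => //.
- exact: graph_HF_wf.
- apply/card_gt0P; have [yH|yH] := boolP (y \in YH m X).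
    by exists true; rewrite inE.
  by exists false; rewrite inE /YF inE yH.
- by case; [apply: graph_H_flow|apply: graph_F_flow].
Qed.

Variable x : nat.
Hypothesis xn : (x <= n)%N.

Lemma triangle_graph_wf : wf_lgraph set0 (triangle_graph R n m x a b).
Proof. by apply: or_wf => X; apply: graph_X_wf. Qed.

Lemma triangle_graph_flow y :
  y \in Ytri n m -> uflow (triangle_graph R n m x a b) y.
Proof.
move=> yT; apply: or_flow.
- by move=> X; apply: graph_X_wf.
- by rewrite bin_gt0.
- rewrite (_ : [set _ | _] = [set: _]); last by apply/setP => X; rewrite [LHS]inE yT inE.
  have := card_draws 'I_n x; rewrite card_ord => <-; rewrite cardsT card_sig.
  by apply/eq_leq/eq_card => X; rewrite !inE.
- by move=> X _; apply: graph_X_flow.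
Qed.

Lemma triangle_graph_correct :
  is_learning_graph (graphs n m) (@Triangle n) (triangle_graph R n m x a b).
Proof. exact: wf_learning_graph triangle_graph_wf triangle_graph_flow. Qed.

End WithB.
End TriangleGraph.

(** * Degree sums and the pairs surviving in Delta *)

Section Counting.
Variable n : nat.
Implicit Types (z : {set vpair n}) (u v w t : 'I_n) (X A B : {set 'I_n}).

Lemma sum_adj z u A : (\sum_(v in A) adj z u v = #|nbhd z u :&: A|)%N.
Proof.
rewrite -sum1_card [RHS]big_mkcond [LHS]big_mkcond; apply: eq_bigr => v _.
by rewrite in_setI nbhdE; case: (v \in A); case: (adj z u v).
Qed.

Lemma sum_degree z : (\sum_u #|nbhd z u| <= 2 * #|z|)%N.
Proof.
have deg u : #|nbhd z u| = (\sum_v adj z u v)%N.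
  by rewrite -[nbhd z u]setIT -sum_adj; apply: eq_bigl => v; rewrite inE.
rewrite (eq_bigr _ (fun u _ => deg u)).
(* Incidences (u, v, e) are counted from the side of [e]: an edge {p, q} arises only from (p, q) and
   (q, p). *)
apply: (@leq_trans (\sum_(u : 'I_n) \sum_(v : 'I_n) \sum_(e in z) (val e == [set u; v]))).
  apply: leq_sum => u _; apply: leq_sum => v _.
  have [/adjP[e ez ee]|//] := boolP (adj z u v).
  by rewrite (bigD1 e) //= -/(val e) ee eqxx.
rewrite pair_big /= (exchange_big_dep (mem z)) //= mulnC -sum_nat_const.
apply: leq_sum => e ez; have /cards2P[p [q [pq ee]]] : #|val e| == 2 := valP e.
apply: (@leq_trans #|[set (p, q); (q, p)]|); last by rewrite cards2; case: (_ != _).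
rewrite -sum1_card big_mkcond [X in (_ <= X)%N]big_mkcond; apply: leq_sum => -[u v] _ /=.
rewrite ez -/(val e) ee in_set2 !xpair_eqE; case: eqP => // E.
have uE : u \in [set p; q] by rewrite E set21.
have pE : p \in [set u; v] by rewrite -E set21.
have qE : q \in [set u; v] by rewrite -E set22.
case/set2P: uE => uE; rewrite {}uE ?eqxx in pE qE *.
  by case/set2P: qE => [qp|->]; [move: pq; rewrite qp eqxx|rewrite eqxx].
by case/set2P: pE => [pp|->]; [move: pq; rewrite pp eqxx|rewrite eqxx orbT].
Qed.

(** In the Vandermonde expansion of C(n, x), the sets meeting a given d-set in exactly one point
    number d C(n-d, x-1). The identity x C(n-d, x) = (n-d-x+1) C(n-d, x-1) then costs at most a
    factor n. *)
Lemma bin_disjoint d x : (d <= n)%N -> (x * (d * 'C(n - d, x)) <= n * 'C(n, x))%N.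
Proof.
move=> dn; case: x => // x.
have /= V := binomial.Vandermonde d (n - d)%N x.+1.
rewrite subnKC // in V.
have le : (d * 'C(n - d, x) <= 'C(n, x.+1))%N.
  by rewrite -V big_ord_recl big_ord_recl /= /bump /= bin1 subn1 addnCA leq_addr.
rewrite mulnCA mul_bin_left mulnCA.
by apply: leq_mul => //; apply: leq_trans (leq_subr _ _) (leq_subr _ _).
Qed.

(* Pr_X[N_uv disjoint from X] decreases with |N_uv| fast enough for the
   expected number of surviving triples (u, v, w) to be n / x per pair. *)
Lemma sum_Delta z B x :
  (x * \sum_(X : {set 'I_n} | #|X| == x) \sum_w #|Delta z X B w| <=
   #|B| ^ 2 * (n * 'C(n, x)))%N.
Proof.
have cardD X w : #|Delta z X B w| = (\sum_(p in setX B B)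
    ((nbhd z p.1 :&: nbhd z p.2 :&: X == set0) * (w \in nbhd z p.1 :&: nbhd z p.2)))%N.
  rewrite -sum1_card [LHS]big_mkcond [RHS]big_mkcond; apply: eq_bigr => -[u v] _ /=.
  rewrite !inE /= ![adj z w _]adjC.
  by case: (u \in B); case: (v \in B); case: (_ == set0); case: (adj z u w);
    case: (adj z v w).
rewrite (eq_bigr (fun X => \sum_(p in setX B B)
  ((nbhd z p.1 :&: nbhd z p.2 :&: X == set0) * #|nbhd z p.1 :&: nbhd z p.2|))%N); last first.
  move=> X _; rewrite (eq_bigr _ (fun w _ => cardD X w)) exchange_big /=.
  apply: eq_bigr => p _; rewrite -big_distrr /=; congr (_ * _)%N.
  rewrite -sum1_card [RHS]big_mkcond; apply: eq_bigr => w _.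
  by case: (_ \in _).
rewrite exchange_big /= -mulnn -cardsX -sum_nat_const big_distrr /=.
apply: leq_sum => p _; rewrite -big_distrl /= mulnC [(_ * #|_|)%N]mulnC mulnC.
set S := nbhd _ _ :&: nbhd _ _.
have -> : (\sum_(X : {set 'I_n} | #|X| == x) (S :&: X == set0) = 'C(n - #|S|, x))%N.
  have -> : (n - #|S| = #|~: S|)%N by have := cardsC S; rewrite card_ord; lia.
  rewrite -cards_draws -sum1_card [LHS]big_mkcond [RHS]big_mkcond.
  apply: eq_bigr => X _; rewrite !inE setIC setI_eq0 disjoints_subset.
  by case: (#|X| == x); case: (X \subset ~: S).
by apply: bin_disjoint; rewrite -[X in (_ <= X)%N]card_ord max_card.
Qed.

End Counting.

(* Each term of the total cost is a multiple of Lam times one of the six terms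
   of the bound; terms up to n ^ 2 are absorbed in n ^ 3 / b, the fifth one. *)
Lemma total_cost_le (R : realFieldType) (n m x a b delta Lam : R) :
  0 < b -> b <= a -> a <= n -> 0 < x -> x <= n -> 0 <= m -> 0 < delta -> 1 <= Lam ->
  (21 * n * Lam + 48 * Lam * x * (a / delta ^+ 2 * (a / n) + 2 * n / (delta * a)))
    * (x / n * (2 * m)) +
  (21 * n * Lam * x +
   48 * Lam * x * (a / delta ^+ 2 + 2 * n / (delta * a) * n) +
   4 * (2 * (n / a) ^+ 2 * (48 * Lam *
     (b ^+ 2 / (a * delta ^+ 2) * (a / n * (2 * m)) +
      n * (b / delta ^+ 2 + 4 * a ^+ 2 / (delta * b)))))) +
  16 * (2 * (n / a) ^+ 2 * (2 * (a / b) ^+ 2)) * (b ^+ 2 * n / x) <=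
  (64 + 800 / delta ^+ 2 + 2000 / delta) * (Lam *
    (x * m + (a * x) ^+ 2 * (m / n ^+ 2) + (n / a) ^+ 2 *
      (a * x ^+ 2 * (m / n ^+ 2) + n * (b ^+ 2 * (m / n ^+ 2) + (a / b) ^+ 2 * (b + b ^+ 2 / x))))).
Proof.
move=> b0 ba an x0 xn m0 d0 L1; set d := m / n ^+ 2.
have a0 : 0 < a by lra.
have n0 : 0 < n by lra.
have L0 : 0 < Lam by lra.
pose i := delta^-1; have i0 : 0 < i by rewrite invr_gt0.
pose t1 := x * m; pose t2 := (a * x) ^+ 2 * d; pose t3 := (n / a) ^+ 2 * (a * x ^+ 2 * d).
pose t4 := (n / a) ^+ 2 * (n * (b ^+ 2 * d)).
(* [t5] is the fifth term of the bound after the powers of [a] have cancelled. *)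
pose t5 := n ^+ 3 / b; pose t6 := (n / a) ^+ 2 * (n * ((a / b) ^+ 2 * (b ^+ 2 / x))).
have d_ge0 : 0 <= d by rewrite divr_ge0 // exprn_ge0 // ltW.
have t1_ge0 : 0 <= t1 by rewrite mulr_ge0 // ltW.
have t2_ge0 : 0 <= t2 by rewrite mulr_ge0 // sqr_ge0.
have t3_ge0 : 0 <= t3 by rewrite mulr_ge0 ?sqr_ge0 // mulr_ge0 // mulr_ge0 ?sqr_ge0 // ltW.
have t4_ge0 : 0 <= t4.
  by rewrite mulr_ge0 ?sqr_ge0 // mulr_ge0 ?(ltW n0) // mulr_ge0 ?sqr_ge0.
have t5_ge0 : 0 <= t5 by rewrite divr_ge0 ?exprn_ge0 // ltW.
have t6_ge0 : 0 <= t6.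
  by rewrite mulr_ge0 ?sqr_ge0 // mulr_ge0 ?(ltW n0) // mulr_ge0 ?sqr_ge0 // divr_ge0 ?sqr_ge0 // ltW.
have -> : x * m + (a * x) ^+ 2 * d + (n / a) ^+ 2 *
      (a * x ^+ 2 * d + n * (b ^+ 2 * d + (a / b) ^+ 2 * (b + b ^+ 2 / x))) =
    t1 + t2 + t3 + t4 + t5 + t6.
  by rewrite /t1 /t2 /t3 /t4 /t5 /t6; field; rewrite !lt0r_neq0.
have s1 : n * x <= t5.
  rewrite ler_pdivlMr // (_ : n ^+ 3 = n * n * n); last by ring.
  by apply: ler_pM; rewrite ?mulr_ge0 ?(ltW n0) ?(ltW x0) ?(ltW b0) // ?ler_wpM2l ?(ltW n0) //; lra.
have s2 : x * a <= t5.
  by apply: le_trans s1; rewrite mulrC ler_wpM2r // ltW.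
have s3 : x * n ^+ 2 / a <= t5.
  rewrite ler_pdivlMr // mulrAC ler_pdivrMr // (_ : n ^+ 3 * a = n * n ^+ 2 * a); last by ring.
  rewrite mulrAC [leRHS]mulrAC ler_wpM2r ?sqr_ge0 //.
  by apply: ler_pM => //; apply: ltW.
have s4 : (n / a) ^+ 2 * (n * b) <= t5.
  rewrite ler_pdivlMr // (_ : _ * (n * b) * b = n ^+ 3 * (b / a) ^+ 2); last first.
    by field; rewrite lt0r_neq0.
  rewrite ger_pMr ?exprn_gt0 //; apply: exprn_ile1; last by rewrite ler_pdivrMr // mul1r.
  by rewrite divr_ge0 // ltW.
have -> : (21 * n * Lam + 48 * Lam * x * (a / delta ^+ 2 * (a / n) + 2 * n / (delta * a)))
    * (x / n * (2 * m)) =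
    Lam * (42 * t1 + 96 * i ^+ 2 * t2 + 192 * i * t3).
  by rewrite /t1 /t2 /t3 /i /d; field; rewrite !lt0r_neq0.
have -> : 21 * n * Lam * x +
   48 * Lam * x * (a / delta ^+ 2 + 2 * n / (delta * a) * n) +
   4 * (2 * (n / a) ^+ 2 * (48 * Lam *
     (b ^+ 2 / (a * delta ^+ 2) * (a / n * (2 * m)) +
      n * (b / delta ^+ 2 + 4 * a ^+ 2 / (delta * b))))) =
   Lam * (21 * (n * x) + 48 * i ^+ 2 * (x * a) + 96 * i * (x * n ^+ 2 / a) +
     768 * i ^+ 2 * t4 + 384 * i ^+ 2 * ((n / a) ^+ 2 * (n * b)) + 1536 * i * t5).
  by rewrite /t4 /t5 /i /d; field; rewrite !lt0r_neq0.
have -> : 16 * (2 * (n / a) ^+ 2 * (2 * (a / b) ^+ 2)) * (b ^+ 2 * n / x) = 64 * t6.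
  by rewrite /t6; field; rewrite !lt0r_neq0.
(* Origin of the constants: 64 covers 42, 21 and 64; 800 covers the coefficients 96, 768 and 48 +
   384 of 1 / delta^2; 2000 covers the coefficients 192 and 96 + 1536 of 1 / delta. *)
have -> : 64 + 800 / delta ^+ 2 + 2000 / delta = 64 + 800 * i ^+ 2 + 2000 * i.
  by rewrite /i exprVn.
(* The [Delta] term comes without a logarithm; Lam >= 1 puts it on the same footing as the
   others. *)
have t6L : 64 * t6 <= Lam * (64 * t6) by rewrite ler_peMl // mulr_ge0.
apply: le_trans (lerD (lexx _) t6L) _.
rewrite -!mulrDr [leRHS]mulrCA ler_pM2l //.
move: s1 s2 s3 s4; move: (n * x) (x * a) (x * n ^+ 2 / a) (_ * (n * b)) => u1 u2 u3 u4.
move: t1_ge0 t2_ge0 t3_ge0 t4_ge0 t5_ge0 t6_ge0; clear t6L.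
move: (t1) (t2) (t3) (t4) (t5) (t6) => {}t1 {}t2 {}t3 {}t4 {}t5 {}t6.
move=> h1 h2 h3 h4 h5 h6 e1 e2 e3 e4.
have ii0 : 0 < i ^+ 2 by rewrite exprn_gt0.
have f2 := ler_wpM2l (ltW ii0) e2; have f3 := ler_wpM2l (ltW i0) e3.
have f4 := ler_wpM2l (ltW ii0) e4.
have p k : 0 <= k -> 0 <= i * k /\ 0 <= i ^+ 2 * k.
  by move=> k0; rewrite !mulr_ge0 // ltW.
have [p1 q1] := p _ h1; have [p2 q2] := p _ h2; have [p3 q3] := p _ h3.
have [p4 q4] := p _ h4; have [p5 q5] := p _ h5; have [p6 q6] := p _ h6.
move: (i ^+ 2) ii0 f2 f4 q1 q2 q3 q4 q5 q6 {p} => ii ii0 f2 f4 q1 q2 q3 q4 q5 q6.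
lra.
Qed.

(** * Negative complexity of the learning graph for Triangle *)

Section TriangleCost.
Variables (R : realType) (n m x a b : nat) (delta : R).
Hypotheses (x_bound : (1 <= x <= n)%N) (b_gt1 : (1 < b)%N) (ba : (b <= a)%N).
Hypotheses (an : (a <= n)%N) (delta_gt0 : 0 < delta).
Hypotheses (sep_ba : separated delta b a) (sep_an : separated delta a n).
Variable z : {set vpair n}.
Hypothesis zm : #|z| = m.
Implicit Types (u v w t : 'I_n) (X A B : {set 'I_n}).

Local Notation deg v := (#|nbhd z v|%:R : R).
Local Notation Lam := (2 * ln (n%:R : R)).
Local Notation mR := (m%:R : R).
Local Notation nR := (n%:R : R).
Local Notation xR := (x%:R : R).
Local Notation aR := (a%:R : R).
Local Notation bR := (b%:R : R).

Let n_gt1 : (1 < n)%N. Proof. exact: leq_trans (leq_trans b_gt1 ba) an. Qed.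
Let n0 : 0 < nR. Proof. by rewrite ltr0n ltnW. Qed.
Let a0 : 0 < aR. Proof. by rewrite ltr0n (ltnW (leq_trans b_gt1 ba)). Qed.
Let b0 : 0 < bR. Proof. by rewrite ltr0n ltnW. Qed.
Let x0 : 0 < xR. Proof. by rewrite ltr0n; case/andP: x_bound. Qed.

Lemma Lam_ge1 : 1 <= Lam.
Proof.
have : ln (2 : R) <= ln nR by rewrite ler_ln ?posrE // ?ltr0n // ler_nat.
by have := ln2_ge R; lra.
Qed.

(** There are C(n, 2) pairs, fewer than n^2, so 2 ln n dominates the logarithm of every
    SparseLoad. *)
Lemma ln_card_le (U : {set vpair n}) : ln (#|U|.+1%:R : R) <= Lam.
Proof.
have -> : Lam = ln (nR ^+ 2) by rewrite lnXn // mulr_natl.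
rewrite ler_ln ?posrE ?exprn_gt0 ?ltr0n //; last exact: ltnW.
rewrite -natrX ler_nat.
have : (#|U| <= 'C(n, 2))%N.
  apply: leq_trans (max_card _) _.
  have := card_draws 'I_n 2; rewrite card_ord => <-; rewrite card_sig.
  by apply/eq_leq/eq_card => A; rewrite !inE.
have := mul_bin_left n 1; rewrite bin1 -mulnn; move: n_gt1; nia.
Qed.

Lemma sum_degR : \sum_v deg v <= 2 * mR.
Proof. by rewrite -natr_sum -natrM ler_nat -zm; apply: sum_degree. Qed.

Lemma graph_Ht_C0 t : C0 (graph_Ht R m t) z <= 7 * nR * Lam * (deg t + 1).
Proof.
apply: le_trans (load_then_C0 (fun lam => search_edge_wf _ _ _ _) z) _.
set S := pairs _ _.
have nb : nbhd (z :&: S) t = nbhd z t.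
  by apply/setP => u; rewrite !nbhdE; apply: adj_setI (set11 t) (in_setT u) _.
have degn : (#|nbhd z t| <= n)%N by rewrite -[X in (_ <= X)%N]card_ord max_card.
(* The 7 splits into 6 for loading the n pairs at [t] and 1 for the search, whose cost deg^2 is at
   most n * deg. *)
have -> : 7 * nR * Lam * (deg t + 1) =
  6 * nR * #|nbhd z t|.+1%:R * Lam + nR * Lam * (deg t + 1).
  by rewrite -[#|_|.+1%:R]natr1; ring.
apply: lerD.
  apply: load_cost_le; last exact: ln_card_le.
    by rewrite /S pairsC; apply: leq_trans (card_pairs1 _ _) _; rewrite cardsT card_ord.
  rewrite /S pairsC; apply: leq_trans (card_pairs1z _ _ _) _.
  under eq_bigr do rewrite adjC.
  by rewrite sum_adj setIT.
apply: le_trans (search_edge_C0 _ _ _ _ _) _.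
rewrite nb cardsX natrM -mulrA.
have d0 : 0 <= deg t by [].
have dn : deg t <= nR by rewrite ler_nat.
apply: ler_pM => //.
by have := Lam_ge1; nra.
Qed.

Lemma graph_H_C0 X :
  C0 (graph_H R m X) z <= 21 * nR * Lam * (\sum_(t in X) deg t + #|X|%:R).
Proof.
rewrite or_C0; last by move=> t; apply: graph_Ht_wf.
rewrite -(big_sub (mem X) (fun t => C1max (graph_Ht R m t) (YHt m t) / 1%:R *
  C0 (graph_Ht R m t) z)).
rewrite -sum1_card natr_sum -big_split mulr_sumr /=; apply: ler_sum => t _.
have -> : 21 * nR * Lam * (deg t + 1) = 3 * (7 * nR * Lam * (deg t + 1)) by ring.
rewrite divr1; apply: ler_pM; first exact: C1max_ge0.
- exact: C0_ge0 (graph_Ht_wf _ _ _).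
- exact: graph_Ht_C1max.
- exact: graph_Ht_C0.
Qed.

(** Having no common neighbour in [X] is antitone in the graph, so forgetting pairs might enlarge
    [Delta]. It does not, because B is inside A and all pairs between [X] and A are loaded. *)
Lemma Delta_loaded X A B w : B \subset A ->
  Delta (z :&: (pairs X A :|: pairs [set w] B)) X B w \subset Delta z X B w.
Proof.
move=> /subsetP BA; set lam := z :&: _.
have sub : lam \subset z := subsetIl _ _.
apply/subsetP => -[u v]; rewrite !inE /= => /and5P[uB vB /eqP e uw vw].
rewrite uB vB !(adjS sub) ?andbT //=; apply/eqP/setP => t; rewrite !inE.
apply/negP => /andP[/andP[ut vt] tX].
have loaded i : i \in B -> adj z i t -> adj lam i t.
  move=> iB; rewrite /lam adjC [adj _ i t]adjC (adj_setI z tX (BA _ iB)) //.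
  exact: subsetUl.
by move/setP/(_ t): e; rewrite !inE !loaded ?tX.
Qed.

Lemma graph_FAw_C0 X A w : #|A| = a ->
  C0 (graph_FAw R m b X A (z :&: pairs X A) w) z <=
  12 * Lam * (bR ^+ 2 / (aR * delta ^+ 2) * \sum_(j in A) (adj z w j)%:R +
              bR / delta ^+ 2 + 4 * aR ^+ 2 / (delta * bR)) +
  'C(a.-2, b.-2)%:R^-1 *
    \sum_(B : {set 'I_n} | (B \subset A) && (#|B| == b)) #|Delta z X B w|%:R.
Proof.
move=> cA; set lam := z :&: pairs X A.
have bA : (b <= #|A|)%N by rewrite cA.
have sepA : separated delta b #|A| by rewrite cA.
have load1 j : (#|pairs [set w] [set j]| <= 1)%N by apply: card_pair1.
have load1z j : (#|z :&: pairs [set w] [set j]| <= adj z w j)%N by apply: card_pair1z.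
have load_cup B s : s \in pairs [set w] B ->
    exists2 j, j \in B & s \in pairs [set w] [set j] by apply: pairs_cup.
have wfB B lam' := search_edge_wf R (pairs X A :|: pairs [set w] B)
  (Delta lam' X B w) (YFAwB m X A lam w B lam').
have := johnson_C0_le (YFAw m X A lam w)
  (fun y => [pick p : 'I_n * 'I_n | [&& p.1 \in A, p.2 \in A & triangle y p.1 p.2 w]])
  (fun B lam' => YFAwB m X A lam w B lam')
  (@pairs_load_mono n [set w]) load_cup wfB b_gt1 bA
  ln_card_le load1 load1z delta_gt0 sepA.
rewrite -/(graph_FAw R m b X A lam w) cA => h; apply: le_trans h _.
have s0 : 0 <= \sum_(j in A) (adj z w j)%:R :> R by apply: sumr_ge0.
(* The crude bound by [a] is used in the term of stages 1 and 2 only; the stage 0 term keeps the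
   sum, to be averaged over w and A later. *)
have sa : \sum_(j in A) (adj z w j)%:R <= aR.
  rewrite -natr_sum ler_nat -cA -sum1_card; apply: leq_sum => j _.
  by case: (adj z w j).
set s := \sum_(j in A) _ in s0 sa *.
have L0 : 0 <= Lam by have := Lam_ge1; lra.
apply: lerD.
  rewrite mulr1; apply: ler_wpM2l; first by rewrite mulr_ge0.
  have -> : bR / delta ^+ 2 * (bR / aR * s + 1) =
            bR ^+ 2 / (aR * delta ^+ 2) * s + bR / delta ^+ 2.
    by field; rewrite !lt0r_neq0.
  rewrite lerD2l.
  have -> : 4 * aR ^+ 2 / (delta * bR) = 2 * aR / (delta * bR) * (aR + aR).
    by field; rewrite !lt0r_neq0.
  apply: ler_wpM2l; first by rewrite divr_ge0 ?mulr_ge0 // ltW.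
  by rewrite lerD2r.
rewrite mulr_sumr; apply: ler_sum => B /andP[BA _].
rewrite /n_used cA [_ / _]mulrC -mulrA; apply: ler_wpM2l; first by rewrite invr_ge0.
apply: (@le_trans _ _ (1 * C0 (search_edge R (pairs X A :|: pairs [set w] B)
  (Delta (z :&: (pairs X A :|: pairs [set w] B)) X B w)
  (YFAwB m X A lam w B (z :&: (pairs X A :|: pairs [set w] B)))) z)).
  apply: ler_wpM2r; first exact: C0_ge0 (wfB _ _).
  by apply: C1max_le => // y _; apply: search_edge_C1.
rewrite mul1r; apply: le_trans (search_edge_C0 _ _ _ _ _) _.
by rewrite ler_nat; apply/subset_leq_card/Delta_loaded.
Qed.

Lemma graph_FA_C0 X A : #|A| = a ->
  C0 (graph_FA R m b X A (z :&: pairs X A)) z <=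
  48 * Lam * (bR ^+ 2 / (aR * delta ^+ 2) * \sum_(j in A) deg j +
              nR * (bR / delta ^+ 2 + 4 * aR ^+ 2 / (delta * bR))) +
  4 / 'C(a.-2, b.-2)%:R *
    \sum_(B : {set 'I_n} | (B \subset A) && (#|B| == b))
      \sum_w #|Delta z X B w|%:R.
Proof.
move=> cA; rewrite or_C0; last by move=> w; apply: graph_FAw_wf.
(* Summing over all [w] turns the adjacencies of [w] into the degrees of the vertices of [A]. *)
have -> : \sum_(j in A) deg j = \sum_w \sum_(j in A) (adj z w j)%:R.
  rewrite exchange_big; apply: eq_bigr => j _.
  rewrite -natr_sum; congr (_%:R); under eq_bigr do rewrite adjC.
  by rewrite -[nbhd z j]setIT -sum_adj; apply: eq_bigl => w; rewrite inE.
apply: (@le_trans _ _ (\sum_w 4 * (12 * Lam * (bR ^+ 2 / (aR * delta ^+ 2) *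
    \sum_(j in A) (adj z w j)%:R + bR / delta ^+ 2 + 4 * aR ^+ 2 / (delta * bR)) +
  'C(a.-2, b.-2)%:R^-1 *
    \sum_(B : {set 'I_n} | (B \subset A) && (#|B| == b)) #|Delta z X B w|%:R))).
  apply: ler_sum => w _; rewrite divr1; apply: ler_pM; first exact: C1max_ge0.
  - exact: C0_ge0 (graph_FAw_wf R m b_gt1 X A _ w).
  - apply: C1max_le => // y yw; apply: graph_FAw_C1 yw _ => //.
    by rewrite cA.
  - exact: graph_FAw_C0.
rewrite -mulr_sumr big_split /= -!mulr_sumr !big_split /= -!mulr_sumr.
have sumc (c : R) : \sum_(w < n) c = nR * c by rewrite sumr_const card_ord mulr_natl.
rewrite !sumc [X in _^-1 * X]exchange_big /=.
by rewrite -subr_ge0 (_ : _ - _ = 0) //; ring.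
Qed.

Local Notation N1 := ('C(n.-2, a.-2)%:R : R).
Local Notation N2 := ('C(a.-2, b.-2)%:R : R).

(** The total size of [Delta] over all A, B and w. It is left unestimated for a fixed [X], since
    only the average over [X] makes it small. *)
Definition blind_sum X : R :=
  \sum_(A : {set 'I_n} | #|A| == a)
    \sum_(B : {set 'I_n} | (B \subset A) && (#|B| == b)) \sum_w #|Delta z X B w|%:R.

Let N1_gt0 : 0 < N1. Proof. exact: bin_used_gt0 (leq_trans b_gt1 ba) an. Qed.
Let N2_gt0 : 0 < N2. Proof. exact: bin_used_gt0. Qed.
Let L1 : 1 <= Lam. Proof. exact: Lam_ge1. Qed.
Let L0 : 0 <= Lam. Proof. by move: L1; lra. Qed.

(** A random k-set carries on average the share k / n of the degree sum, itself at most 2m; this is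
    where the density enters. *)
Lemma sum_draws_degree k :
  \sum_(A : {set 'I_n} | #|A| == k) \sum_(j in A) deg j <=
  'C(n, k)%:R * (k%:R / nR * (2 * mR)).
Proof.
have := @sum_draws R _ [set: 'I_n] k (fun j => deg j).
rewrite cardsT card_ord => /(_ (ltnW n_gt1)).
under eq_bigl do rewrite subsetT; move=> ->.
rewrite mulrAC mulrC; apply: ler_wpM2l => //; apply: ler_wpM2l; first by rewrite divr_ge0.
by rewrite (eq_bigl xpredT) ?sum_degR // => j; rewrite inE.
Qed.

Lemma sum_size_const k (c : R) :
  \sum_(A : {set 'I_n} | #|A| == k) c = 'C(n, k)%:R * c.
Proof.
have := @sum_draws_const R _ [set: 'I_n] k c; rewrite cardsT card_ord => <-.
by apply: eq_bigl => A; rewrite subsetT.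
Qed.

Lemma sum_graph_FA X :
  N1^-1 * \sum_(A : {set 'I_n} | #|A| == a)
    C0 (graph_FA R m b X A (z :&: pairs X A)) z <=
  2 * (nR / aR) ^+ 2 * (48 * Lam *
     (bR ^+ 2 / (aR * delta ^+ 2) * (aR / nR * (2 * mR)) +
      nR * (bR / delta ^+ 2 + 4 * aR ^+ 2 / (delta * bR)))) +
  4 / (N1 * N2) * blind_sum X.
Proof.
set K := nR * (_ + _); set u := bR ^+ 2 / _.
have d_ge0 := ltW delta_gt0.
have u0 : 0 <= u by rewrite /u divr_ge0 ?mulr_ge0 ?sqr_ge0.
have K0 : 0 <= K by rewrite /K mulr_ge0 // addr_ge0 // divr_ge0 ?mulr_ge0 ?sqr_ge0.
apply: (@le_trans _ _ (N1^-1 * \sum_(A : {set 'I_n} | #|A| == a)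
   (48 * Lam * u * (\sum_(j in A) deg j) + 48 * Lam * K + 4 / N2 *
    \sum_(B : {set 'I_n} | (B \subset A) && (#|B| == b)) \sum_w #|Delta z X B w|%:R))).
  apply: ler_wpM2l; first by rewrite invr_ge0 ltW.
  apply: ler_sum => A /eqP cA; apply: le_trans (graph_FA_C0 _ cA) _.
  by rewrite -/u -/K mulrDr mulrA.
rewrite big_split big_split /= -!mulr_sumr sum_size_const.
have -> : 4 / (N1 * N2) * blind_sum X = N1^-1 * (4 / N2 * blind_sum X).
  by field; rewrite !lt0r_neq0.
rewrite mulrDr; apply: lerD => //.
apply: (@le_trans _ _ (N1^-1 * ('C(n, a)%:R * (48 * Lam * (u * (aR / nR * (2 * mR)) + K))))).
  apply: ler_wpM2l; first by rewrite invr_ge0 ltW.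
  have := ler_wpM2l (mulr_ge0 (mulr_ge0 (ler0n R 48) L0) u0) (sum_draws_degree a).
  move=> h; apply: le_trans (lerD h (lexx _)) _.
  by rewrite -subr_ge0 (_ : _ - _ = 0) // /K; ring.
rewrite [leLHS]mulrA; apply: ler_wpM2r.
  apply: mulr_ge0; first by rewrite mulr_ge0 // L0.
  apply: addr_ge0 => //; apply: mulr_ge0 => //.
  by rewrite mulr_ge0 ?divr_ge0 ?mulr_ge0.
by rewrite mulrC; apply: bin_ratio_full (leq_trans b_gt1 ba) an.
Qed.

Lemma graph_F_C0 X : #|X| = x ->
  C0 (graph_F R m a b X) z <=
  12 * Lam * xR * (aR / delta ^+ 2 * (aR / nR * \sum_(t in X) deg t + 1) +
                   2 * nR / (delta * aR) * (\sum_(t in X) deg t + nR)) +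
  N1^-1 * \sum_(A : {set 'I_n} | #|A| == a)
    C0 (graph_FA R m b X A (z :&: pairs X A)) z.
Proof.
move=> cX.
have aT : (a <= #|[set: 'I_n]|)%N by rewrite cardsT card_ord.
have sepT : separated delta a #|[set: 'I_n]| by rewrite cardsT card_ord.
have load1 j : (#|pairs X [set j]| <= x)%N by rewrite -cX card_pairs1.
have load1z j : (#|z :&: pairs X [set j]| <= \sum_(t in X) adj z t j)%N
  by apply: card_pairs1z.
have load_cup A s : s \in pairs X A ->
    exists2 j, j \in A & s \in pairs X [set j] by apply: pairs_cup.
have := johnson_C0_le (YF m X)
  (fun y => [pick p : 'I_n * 'I_n | [exists w, triangle y p.1 p.2 w]])
  (YFA m X) (@pairs_load_mono n X) load_cup (graph_F_load_wf R m b_gt1 X)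
  (leq_trans b_gt1 ba) aT ln_card_le load1 load1z delta_gt0 sepT.
rewrite -/(graph_F R m a b X) cardsT card_ord => h; apply: le_trans h _.
(* Edges between [X] and all vertices, counted from the side of [X]. *)
have -> : \sum_(j in [set: 'I_n]) (\sum_(t in X) adj z t j)%:R = \sum_(t in X) deg t.
  under eq_bigr do rewrite natr_sum.
  rewrite exchange_big; apply: eq_bigr => t _.
  by rewrite -natr_sum sum_adj setIT.
apply: lerD => //.
rewrite mulr_sumr; under [leLHS]eq_bigl do rewrite subsetT.
apply: ler_sum => A /eqP cA; rewrite set0U /n_used cardsT card_ord.
apply: ler_wpM2r; first exact: C0_ge0 (graph_FA_wf _ _ _ _ _ _).
rewrite -[leRHS]mul1r; apply: ler_wpM2r; first by rewrite invr_ge0.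
apply: or_C1max_le; last exact: ltnSn.
by move=> w; apply: graph_FAw_wf.
Qed.

(** Apart from [blind_sum], the bound for [graph_X] is affine in the degree sum of [X]. The slope
    collects 21 from [graph_H] and 48 = 4 * 12 from the outer Johnson stages; [cost_const] collects
    what depends on [X] only through its size. *)
Definition cost_slope : R := 21 * nR * Lam +
  48 * Lam * xR * (aR / delta ^+ 2 * (aR / nR) + 2 * nR / (delta * aR)).

Definition cost_const : R := 21 * nR * Lam * xR +
   48 * Lam * xR * (aR / delta ^+ 2 + 2 * nR / (delta * aR) * nR) +
   4 * (2 * (nR / aR) ^+ 2 * (48 * Lam *
     (bR ^+ 2 / (aR * delta ^+ 2) * (aR / nR * (2 * mR)) +
      nR * (bR / delta ^+ 2 + 4 * aR ^+ 2 / (delta * bR))))).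

Lemma graph_X_C0 X : #|X| = x ->
  C0 (graph_X R m a b X) z <=
  cost_slope * (\sum_(t in X) deg t) + cost_const + 16 / (N1 * N2) * blind_sum X.
Proof.
move=> cX; rewrite or_C0; last exact: graph_HF_wf.
rewrite big_bool /= !divr1.
have hH : C1max (graph_H R m X) (YH m X) * C0 (graph_H R m X) z <=
    21 * nR * Lam * (\sum_(t in X) deg t + xR).
  rewrite -[leRHS]mul1r; apply: ler_pM; first exact: C1max_ge0.
  - exact: C0_ge0 (graph_H_wf _ _ _).
  - by apply: or_C1max_le; [move=> t; apply: graph_Ht_wf|exact: ltnSn].
  - by rewrite -cX; apply: graph_H_C0.
have hF : C1max (graph_F R m a b X) (YF m X) * C0 (graph_F R m a b X) z <=
    4 * C0 (graph_F R m a b X) z.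
  apply: ler_wpM2r; first exact: C0_ge0 (graph_F_wf _ _ b_gt1 ba _).
  exact: graph_F_C1max.
have := graph_F_C0 cX; have := sum_graph_FA X.
move=> h1 h2; have {h1}h2 := le_trans h2 (lerD (lexx _) h1).
apply: le_trans (lerD hH (le_trans hF (ler_wpM2l _ h2))) _ => //.
rewrite /cost_slope /cost_const -subr_ge0 (_ : _ - _ = 0) //.
by field; rewrite !lt0r_neq0.
Qed.

Lemma sum_blind : \sum_(X : {set 'I_n} | #|X| == x) blind_sum X <=
  'C(n, a)%:R * ('C(a, b)%:R * ('C(n, x)%:R * (bR ^+ 2 * nR / xR))).
Proof.
(* The sum over [X] is moved inside those over A and B, so that [sum_Delta] applies to each fixed
   B. *)
rewrite exchange_big /= -sum_size_const; apply: ler_sum => A /eqP cA.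
have := @sum_draws_const R _ A b ('C(n, x)%:R * (bR ^+ 2 * nR / xR)).
rewrite cA => <-; rewrite exchange_big /=; apply: ler_sum => B /andP[_ /eqP cB].
rewrite [_ * (_ / xR)]mulrA ler_pdivlMr // mulrC.
have := sum_Delta z B x; rewrite cB -(ler_nat R) !natrM natr_sum.
under eq_bigr do rewrite natr_sum.
by move/le_trans; apply; rewrite -subr_ge0 (_ : _ - _ = 0) //; ring.
Qed.

Lemma triangle_graph_C0 :
  C0 (triangle_graph R n m x a b) z <=
  (64 + 800 / delta ^+ 2 + 2000 / delta) * (Lam *
    (xR * mR + (aR * xR) ^+ 2 * (mR / nR ^+ 2) + (nR / aR) ^+ 2 *
      (aR * xR ^+ 2 * (mR / nR ^+ 2) +
       nR * (bR ^+ 2 * (mR / nR ^+ 2) + (aR / bR) ^+ 2 * (bR + bR ^+ 2 / xR))))).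
Proof.
have /andP[_ xn] := x_bound.
have Cx : 0 < ('C(n, x)%:R : R) by rewrite ltr0n bin_gt0.
rewrite or_C0; last by move=> X; apply: graph_X_wf.
rewrite -(big_sub (fun X : {set 'I_n} => #|X| == x) (fun X =>
  C1max (graph_X R m a b X) (Ytri n m) / 'C(n, x)%:R * C0 (graph_X R m a b X) z)).
apply: (@le_trans _ _ ('C(n, x)%:R^-1 * \sum_(X : {set 'I_n} | #|X| == x)
  (cost_slope * (\sum_(t in X) deg t) + cost_const + 16 / (N1 * N2) * blind_sum X))).
  rewrite mulr_sumr; apply: ler_sum => X /eqP cX; apply: ler_pM.
  - by rewrite divr_ge0 ?C1max_ge0.
  - exact: C0_ge0 (graph_X_wf _ _ b_gt1 ba _).
  - rewrite -[leRHS]mul1r; apply: ler_wpM2r; first by rewrite invr_ge0.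
    by apply: or_C1max_le; [move=> h; apply: graph_HF_wf|exact: ltnSn].
  - exact: graph_X_C0.
rewrite big_split big_split /= -!mulr_sumr sum_size_const.
have slope0 : 0 <= cost_slope.
  have d_ge0 := ltW delta_gt0; rewrite /cost_slope; apply: addr_ge0.
    by apply: mulr_ge0 => //; apply: mulr_ge0.
  apply: mulr_ge0; first by apply: mulr_ge0 => //; apply: mulr_ge0.
  by rewrite addr_ge0 // ?mulr_ge0 ?invr_ge0 ?mulr_ge0 ?sqr_ge0.
have g0 : 0 <= 16 / (N1 * N2) by rewrite divr_ge0 // mulr_ge0.
apply: (@le_trans _ _ ('C(n, x)%:R^-1 * (
  cost_slope * ('C(n, x)%:R * (xR / nR * (2 * mR))) + 'C(n, x)%:R * cost_const +
  16 / (N1 * N2) * ('C(n, a)%:R * ('C(a, b)%:R * ('C(n, x)%:R * (bR ^+ 2 * nR / xR))))))).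
  apply: ler_wpM2l; first by rewrite invr_ge0.
  apply: lerD; last exact: ler_wpM2l sum_blind.
  by rewrite lerD2r; apply: ler_wpM2l (sum_draws_degree x).
(* The binomials of the average over [X] cancel. Of the two Johnson normalisations there remain the
   ratios of all plugged sets to used ones, to be bounded by [bin_ratio_full]. *)
have -> : 'C(n, x)%:R^-1 * (
  cost_slope * ('C(n, x)%:R * (xR / nR * (2 * mR))) + 'C(n, x)%:R * cost_const +
  16 / (N1 * N2) * ('C(n, a)%:R * ('C(a, b)%:R * ('C(n, x)%:R * (bR ^+ 2 * nR / xR))))) =
  cost_slope * (xR / nR * (2 * mR)) + cost_const +
  16 * ('C(n, a)%:R / N1 * ('C(a, b)%:R / N2)) * (bR ^+ 2 * nR / xR).
  by field; rewrite !lt0r_neq0.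
apply: le_trans (total_cost_le b0 _ _ x0 _ _ delta_gt0 L1); rewrite ?ler_nat //.
rewrite /cost_slope /cost_const lerD2l; apply: ler_wpM2r.
  by rewrite divr_ge0 ?mulr_ge0 ?sqr_ge0.
apply: ler_wpM2l => //; apply: ler_pM.
- by rewrite divr_ge0.
- by rewrite divr_ge0.
- exact: bin_ratio_full (leq_trans b_gt1 ba) an.
- exact: bin_ratio_full.
Qed.

End TriangleCost.

(** * Complexity bounds *)

Section Complexity.
Variable R : realType.

Definition complexity_bound (n m x a b : R) : R :=
  x * m + (a * x) ^+ 2 * (m / n ^+ 2) + (n / a) ^+ 2 *
    (a * x ^+ 2 * (m / n ^+ 2) +
     n * (b ^+ 2 * (m / n ^+ 2) + (a / b) ^+ 2 * (b + b ^+ 2 / x))).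

Lemma triangle_complexity_le (delta : R) (n m x a b : nat) : 0 < delta ->
  (1 <= x <= n)%N -> (2 <= b <= a)%N -> (a <= n)%N ->
  separated delta b a -> separated delta a n ->
  triangle_complexity R n m x a b <=
    Num.sqrt (2 * (64 + 800 / delta ^+ 2 + 2000 / delta)) *
    Num.sqrt (complexity_bound n%:R m%:R x%:R a%:R b%:R * ln n%:R).
Proof.
move=> d0 xn /andP[b1 ba] an sba san.
set K := 64 + _ + _; set T := complexity_bound _ _ _ _ _.
have K0 : 0 <= K.
  by rewrite !addr_ge0 // divr_ge0 ?sqr_ge0 // ltW.
rewrite -sqrtrM ?mulr_ge0 //; apply: ler_wsqrtr.
have -> : 2 * K * (T * ln n%:R) = K * (2 * ln n%:R * T) by ring.
have T0 : 0 <= K * (2 * ln n%:R * T).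
  rewrite !mulr_ge0 // /T /complexity_bound.
    by apply: ln_ge0; rewrite ler1n; lia.
  by rewrite !(addr_ge0, mulr_ge0, sqr_ge0, invr_ge0, exprn_ge0).
(* The outermost construction is an OR, so the positive factor is at most 1. The 2 in the constant
   comes from Lam = 2 ln n. *)
rewrite -[leRHS]mulr1; apply: ler_pM; first exact: bigmax0_ge0.
- exact: C1max_ge0.
- apply: le_bigmax0 => // z; rewrite !inE => /andP[/eqP zm _].
  exact: triangle_graph_C0.
- apply: or_C1max_le; last by rewrite bin_gt0; case/andP: xn.
  by move=> X; apply: graph_X_wf.
Qed.

Lemma powR_frac (y : R) (i k : nat) : y `^ (i%:R / k%:R) = (y `^ k%:R^-1) ^+ i.
Proof. by rewrite -powR_mulrn ?powR_ge0 // -powRrM mulrC. Qed.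

Lemma powR_root (y : R) (k : nat) : 0 <= y -> (0 < k)%N -> (y `^ k%:R^-1) ^+ k = y.
Proof.
by move=> y0 k0; rewrite -powR_frac divff ?powRr1 // pnatr_eq0 -lt0n.
Qed.

Lemma powR_expK (y : R) (k : nat) : 0 <= y -> (0 < k)%N -> (y ^+ k) `^ k%:R^-1 = y.
Proof.
move=> y0 k0; rewrite -powR_mulrn // -powRrM divff ?powRr1 //.
by rewrite pnatr_eq0 -lt0n.
Qed.

Lemma ceilnE (r : R) : 0 < r -> (ceiln r)%:R = (Num.ceil r)%:~R :> R.
Proof.
move=> r0; rewrite /ceiln natr_absz ger0_norm //.
by rewrite ltW // ceil_gt0.
Qed.

Lemma ceiln_ge (r : R) : 0 < r -> r <= (ceiln r)%:R.
Proof. by move=> r0; rewrite ceilnE // ceil_ge. Qed.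

Lemma ceiln_lt (r : R) : 0 < r -> (ceiln r)%:R < r + 1.
Proof.
by move=> r0; rewrite ceilnE //; have := ceilB1_lt r; rewrite intrD; lra.
Qed.

(* With n = u ^ 12 and m / n ^ 2 = s ^ 6, the parameters are a ~ u ^ 9 and
   b ~ c u ^ 6 / s ^ 2, and every term is O(s ^ 2 u ^ 30). *)
Lemma balanced_bound (c u s v w : R) :
  0 < c -> 1 <= u -> 0 < s -> s <= 1 -> 1 <= v <= 2 -> 1 <= w <= 2 ->
  complexity_bound (u ^+ 12) (s ^+ 6 * u ^+ 24) (w * (c * (u ^+ 6 / s ^+ 2)))
    (v * u ^+ 9) (w * (c * (u ^+ 6 / s ^+ 2))) <=
  (2 * c + 24 * c ^+ 2 + 2 / c) * (s * u ^+ 15) ^+ 2.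
Proof.
move=> c0 u1 s0 s1 /andP[v1 v2] /andP[w1 w2].
have u0 : 0 < u by lra.
have v0 : 0 < v by lra.
have w0 : 0 < w by lra.
pose P := (s * u ^+ 15) ^+ 2; have P0 : 0 < P by rewrite exprn_gt0 // mulr_gt0 ?exprn_gt0.
(* [v] and [w] are the rounding factors of the two ceilings. Since x = b, the last two terms of the
   bound coincide and merge into 2 / (w * c). *)
have -> : complexity_bound (u ^+ 12) (s ^+ 6 * u ^+ 24) (w * (c * (u ^+ 6 / s ^+ 2)))
    (v * u ^+ 9) (w * (c * (u ^+ 6 / s ^+ 2))) =
  P * (w * c * s ^+ 2 + (v * w * c) ^+ 2 + (w * c) ^+ 2 / (v * u ^+ 3) +
       (w * c / v) ^+ 2 + 2 / (w * c)).
  by rewrite /complexity_bound /P; field; rewrite !lt0r_neq0.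
rewrite mulrC ler_pM2r //.
have ss1 : s ^+ 2 <= 1 by rewrite exprn_ile1 // ltW.
have wc : w * c <= 2 * c by rewrite ler_pM2r.
have wc0 : 0 < w * c by rewrite mulr_gt0.
have e1 : w * c * s ^+ 2 <= 2 * c.
  by apply: le_trans wc; rewrite ger_pMr.
have wc2 : (w * c) ^+ 2 <= 4 * c ^+ 2.
  rewrite (_ : 4 * c ^+ 2 = (2 * c) ^+ 2); last by ring.
  by rewrite ler_pXn2r // nnegrE ltW // mulr_gt0.
have e2 : (v * w * c) ^+ 2 <= 16 * c ^+ 2.
  rewrite -mulrA exprMn (_ : 16 * c ^+ 2 = 2 ^+ 2 * (4 * c ^+ 2)); last by ring.
  by apply: ler_pM; rewrite ?sqr_ge0 // ler_pXn2r // nnegrE ltW.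
have u3 : 1 <= u ^+ 3 by rewrite exprn_ege1.
have e3 : (w * c) ^+ 2 / (v * u ^+ 3) <= 4 * c ^+ 2.
  apply: le_trans wc2; rewrite ler_pdivrMr ?mulr_gt0 ?exprn_gt0 //.
  by rewrite ler_peMr ?sqr_ge0 // mulr_ege1.
have e4 : (w * c / v) ^+ 2 <= 4 * c ^+ 2.
  apply: le_trans wc2; rewrite exprMn ler_piMr ?sqr_ge0 // exprn_ile1 ?invr_ge0 ?(ltW v0) //.
  by rewrite invf_le1.
have e5 : 2 / (w * c) <= 2 / c.
  by rewrite ler_pM2l // lef_pV2 ?posrE // ler_peMl // ltW.
(* The coefficient 24 of c^2 is 16 + 4 + 4. *)
move: e1 e2 e3 e4 e5; move: (w * c * s ^+ 2) ((v * w * c) ^+ 2) (_ / (v * u ^+ 3))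
  ((w * c / v) ^+ 2) (2 / (w * c)) (2 / c) (c ^+ 2) => *; lra.
Qed.

Lemma balanced_parameters (c kappa : R) : 0 < c -> 0 < kappa < 1 ->
  exists (C : R) (n0 : nat), forall n m : nat,
     (n0 <= n)%N -> (m <= 'C(n, 2))%N -> (0 < m)%N ->
     let q : R := c * (Num.sqrt n%:R / (m%:R / n%:R ^+ 2) `^ (1 / 3)) in
     q <= kappa * n%:R `^ (3 / 4) ->
     let a := ceiln (n%:R `^ (3 / 4) : R) in
     let b := ceiln q in
     [/\ (1 <= b <= n)%N, (2 <= b <= a)%N, (a <= n)%N
       & triangle_complexity R n m b a b <=
           C * (n%:R `^ (11 / 12) * m%:R `^ (1 / 6) * Num.sqrt (ln n%:R))].
Proof.
move=> c0 /andP[k0 k1].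
(* 1 - kappa separates [b] from [a], and 1/2 separates [a] from [n]. *)
pose delta := Num.min (1 - kappa) 2^-1.
have d0 : 0 < delta by rewrite lt_min subr_gt0 k1 invr_gt0 ltr0n.
have dk : delta <= 1 - kappa by rewrite ge_min lexx.
have d2 : delta <= 2^-1 by rewrite ge_min lexx orbT.
pose K := 2 * (64 + 800 / delta ^+ 2 + 2000 / delta).
exists (Num.sqrt K * Num.sqrt (2 * c + 24 * c ^+ 2 + 2 / c)).
(* 2^12 ensures u >= 2, hence 2 u^9 <= n. The second summand ensures c^2 n > 1, that is c u^6 > 1,
   and hence q > 1, since s <= 1. *)
exists (2 ^ 12 + ceiln ((c ^+ 2)^-1)%R)%N => n m n0n mn m0 q qk a b.
pose u : R := n%:R `^ 12%:R^-1; pose s : R := (m%:R / n%:R ^+ 2) `^ 6%:R^-1.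
have mn2 : (m <= n ^ 2)%N.
  by move: mn (mul_bin_left n 1); rewrite bin1 -mulnn; clear; nia.
have n_ge : (2 ^ 12 <= n)%N by apply: leq_trans n0n; apply: leq_addr.
have n_gt1 : (1 < n)%N.
  by apply: leq_trans n_ge; rewrite -[X in (X < _)%N](exp1n 12) ltn_exp2r.
have nR0 : 0 < (n%:R : R) by rewrite ltr0n ltnW.
have mR0 : 0 < (m%:R : R) by rewrite ltr0n.
have dens0 : 0 < m%:R / n%:R ^+ 2 :> R by rewrite divr_gt0 ?exprn_gt0.
have u0 : 0 < u by apply: powR_gt0.
have s0 : 0 < s by apply: powR_gt0.
have nE : n%:R = u ^+ 12 by rewrite /u powR_root ?ltW.
have densE : m%:R / n%:R ^+ 2 = s ^+ 6 :> R by rewrite /s powR_root ?ltW.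
have mE : m%:R = s ^+ 6 * u ^+ 24 :> R.
  by rewrite -densE nE -exprM -mulrA mulVf ?mulr1 // expf_neq0 // lt0r_neq0.
have n34 : n%:R `^ (3 / 4) = u ^+ 9.
  rewrite (_ : 3 / 4 = 9%:R / 12%:R); last by field.
  by rewrite powR_frac.
have n1112 : n%:R `^ (11 / 12) = u ^+ 11 by rewrite powR_frac.
have sqrtn : Num.sqrt n%:R = u ^+ 6.
  by rewrite nE (_ : u ^+ 12 = (u ^+ 6) ^+ 2) ?sqrtr_sqr ?ger0_norm ?exprn_ge0 ?ltW // -exprM.
have dens13 : (m%:R / n%:R ^+ 2) `^ (1 / 3) = s ^+ 2.
  rewrite (_ : 1 / 3 = 2%:R / 6%:R); last by field.
  by rewrite powR_frac.
have m16 : m%:R `^ (1 / 6) = s * u ^+ 4.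
  have su0 : 0 <= s * u ^+ 4 by rewrite mulr_ge0 ?exprn_ge0 ?ltW.
  rewrite mE div1r (_ : s ^+ 6 * u ^+ 24 = (s * u ^+ 4) ^+ 6); last by ring.
  by rewrite powR_expK.
have qE : q = c * (u ^+ 6 / s ^+ 2) by rewrite /q sqrtn dens13.
have u2 : 2 <= u.
  rewrite leNgt; apply/negP => ult; have : u ^+ 12 < 2 ^+ 12.
    by rewrite ltr_pXn2r ?nnegrE // ltW.
  by rewrite -nE -natrX ltr_nat ltnNge n_ge.
have s1 : s <= 1.
  rewrite leNgt; apply/negP => sgt; have : 1 < s ^+ 6 by rewrite exprn_egt1.
  rewrite -densE ltr_pdivlMr ?exprn_gt0 // mul1r -natrX ltr_nat.
  by rewrite ltnNge mn2.
have q1 : 1 < q.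
  have cu : 1 < c * u ^+ 6.
    rewrite -(ltr_pXn2r (ltn0Sn 1)) ?nnegrE ?mulr_ge0 ?exprn_ge0 ?ltW // expr1n.
    rewrite exprMn -exprM -nE -ltr_pdivrMl ?exprn_gt0 // mulr1.
    apply: le_lt_trans (ceiln_ge _) _; first by rewrite invr_gt0 exprn_gt0.
    rewrite ltr_nat; apply: leq_trans n0n.
    by rewrite -[X in (X < _)%N]add0n ltn_add2r expn_gt0.
  rewrite qE mulrA ltr_pdivlMr ?exprn_gt0 // mul1r; apply: le_lt_trans cu.
  by rewrite exprn_ile1 // ltW.
have q0 : 0 < q := lt_trans ltr01 q1.
have al0 : 0 < n%:R `^ (3 / 4) :> R by apply: powR_gt0.
have [a_ge a_lt] := (ceiln_ge al0, ceiln_lt al0).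
have [b_ge b_lt] := (ceiln_ge q0, ceiln_lt q0).
rewrite -/a -/b in a_ge a_lt b_ge b_lt.
have u9 : 1 <= u ^+ 9 by apply: exprn_ege1; apply: le_trans u2; rewrite ler1n.
have u9n : 2 * u ^+ 9 <= n%:R.
  rewrite nE (_ : u ^+ 12 = u ^+ 3 * u ^+ 9); last by rewrite -exprD.
  rewrite ler_pM2r ?exprn_gt0 //.
  have : 2 ^+ 3 <= u ^+ 3 by rewrite ler_pXn2r ?nnegrE // ltW.
  by apply: le_trans; rewrite -natrX ler_nat.
have b2 : (1 < b)%N by rewrite -(ltr_nat R); exact: lt_le_trans q1 b_ge.
have qal : q <= n%:R `^ (3 / 4).
  apply: le_trans qk _; rewrite ger_pMl // ltW //.
have ba : (b <= a)%N.
  by rewrite -ltnS -(ltr_nat R) -(@natr1 R a); clear -b_lt qal a_ge; lra.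
have an : (a <= n)%N.
  by rewrite -ltnS -(ltr_nat R) -(@natr1 R n); rewrite n34 in a_lt; clear -a_lt u9 u9n; lra.
(* [separated] involves k - 1, and a ceiling exceeds its argument by less than 1, so rounding does
   no harm. *)
have pred_lt k r : (0 < k)%N -> (k%:R : R) < r + 1 -> k.-1%:R < r.
  by move=> k_gt0; rewrite -{1}(prednK k_gt0) -natr1 ltrD2r.
have sba : separated delta b a.
  rewrite /separated; apply: le_trans (ltW (pred_lt _ _ (ltnW b2) b_lt)) _.
  apply: le_trans qk _; apply: ler_pM; [exact: ltW|exact: ltW| |exact: a_ge].
  by rewrite lerBrDr addrC -lerBrDr.
have san : separated delta a n.
  rewrite /separated; apply: le_trans (ltW (pred_lt _ _ (leq_trans (ltnW b2) ba) a_lt)) _.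
  rewrite n34; apply: le_trans (_ : 2^-1 * n%:R <= _); first by clear -u9n; lra.
  by apply: ler_wpM2r => //; clear -d2; lra.
have bn : (1 <= b <= n)%N by rewrite (ltnW b2) (leq_trans ba an).
split => //; first by rewrite b2 ba.
apply: le_trans (triangle_complexity_le m d0 bn _ an sba san) _; first by rewrite b2 ba.
rewrite -[leRHS]mulrA; apply: ler_wpM2l; first exact: sqrtr_ge0.
set T := complexity_bound _ _ _ _ _.
have T_le : T <= (2 * c + 24 * c ^+ 2 + 2 / c) * (s * u ^+ 15) ^+ 2.
  (* As u^9 and q are at least 1, a ceiling is less than twice its argument, so both rounding
     factors lie between 1 and 2. *)
  have aE : a%:R = a%:R / u ^+ 9 * u ^+ 9 :> R.
    by rewrite divfK // expf_neq0 // lt0r_neq0.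
  have bE : b%:R = b%:R / q * q :> R by rewrite divfK // lt0r_neq0.
  rewrite /T nE mE aE bE {2 4}qE.
  apply: balanced_bound => //; first by apply: le_trans u2; rewrite ler1n.
    rewrite ler_pdivlMr ?exprn_gt0 // mul1r ler_pdivrMr ?exprn_gt0 // -n34 a_ge /=.
    by rewrite n34 in a_lt *; clear -a_lt u9; lra.
  by rewrite ler_pdivlMr // mul1r ler_pdivrMr // b_ge /=; clear -b_lt q1; lra.
have ln0 : 0 <= ln n%:R :> R by apply: ln_ge0; rewrite ler1n ltnW.
have C0 : 0 <= 2 * c + 24 * c ^+ 2 + 2 / c.
  by rewrite !addr_ge0 ?mulr_ge0 ?sqr_ge0 ?invr_ge0 // ltW.
apply: le_trans (ler_wsqrtr (ler_wpM2r ln0 T_le)) _.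
rewrite -[_ * _ ^+ 2 * _]mulrA sqrtrM //; apply: ler_wpM2l; first exact: sqrtr_ge0.
(* n^(11/12) m^(1/6) = u^11 * s u^4, which is exactly s u^15. *)
rewrite n1112 m16 sqrtrM ?sqr_ge0 // sqrtr_sqr.
apply: ler_wpM2r; first exact: sqrtr_ge0.
rewrite ger0_norm; last by rewrite mulr_ge0 ?exprn_ge0 ?ltW.
by rewrite -subr_ge0 (_ : _ - _ = 0) //; ring.
Qed.

End Complexity.

Theorem theorem5p2 (R : realType) :
  (forall n m x a b : nat,
     (1 <= x <= n)%N -> (2 <= b <= a)%N -> (a <= n)%N ->
     is_learning_graph (graphs n m) (@Triangle n) (triangle_graph R n m x a b))
  /\
  (forall delta : R, 0 < delta ->
   exists C : R, forall n m x a b : nat,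
     (1 <= x <= n)%N -> (2 <= b <= a)%N -> (a <= n)%N ->
     separated delta b a -> separated delta a n ->
     let d : R := m%:R / n%:R ^+ 2 in
     triangle_complexity R n m x a b <=
       C * Num.sqrt
         ((x%:R * m%:R + (a%:R * x%:R) ^+ 2 * d
           + (n%:R / a%:R) ^+ 2 *
             (a%:R * x%:R ^+ 2 * d
              + n%:R * (b%:R ^+ 2 * d
                        + (a%:R / b%:R) ^+ 2
                          * (b%:R + b%:R ^+ 2 / x%:R))))
          * ln n%:R))
  /\
  (forall c kappa : R, 0 < c -> 0 < kappa < 1 ->
   exists (C : R) (n0 : nat), forall n m : nat,
     (n0 <= n)%N -> (m <= 'C(n, 2))%N ->
     (n%:R : R) `^ (5 / 4) <= m%:R ->
     let q : R := c * (Num.sqrt n%:R / (m%:R / n%:R ^+ 2) `^ (1 / 3)) in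
     q <= kappa * n%:R `^ (3 / 4) ->
     let a := ceiln (n%:R `^ (3 / 4) : R) in
     let b := ceiln q in
     [/\ (1 <= b <= n)%N, (2 <= b <= a)%N, (a <= n)%N
       & triangle_complexity R n m b a b <=
           C * (n%:R `^ (11 / 12) * m%:R `^ (1 / 6) * Num.sqrt (ln n%:R))]).
Proof.
split; [|split].
- move=> n m x a b /andP[_ xn] /andP[b1 ba] an.
  exact: triangle_graph_correct.
- move=> delta d0.
  exists (Num.sqrt (2 * (64 + 800 / delta ^+ 2 + 2000 / delta))) => n m x a b xn ba an sba san.
  exact: triangle_complexity_le.
- move=> c kappa c0 k01; have [C [n0 CP]] := balanced_parameters c0 k01.
  (* The successor makes [n] positive, so that n^(5/4) > 0 and therefore m > 0. *)
  exists C, n0.+1 => n m n0n mn m54.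
  apply: CP => //; first exact: ltnW.
  rewrite -(ltr_nat R); apply: lt_le_trans m54; apply: powR_gt0.
  by rewrite ltr0n; apply: leq_ltn_trans n0n.
Qed.
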